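(* Let $\mathbb P$ be an $(S,\mathcal Y)$ coherent adequate type forcing, and let $\mu=2^\omega$. Then $\mathbb P$ collapses $\mu$ to have size $\omega_1$.
   Context: Let $\lambda\ge\omega_2$ be a cardinal of uncountable cofinality with $2^\omega<\lambda$, and let $Y\subseteq H(\lambda)$ be a predicate coding a well-ordering of $H(\lambda)$. Let $\langle r_i:i<2^\omega\rangle$ be the least (in that well-ordering) injective enumeration of $\mathcal P(\omega)$, and assume $Y$ codes the relation $Z$ where $Z(i,n)$ iff $i<2^\omega$ and $n\in r_i$. Let $\mathcal X$ be the set of all countable $N\subseteq H(\lambda)$ with $(N,\in,Y\cap N)\prec(H(\lambda),\in,Y)$. Let $\Lambda=\omega_2\cap\mathrm{cof}(\omega_1)$. For a set $N$ and ordinal $\gamma$, $\min(N\setminus\gamma)$ denotes the least ordinal of $N\cap\omega_2$ that is $\ge\gamma$. For $M\in\mathcal X$ let $\Lambda_M$ be the set of $\beta\in\Lambda$ with $\beta=\min(\Lambda\setminus\sup(M\cap\beta))$; for $M,N\in\mathcal X$, $\beta_{M,N}$ denotes the largest element of $\Lambda_M\cap\Lambda_N$. Write $M<N$ if $M\cap\beta_{M,N}\in N$; $M\sim N$ if $M\cap\beta_{M,N}=N\cap\beta_{M,N}$; $M\le N$ if $M<N$ or $M\sim N$. $A\subseteq\mathcal X$ is adequate if for all $M,N\in A$, $M<N$, $M\sim N$ or $N<M$. For $\{M,N\}$ adequate, $R_M(N)$ is the set of $\beta$ such that either $N\le M$ and $\beta=\min(N\setminus\beta_{M,N})$, or $\beta=\min(N\setminus\gamma)$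 for some ordinal $\gamma\in M\setminus\beta_{M,N}$; for adequate $A$, $R_A=\bigcup\{R_N(M):M,N\in A\}$. An isomorphism between $M,N\in\mathcal X$ is a bijection $\sigma:M\to N$ preserving $\in$ and membership in $Y$ in both directions; if it exists it is unique, denoted $\sigma_{M,N}$. $M\cong N$ (strongly isomorphic) means isomorphic with $\sigma_{M,N}(a)=a$ for all $a\in M\cap N$. $A\subseteq\mathcal X$ is coherent adequate if adequate and for all $M,N\in A$: (1) $M\sim N$ implies $M\cong N$; (2) if $M<N$ there is $N'\in A$ isomorphic to $N$ with $M\in N'$; (3) if $M,N$ isomorphic and $K\in M\cap A$ then $\sigma_{M,N}(K)\in A$. For $S\subseteq\omega_2$, $A$ is $(S)$ coherent adequate if it is coherent adequate and $R_A\subseteq S$. Fix $S\subseteq\omega_2$ with $S\cap\mathrm{cof}(\omega_1)$ stationary, and $\mathcal Y\subseteq\mathcal X$ stationary in $P_{\omega_1}(H(\lambda))$ and closed under isomorphisms (if $M,N\in\mathcal Y$ are isomorphic and $K\in M\cap\mathcal Y$ then $\sigma_{M,N}(K)\in\mathcal Y$). A condition $q$ is strongly $M$-generic if every set dense in the poset $M\cap\mathbb P$ is predense below $q$. A forcing poset $\mathbb P$ is an $(S,\mathcal Y)$ coherent adequate type forcing if there is $m<\omega$ (the sequence $x_0,\dots,x_m$ may also be empty) such that conditions have the form $(x_0,\ldots,x_m,A)$ and: (I) $x_0,\dots,x_m$ are finite subsets of $H(\lambda)$; (II) $A$ is a finite $(S)$ coherent adequate subset of $\mathcal Y$; (III)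 if $(y_0,\dots,y_m,B)\le(x_0,\dots,x_m,A)$, $N,N'\in B$ are isomorphic and $(x_0,\dots,x_m,A)\in N$, then $\sigma_{N,N'}((x_0,\dots,x_m,A))\in\mathbb P$ and $(y_0,\dots,y_m,B)\le\sigma_{N,N'}((x_0,\dots,x_m,A))$; (IV) if $M_0,\dots,M_n\in\mathcal Y$ are isomorphic, $\{M_0,\dots,M_n\}$ is $(S)$ coherent adequate and $(x_0,\dots,x_m,A)\in M_0\cap\dots\cap M_n$, then some $(y_0,\dots,y_m,B)\le(x_0,\dots,x_m,A)$ has $M_0,\dots,M_n\in B$; (V) for all $M\in A$, $(x_0,\dots,x_m,A)$ is strongly $M$-generic.
   Formalization: The definition of an (S,Y) coherent adequate type forcing is given the extra clause that (y,B) ≤ (x,A) implies A ⊆ B; with (I)–(V) alone the claim fails when CH fails, e.g. for all finite coherent adequate sets with any two conditions below each other. *)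

(* Defs.v *)
From Stdlib Require Import List Classical ClassicalEpsilon.
From Stdlib Require Import FunctionalExtensionality PropExtensionality ProofIrrelevance.

Set Implicit Arguments.

(** The universe of sets: a model of second-order ZF, with ordinary equality as
    equality of sets. Replacement quantifies over all functional relations of
    the ambient logic (which gives separation), and foundation is
    well-foundedness of membership. The axiom of choice follows from
    replacement and the choice axiom of the ambient logic. *)
Record universe : Type := Universe {
  carrier :> Type;
  mem : carrier -> carrier -> Prop;
  empty : carrier;
  extensionality : forall x y, (forall z, mem z x <-> mem z y) -> x = y;
  foundation : well_founded mem;
  empty_ax : forall z, ~ mem z empty;
  pairing : forall x y, exists p, forall z, mem z p <-> z = x \/ z = y;
  union_ax : forall x, exists u, forall z, mem z u <-> exists y, mem y x /\ mem z y;
  power_ax : forall x, exists p, forall z,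
    mem z p <-> forall t, mem t z -> mem t x;
  replacement : forall x (R : carrier -> carrier -> Prop),
    (forall a b c, R a b -> R a c -> b = c) ->
    exists u, forall b, mem b u <-> exists a, mem a x /\ R a b;
  infinity : exists w, mem empty w /\
    forall n, mem n w ->
      exists s, mem s w /\ forall z, mem z s <-> mem z n \/ z = n
}.

Arguments mem {u} x y.
Arguments empty {u}.

Notation "x ∈ y" := (mem x y) (at level 70).
Notation "x ⊆ y" := (forall z, z ∈ x -> z ∈ y) (at level 70).

(** First-order formulas in the language with membership, equality and one
    unary predicate symbol, with de Bruijn variables. *)
Inductive form : Type :=
  | Mem (i j : nat)
  | Eq (i j : nat)
  | Pred (i : nat)
  | Bot
  | Imp (A B : form)
  | All (A : form).

Definition scons {T : Type} (a : T) (e : nat -> T) : nat -> T :=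
  fun n => match n with O => a | Datatypes.S k => e k end.

Section SetTheory.

Context {U : universe}.
Implicit Types x y z a b c f p q alpha beta gamma kappa lam : U.

Definition the (Phi : U -> Prop) : U := epsilon (inhabits empty) Phi.

(** [setof Phi] is the set of all [z] with [Phi z]; it is meaningless when that
    class is proper. *)
Definition setof (Phi : U -> Prop) : U := the (fun s => forall z, z ∈ s <-> Phi z).

Definition upair x y : U := setof (fun z => z = x \/ z = y).
Definition opair x y : U := upair (upair x x) (upair x y).
Definition union x : U := setof (fun z => exists y, y ∈ x /\ z ∈ y).
Definition inter x y : U := setof (fun z => z ∈ x /\ z ∈ y).
Definition powerset x : U := setof (fun z => z ⊆ x).
Definition succ x : U := setof (fun z => z ∈ x \/ z = x).

Definition is_bij f a b : Prop :=
  (forall z, z ∈ f -> exists x y, x ∈ a /\ y ∈ b /\ z = opair x y) /\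
  (forall x, x ∈ a -> exists! y, opair x y ∈ f) /\
  (forall y, y ∈ b -> exists! x, opair x y ∈ f).

Definition equinum a b : Prop := exists f, is_bij f a b.
Definition lec a b : Prop := exists c, c ⊆ b /\ equinum a c.

Definition transitive x : Prop := forall y, y ∈ x -> y ⊆ x.
Definition ordinal x : Prop := transitive x /\ forall y, y ∈ x -> transitive y.

(** The least ordinal satisfying [Phi], as the intersection of all such ordinals;
    meaningless if there are none. *)
Definition least_ord (Phi : U -> Prop) : U :=
  setof (fun xi => forall kappa, ordinal kappa -> Phi kappa -> xi ∈ kappa).

Definition card x : U := least_ord (fun kappa => equinum kappa x).
Definition is_cardinal kappa : Prop := ordinal kappa /\ card kappa = kappa.
Definition hartogs x : U := setof (fun alpha => ordinal alpha /\ lec alpha x).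

Fixpoint numeral (n : nat) : U :=
  match n with O => empty | Datatypes.S k => succ (numeral k) end.

Definition omega : U := setof (fun x => exists n, x = numeral n).
Definition omega1 : U := hartogs omega.
Definition omega2 : U := hartogs omega1.

(** The cardinal [2 ^ omega]. *)
Definition continuum : U := card (powerset omega).

Definition countable x : Prop := lec x omega.
Definition finite x : Prop := exists l : list U, forall z, z ∈ x <-> In z l.

(** Cofinality: the least cardinality of an unbounded subset; among ordinals
    [⊆] is [<=]. *)
Definition cf alpha : U :=
  least_ord (fun kappa => exists c, c ⊆ alpha /\ equinum kappa c /\
    forall beta, beta ∈ alpha -> exists gamma, gamma ∈ c /\ beta ⊆ gamma).

Definition trcl x : U := setof (fun y => forall t, transitive t -> x ⊆ t -> y ∈ t).
Definition H lam : U := setof (fun x => card (trcl x) ∈ lam).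

Definition club_omega2 (C : U) : Prop :=
  C ⊆ omega2 /\
  (forall alpha, alpha ∈ omega2 -> exists beta, beta ∈ C /\ alpha ∈ beta) /\
  (forall delta, delta ∈ omega2 -> delta <> empty ->
     union (inter C delta) = delta -> delta ∈ C).

Definition stationary_omega2 (T : U) : Prop :=
  forall C, club_omega2 C -> exists alpha, alpha ∈ C /\ alpha ∈ T.

(** Clubs and stationary sets in [P_{omega_1}(X)], the set of countable subsets
    of [X]. *)
Definition club_countable (X C : U) : Prop :=
  (forall a, a ∈ C -> a ⊆ X /\ countable a) /\
  (forall a, a ⊆ X -> countable a -> exists b, b ∈ C /\ a ⊆ b) /\
  (forall s : nat -> U, (forall n, s n ∈ C /\ s n ⊆ s (Datatypes.S n)) ->
     setof (fun z => exists n, z ∈ s n) ∈ C).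

Definition stationary_countable (X T : U) : Prop :=
  forall C, club_countable X C -> exists a, a ∈ C /\ a ∈ T.

(** Satisfaction in the structure [(D, ∈, Y ∩ D)]. *)
Fixpoint sat (D Y : U) (A : form) (e : nat -> U) : Prop :=
  match A with
  | Mem i j => e i ∈ e j
  | Eq i j => e i = e j
  | Pred i => e i ∈ Y
  | Bot => False
  | Imp A B => sat D Y A e -> sat D Y B e
  | All A => forall x, x ∈ D -> sat D Y A (scons x e)
  end.

Definition elementary (N D Y : U) : Prop :=
  N ⊆ D /\ (exists x, x ∈ N) /\
  forall (A : form) (e : nat -> U), (forall n, e n ∈ N) ->
    (sat N Y A e <-> sat D Y A e).

(** [Y] codes the binary relation [R] on [D]: [R] is definable without
    parameters in [(D, ∈, Y)]. (Variables above 1 only repeat the second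
    argument.) *)
Definition codes (D Y : U) (R : U -> U -> Prop) : Prop :=
  exists A : form, forall a b, a ∈ D -> b ∈ D ->
    (R a b <-> sat D Y A (scons a (fun _ => b))).

Definition well_ordering (D : U) (R : U -> U -> Prop) : Prop :=
  (forall a, a ∈ D -> ~ R a a) /\
  (forall a b c, a ∈ D -> b ∈ D -> c ∈ D -> R a b -> R b c -> R a c) /\
  (forall a b, a ∈ D -> b ∈ D -> R a b \/ a = b \/ R b a) /\
  (forall T : U, T ⊆ D -> (exists a, a ∈ T) ->
     exists a, a ∈ T /\ forall b, b ∈ T -> ~ R b a).

(** [r] is the [R]-least injective enumeration of [P(omega)] in length
    [2 ^ omega]. *)
Definition least_enumeration (R : U -> U -> Prop) (r : U) : Prop :=
  is_bij r continuum (powerset omega) /\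
  forall r', is_bij r' continuum (powerset omega) -> r' <> r -> R r r'.

Definition Zrel (r i n : U) : Prop :=
  i ∈ continuum /\ exists x, opair i x ∈ r /\ n ∈ x.

Definition XX lam (Y : U) : U :=
  setof (fun N => countable N /\ elementary N (H lam) Y).

Definition Lambda : U := setof (fun beta => beta ∈ omega2 /\ cf beta = omega1).

(** [beta = min (N \ gamma)]; no [beta] qualifies if that minimum does not exist. *)
Definition is_min (N gamma beta : U) : Prop :=
  beta ∈ N /\ beta ∈ omega2 /\ gamma ⊆ beta /\
  forall delta, delta ∈ N -> delta ∈ omega2 -> gamma ⊆ delta -> beta ⊆ delta.

Definition Lambda_of (M : U) : U :=
  setof (fun beta => beta ∈ Lambda /\ is_min Lambda (union (inter M beta)) beta).

(** The comparison point [beta_{M,N}]. *)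
Definition cmp (M N : U) : U :=
  the (fun beta => beta ∈ Lambda_of M /\ beta ∈ Lambda_of N /\
    forall gamma, gamma ∈ Lambda_of M -> gamma ∈ Lambda_of N -> gamma ⊆ beta).

Definition mlt (M N : U) : Prop := inter M (cmp M N) ∈ N.
Definition msim (M N : U) : Prop := inter M (cmp M N) = inter N (cmp M N).
Definition mle (M N : U) : Prop := mlt M N \/ msim M N.

Definition adequate lam (Y A : U) : Prop :=
  A ⊆ XX lam Y /\
  forall M N, M ∈ A -> N ∈ A -> mlt M N \/ msim M N \/ mlt N M.

(** [beta] belongs to [R_M(N)]. *)
Definition remainder (M N beta : U) : Prop :=
  (mle N M /\ is_min N (cmp M N) beta) \/
  (exists gamma, ordinal gamma /\ gamma ∈ M /\ ~ gamma ∈ cmp M N /\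
     is_min N gamma beta).

Definition is_iso (Y M N : U) (s : U -> U) : Prop :=
  (forall a, a ∈ M -> s a ∈ N) /\
  (forall b, b ∈ N -> exists! a, a ∈ M /\ s a = b) /\
  (forall a b, a ∈ M -> b ∈ M -> (a ∈ b <-> s a ∈ s b)) /\
  (forall a, a ∈ M -> (a ∈ Y <-> s a ∈ Y)).

Definition isomorphic (Y M N : U) : Prop := exists s, is_iso Y M N s.

(** [sigma_{M,N}]; its values outside [M] are irrelevant. *)
Definition sigma (Y M N : U) : U -> U :=
  epsilon (inhabits (fun x => x)) (is_iso Y M N).

Definition strongly_isomorphic (Y M N : U) : Prop :=
  isomorphic Y M N /\ forall a, a ∈ M -> a ∈ N -> sigma Y M N a = a.

Definition coherent_adequate lam (Y A : U) : Prop :=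
  adequate lam Y A /\
  (forall M N, M ∈ A -> N ∈ A -> msim M N -> strongly_isomorphic Y M N) /\
  (forall M N, M ∈ A -> N ∈ A -> mlt M N ->
     exists N', N' ∈ A /\ isomorphic Y N N' /\ M ∈ N') /\
  (forall M N K, M ∈ A -> N ∈ A -> isomorphic Y M N -> K ∈ M -> K ∈ A ->
     sigma Y M N K ∈ A).

Definition S_coherent_adequate lam (Y S A : U) : Prop :=
  coherent_adequate lam Y A /\
  forall M N beta, M ∈ A -> N ∈ A -> remainder N M beta -> beta ∈ S.

Definition closed_under_iso (Y YY : U) : Prop :=
  forall M N K, M ∈ YY -> N ∈ YY -> isomorphic Y M N -> K ∈ M -> K ∈ YY ->
    sigma Y M N K ∈ YY.

Definition forcing_poset (P : U) (le : U -> U -> Prop) : Prop :=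
  (exists p, p ∈ P) /\
  (forall p, p ∈ P -> le p p) /\
  (forall p q r, p ∈ P -> q ∈ P -> r ∈ P -> le p q -> le q r -> le p r).

Definition strongly_generic (P : U) (le : U -> U -> Prop) (M q : U) : Prop :=
  forall D : U,
    D ⊆ inter M P ->
    (forall p, p ∈ inter M P -> exists d, d ∈ D /\ le d p) ->
    forall r, r ∈ P -> le r q ->
      exists d s, d ∈ D /\ s ∈ P /\ le s r /\ le s d.

(** The tuple [(x_0, ..., x_{k-1}, A)], as nested ordered pairs; it is [A] itself
    if the sequence of [x_i] is empty. *)
Definition tuple (xs : list U) (A : U) : U := fold_right opair A xs.

(** [k] is the number [m + 1] of the components [x_0, ..., x_m], or 0 if there
    are none. The clause that [A ⊆ B] whenever [(y, B) <= (x, A)] makes explicit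
    the convention that extending a condition keeps its side conditions. The other
    clauses do not imply it: with [S] all of [omega_2] and [YY = XX], the poset of
    all finite coherent adequate sets in which any two conditions are below each
    other satisfies them, but it is a trivial forcing. *)
Definition coherent_adequate_type lam (Y S YY P : U) (le : U -> U -> Prop) : Prop :=
  forcing_poset P le /\
  exists k : nat,
    (forall p, p ∈ P -> exists xs A, length xs = k /\ p = tuple xs A) /\
    (forall xs A ys B, length xs = k -> length ys = k ->
       tuple xs A ∈ P -> tuple ys B ∈ P -> le (tuple ys B) (tuple xs A) ->
       A ⊆ B) /\
    (forall xs A, length xs = k -> tuple xs A ∈ P ->
       forall x, In x xs -> finite x /\ x ⊆ H lam) /\
    (forall xs A, length xs = k -> tuple xs A ∈ P ->
       finite A /\ A ⊆ YY /\ S_coherent_adequate lam Y S A) /\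
    (forall xs A ys B, length xs = k -> length ys = k ->
       tuple xs A ∈ P -> tuple ys B ∈ P -> le (tuple ys B) (tuple xs A) ->
       forall N N', N ∈ B -> N' ∈ B -> isomorphic Y N N' -> tuple xs A ∈ N ->
         sigma Y N N' (tuple xs A) ∈ P /\
         le (tuple ys B) (sigma Y N N' (tuple xs A))) /\
    (* [F] is the set of the finitely many models [M_0, ..., M_n], [n >= 0]. *)
    (forall F : U, finite F -> (exists M, M ∈ F) -> F ⊆ YY ->
       (forall M N, M ∈ F -> N ∈ F -> isomorphic Y M N) ->
       S_coherent_adequate lam Y S F ->
       forall xs A, length xs = k -> tuple xs A ∈ P ->
         (forall M, M ∈ F -> tuple xs A ∈ M) ->
         exists ys B, length ys = k /\ tuple ys B ∈ P /\
           le (tuple ys B) (tuple xs A) /\ F ⊆ B) /\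
    (forall xs A, length xs = k -> tuple xs A ∈ P ->
       forall M, M ∈ A -> strongly_generic P le M (tuple xs A)).

(** Formulas of the forcing language, with names as parameters. Binders are
    represented by functions on names. *)
Inductive fml : Type :=
  | FMem (a b : U)
  | FEq (a b : U)
  | FAnd (A B : fml)
  | FNot (A : fml)
  | FAll (F : U -> fml).

Inductive is_name (P : U) : U -> Prop :=
  | IsName a :
      (forall z, z ∈ a -> exists c s, z = opair c s /\ is_name P c /\ s ∈ P) ->
      is_name P a.

(** No greatest condition is assumed, so every condition occurs in a check name. *)
Definition check (P : U) : U -> U :=
  Fix (foundation U) (fun _ => U : Type) (fun x rec =>
    setof (fun z => exists y (h : y ∈ x) p, p ∈ P /\ z = opair (rec y h) p)).

(** The relation [p ⊩ a = b] satisfies the usual recursion over pairs of names: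
    for each [(c, s)] in [a], the [q <= s] that force [c = d] for some
    [(d, t)] in [b] with [q <= t] are dense below every condition below both [p]
    and [s], and symmetrically. All recursive occurrences are positive and the
    recursion is well-founded, so the inductive definition is the unique
    solution. *)
Inductive forces_eq (P : U) (le : U -> U -> Prop) : U -> U -> U -> Prop :=
  | ForcesEq p a b :
      (forall c s, opair c s ∈ a -> forall q, q ∈ P -> le q p -> le q s ->
         exists r d t, r ∈ P /\ le r q /\ opair d t ∈ b /\ le r t /\
           forces_eq P le r c d) ->
      (forall d t, opair d t ∈ b -> forall q, q ∈ P -> le q p -> le q t ->
         exists r c s, r ∈ P /\ le r q /\ opair c s ∈ a /\ le r s /\
           forces_eq P le r c d) ->
      forces_eq P le p a b.

Fixpoint forces (P : U) (le : U -> U -> Prop) (p : U) (A : fml) : Prop :=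
  match A with
  | FMem a b => forall q, q ∈ P -> le q p ->
      exists r c s, r ∈ P /\ le r q /\ opair c s ∈ b /\ le r s /\
        forces_eq P le r a c
  | FEq a b => forces_eq P le p a b
  | FAnd A B => forces P le p A /\ forces P le p B
  | FNot A => forall q, q ∈ P -> le q p -> ~ forces P le q A
  | FAll F => forall a, is_name P a -> forces P le p (F a)
  end.

Definition FOr (A B : fml) : fml := FNot (FAnd (FNot A) (FNot B)).
Definition FImp (A B : fml) : fml := FNot (FAnd A (FNot B)).
Definition FIff (A B : fml) : fml := FAnd (FImp A B) (FImp B A).
Definition FEx (F : U -> fml) : fml := FNot (FAll (fun x => FNot (F x))).
Definition FAllIn (a : U) (F : U -> fml) : fml :=
  FAll (fun x => FImp (FMem x a) (F x)).
Definition FExIn (a : U) (F : U -> fml) : fml :=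
  FEx (fun x => FAnd (FMem x a) (F x)).

Definition FSub a b : fml := FAllIn a (fun x => FMem x b).
Definition FUpair z x y : fml :=
  FAll (fun w => FIff (FMem w z) (FOr (FEq w x) (FEq w y))).
Definition FOpair z x y : fml :=
  FEx (fun u => FEx (fun v => FAnd (FUpair u x x) (FAnd (FUpair v x y) (FUpair z u v)))).
Definition FPairIn f x y : fml := FExIn f (fun z => FOpair z x y).
Definition FExUnique (F : U -> fml) : fml :=
  FEx (fun x => FAnd (F x) (FAll (fun y => FImp (F y) (FEq x y)))).
Definition FBij f a b : fml :=
  FAnd (FAllIn f (fun z => FExIn a (fun x => FExIn b (fun y => FOpair z x y))))
  (FAnd (FAllIn a (fun x => FExUnique (fun y => FPairIn f x y)))
        (FAllIn b (fun y => FExUnique (fun x => FPairIn f x y)))).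
Definition FEquinum a b : fml := FEx (fun f => FBij f a b).
Definition FLec a b : fml := FEx (fun c => FAnd (FSub c b) (FEquinum a c)).
Definition FTransitive a : fml := FAllIn a (fun x => FSub x a).
Definition FOrdinal a : fml := FAnd (FTransitive a) (FAllIn a FTransitive).
Definition FEmpty a : fml := FAll (fun x => FNot (FMem x a)).
Definition FSucc y x : fml :=
  FAll (fun w => FIff (FMem w y) (FOr (FMem w x) (FEq w x))).

(** [a] is an ordinal containing 0, closed under successor, all of whose elements
    are 0 or successors. *)
Definition FOmega a : fml :=
  FAnd (FOrdinal a)
  (FAnd (FExIn a FEmpty)
  (FAnd (FAllIn a (fun n => FExIn a (fun m => FSucc m n)))
        (FAllIn a (fun n => FOr (FEmpty n) (FEx (fun m => FSucc n m)))))).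

Definition FCountable a : fml := FEx (fun o => FAnd (FOmega o) (FLec a o)).

(** [a] is the least uncountable ordinal. *)
Definition FOmega1 a : fml :=
  FAnd (FOrdinal a) (FAnd (FNot (FCountable a)) (FAllIn a FCountable)).

(** [P] collapses [mu] to have size [omega_1]: every condition forces that the
    ground model [omega_1] is still [omega_1] and is equinumerous with [mu]. *)
Definition collapses_to_omega1 (P : U) (le : U -> U -> Prop) (mu : U) : Prop :=
  forall p, p ∈ P ->
    forces P le p (FAnd (FOmega1 (check P omega1))
                        (FEquinum (check P omega1) (check P mu))).

End SetTheory.

(** The hypotheses of [universe] are satisfiable: well-founded trees, identified up
    to extensional equality by choosing representatives, form a model. *)
Module TreeModel.

Unset Implicit Arguments.

Inductive tree : Type := Sup (I : Type) (f : I -> tree).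

Fixpoint teq (s t : tree) : Prop :=
  match s, t with
  | Sup _ f, Sup _ g =>
      (forall i, exists j, teq (f i) (g j)) /\ (forall j, exists i, teq (f i) (g j))
  end.

Lemma teq_refl s : teq s s.
Proof. induction s as [I f IH]; simpl; split; eauto. Qed.

Lemma teq_sym s : forall t, teq s t -> teq t s.
Proof.
  induction s as [I f IH]; intros [J g]; simpl; intros [h1 h2]; split.
  - intro j; destruct (h2 j); eauto.
  - intro i; destruct (h1 i); eauto.
Qed.

Lemma teq_trans s : forall t u, teq s t -> teq t u -> teq s u.
Proof.
  induction s as [I f IH]; intros [J g] [K h]; simpl; intros [h1 h2] [h3 h4]; split.
  - intro i; destruct (h1 i) as [j hj]; destruct (h3 j); eauto.
  - intro k; destruct (h4 k) as [j hj]; destruct (h2 j); eauto.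
Qed.

Definition trep (s : tree) : tree := epsilon (inhabits s) (teq s).

Lemma trep_teq s : teq s (trep s).
Proof. exact (epsilon_spec (inhabits s) (teq s) (ex_intro _ s (teq_refl s))). Qed.

Lemma trep_eq s t : teq s t -> trep s = trep t.
Proof.
  intro h. unfold trep.
  replace (inhabits t) with (inhabits s) by apply proof_irrelevance.
  f_equal. apply functional_extensionality; intro u.
  apply propositional_extensionality; split; eauto using teq_trans, teq_sym.
Qed.

Definition tset : Type := {s : tree | trep s = s}.
Definition cls (s : tree) : tset :=
  exist _ (trep s) (eq_sym (trep_eq _ _ (trep_teq s))).

Definition tin (s t : tree) : Prop := match t with Sup _ g => exists j, teq s (g j) end.
Definition tmem (x y : tset) : Prop := tin (proj1_sig x) (proj1_sig y).

Lemma tset_eq (x y : tset) : teq (proj1_sig x) (proj1_sig y) -> x = y.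
Proof.
  destruct x as [s hs], y as [t ht]; simpl; intro h. apply trep_eq in h.
  assert (s = t) by congruence. subst t. f_equal. apply proof_irrelevance.
Qed.

Lemma tin_teq s t u : tin s t -> teq t u -> tin s u.
Proof.
  destruct t as [J g], u as [K h]; simpl; intros [j hj] [h1 _].
  destruct (h1 j) as [k hk]; exists k; eauto using teq_trans.
Qed.

Lemma tmem_cls x (I : Type) (F : I -> tset) :
  tmem x (cls (Sup I (fun i => proj1_sig (F i)))) <-> exists i, x = F i.
Proof.
  unfold tmem, cls; simpl; split.
  - intro h. apply tin_teq with (2 := teq_sym _ _ (trep_teq _)) in h.
    destruct h as [i hi]; exists i; apply tset_eq; exact hi.
  - intros [i ->]. apply tin_teq with (2 := trep_teq _). exists i; apply teq_refl.
Qed.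

Lemma tset_surj (x : tset) : exists (I : Type) (F : I -> tset),
  x = cls (Sup I (fun i => proj1_sig (F i))).
Proof.
  destruct x as [[I f] h]. exists I, (fun i => cls (f i)).
  apply tset_eq. apply (teq_trans _ (Sup I (fun i => trep (f i)))).
  - simpl; split; intro i; exists i; apply trep_teq.
  - apply trep_teq.
Qed.

Lemma universe_inhabited : inhabited universe.
Proof.
  assert (small : forall (x : tset), exists (I : Type) (F : I -> tset),
     forall z, tmem z x <-> exists i, z = F i).
  { intro x; destruct (tset_surj x) as (I & F & ->); exists I, F; intro; apply tmem_cls. }
  apply inhabits.
  refine (@Universe tset tmem (cls (Sup False (fun e => match e with end))) _ _ _ _ _ _ _ _).
  - intros x y h. apply tset_eq.
    destruct x as [[I f] hx], y as [[J g] hy]; simpl in *.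
    split.
    + intro i. destruct (h (cls (f i))) as [h1 _].
      destruct h1 as [j hj]; [exists i; apply teq_sym, trep_teq|].
      exists j. eapply teq_trans; [apply trep_teq|exact hj].
    + intro j. destruct (h (cls (g j))) as [_ h1].
      destruct h1 as [i hi]; [exists j; apply teq_sym, trep_teq|].
      exists i. apply teq_sym. eapply teq_trans; [apply trep_teq|exact hi].
  - intros [s hs].
    assert (key : forall u (y : tset), teq (proj1_sig y) u -> Acc tmem y).
    { clear. induction u as [I f IH]; intros y hy. constructor; intros z hz.
      apply tin_teq with (2 := hy) in hz. destruct hz as [i hi]. eauto. }
    apply (key s); apply teq_refl.
  - intros z h. change (tmem z (cls (Sup False (fun e => match e with end)))) in h.
    apply tin_teq with (2 := teq_sym _ _ (trep_teq _)) in h. destruct h as [[] _].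
  - intros x y. exists (cls (Sup bool (fun b => proj1_sig (if b then x else y)))).
    intro z. rewrite tmem_cls with (F := fun b : bool => if b then x else y). split.
    + intros [[] ->]; auto.
    + intros [->| ->]; [exists true|exists false]; reflexivity.
  - intro x. destruct (tset_surj x) as (I & F & ->).
    destruct (choice (fun (i : I) (s : {J : Type & J -> tset}) =>
       forall z, tmem z (F i) <-> exists j, z = projT2 s j)) as [G hG].
    { intro i. destruct (small (F i)) as (J & g & h). exists (existT _ J g). exact h. }
    exists (cls (Sup {i : I & projT1 (G i)} (fun p => proj1_sig (projT2 (G (projT1 p)) (projT2 p))))).
    intro z. rewrite tmem_cls with (F := fun p : {i : I & projT1 (G i)} => projT2 (G (projT1 p)) (projT2 p)).
    split.
    + intros [[i j] ->]. exists (F i). split; [apply tmem_cls; eauto|apply hG; simpl; eauto].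
    + intros (y & hy & hz). apply tmem_cls in hy. destruct hy as [i ->].
      apply hG in hz. destruct hz as [j ->]. exists (existT _ i j). reflexivity.
  - intro x. destruct (tset_surj x) as (I & F & ->).
    set (Q := fun q : I -> Prop => cls (Sup {i | q i} (fun i => proj1_sig (F (proj1_sig i))))).
    exists (cls (Sup (I -> Prop) (fun q => proj1_sig (Q q)))).
    intro z. rewrite tmem_cls with (F := Q). split.
    + intros [q ->] t ht. apply tmem_cls with (F := fun i : {i | q i} => F (proj1_sig i)) in ht.
      destruct ht as [[i hi] ->]. apply tmem_cls; simpl; eauto.
    + intro h. exists (fun i => tmem (F i) z).
      destruct (tset_surj z) as (J & g & hz). rewrite hz. apply tset_eq.
      unfold Q, cls, proj1_sig at 1 3.
      eapply teq_trans; [apply teq_sym, trep_teq|]. eapply teq_trans; [|apply trep_teq].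
      simpl. split.
      * intro j. assert (hj : tmem (g j) z) by (rewrite hz; apply tmem_cls; eauto).
        destruct (proj1 (tmem_cls _ _ _) (h _ hj)) as [i hi].
        rewrite hi in hj. rewrite hz in hj.
        exists (exist _ i hj). simpl. rewrite hi. apply teq_refl.
      * intros [i hi]; simpl. apply tmem_cls in hi. destruct hi as [j hj].
        exists j. rewrite hj. apply teq_refl.
  - intros x R hR. destruct (tset_surj x) as (I & F & ->).
    set (d := cls (Sup False (fun e => match e with end))).
    set (G := fun i : {i : I | exists b, R (F i) b} => epsilon (inhabits d) (R (F (proj1_sig i)))).
    exists (cls (Sup _ (fun i => proj1_sig (G i)))).
    intro b. rewrite tmem_cls. split.
    + intros [[i hi] ->]. exists (F i). split; [apply tmem_cls; eauto|].
      unfold G; simpl. apply epsilon_spec; exact hi.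
    + intros (a & ha & hb). apply tmem_cls in ha. destruct ha as [i ->].
      exists (exist _ i (ex_intro _ b hb)). apply (hR (F i)); [exact hb|].
      unfold G; simpl. apply epsilon_spec; eauto.
  - set (d := cls (Sup False (fun e => match e with end))).
    assert (sc : forall n, exists s, forall z, tmem z s <-> tmem z n \/ z = n).
    { intro n. destruct (tset_surj n) as (I & F & hn).
      exists (cls (Sup (option I) (fun o => proj1_sig (match o with Some i => F i | None => n end)))).
      intro z. rewrite tmem_cls with (F := fun o => match o with Some i => F i | None => n end).
      assert (hz : tmem z n <-> exists i, z = F i) by (rewrite hn; apply tmem_cls).
      rewrite hz. split.
      - intros [[i|] ->]; eauto.
      - intros [[i ->]| ->]; [exists (Some i)|exists None]; reflexivity. }
    apply choice in sc. destruct sc as [sc hsc].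
    exists (cls (Sup nat (fun n => proj1_sig (Nat.iter n sc d)))). split.
    + apply tmem_cls with (F := fun n => Nat.iter n sc d). exists 0; reflexivity.
    + intros n hn. apply tmem_cls with (F := fun n => Nat.iter n sc d) in hn.
      destruct hn as [k ->]. exists (sc (Nat.iter k sc d)). split; [|apply hsc].
      apply tmem_cls with (F := fun n => Nat.iter n sc d). exists (S k); reflexivity.
Qed.

End TreeModel.

(* Main.v *)
(** If [N] and [N'] are isomorphic models, the isomorphism fixes every index below
    [2 ^ omega], since [Y] codes the reals by their indices and the isomorphism fixes
    the natural numbers; hence [N] and [N'] contain the same indices. Two models of a
    coherent adequate set with the same trace on [omega1] are isomorphic. So the
    models occurring in the generic filter assign to each [delta < omega1] at most
    one countable set of indices, namely the common trace on [2 ^ omega] of the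
    models whose trace on [omega1] is [delta], and by density these sets cover
    [2 ^ omega]. This yields a partial surjection of [omega1 x omega], hence of
    [omega1], onto [2 ^ omega] in the extension. Strong genericity for stationarily
    many countable models preserves [omega1].

    Functions of the extension are handled through the relation "p decides that x is
    sent to y", so that the least-preimage argument and the Schroeder-Bernstein theorem
    are carried out on such relations in the ground model, and names are needed only
    for the final bijection. *)

Require Import Defs.
From Stdlib Require Import List Classical ClassicalEpsilon FunctionalExtensionality.
From Stdlib Require Import Arith Cantor Lia Wellfounded.
From Stdlib Require Relation_Operators.

(** Elementarity concerns first-order formulas over [H lam], so each fact about traces has to be
    reached by a definition inside that structure. Countability is the delicate notion: it is
    expressed by generators and evaluated only at members of a countable model, which then itself
    serves as a set closed under them. No formula takes [omega1] as a parameter; its members are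
    recognized as the countable ordinals.

    The density arguments add one model at a time, so the only coherent adequate set to be built is
    a singleton, and the stationary part of [S] supplies its comparison point.

    The two halves of the theorem cross between names and relations in opposite directions. The
    bijection is a name built from a relation. Preservation of [omega1] starts from an arbitrary
    name of an injection, where even the set called omega is only some name forced to satisfy
    [FOmega]; its elements must first be shown to be numerals on a dense set. *)

Section SetBasics.

Context {U : universe}.
Implicit Types x y z a b c t : U.

(** * Comprehension, pairs and membership recursion *)

Definition is_set (Phi : U -> Prop) : Prop := exists s, forall z, z ∈ s <-> Phi z.

Lemma setof_spec Phi : is_set Phi -> forall z, z ∈ setof Phi <-> Phi z.
Proof. intro h. exact (epsilon_spec (inhabits empty) _ h). Qed.

(** Separation, from replacement along the partial identity. Since [setof] is arbitrary on proper
    classes, almost every comprehension below is justified by exhibiting such a bounding set. *)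
Lemma is_set_sub a Phi : (forall z, Phi z -> z ∈ a) -> is_set Phi.
Proof.
  intro h. destruct (replacement U a (fun x y => x = y /\ Phi x)) as [s hs].
  { intros u v w [<- _] [<- _]. reflexivity. }
  exists s. intro z. rewrite hs. split.
  - intros (u & _ & -> & hu). exact hu.
  - intro hz. exists z. auto.
Qed.

Lemma set_ext x y : (forall z, z ∈ x <-> z ∈ y) -> x = y.
Proof. apply extensionality. Qed.

Lemma mem_irrefl x : ~ x ∈ x.
Proof.
  induction x as [x IH] using (well_founded_ind (foundation U)).
  intro h. exact (IH x h h).
Qed.

Lemma mem_asym x y : x ∈ y -> ~ y ∈ x.
Proof.
  revert y. induction x as [x IH] using (well_founded_ind (foundation U)).
  intros y h1 h2. exact (IH y h2 x h2 h1).
Qed.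

Lemma upair_spec x y z : z ∈ upair x y <-> z = x \/ z = y.
Proof. apply (setof_spec (fun z => z = x \/ z = y)), pairing. Qed.

Lemma union_spec x z : z ∈ union x <-> exists y, y ∈ x /\ z ∈ y.
Proof. apply (setof_spec (fun z => exists y, y ∈ x /\ z ∈ y)), union_ax. Qed.

Lemma inter_spec x y z : z ∈ inter x y <-> z ∈ x /\ z ∈ y.
Proof.
  apply (setof_spec (fun z => z ∈ x /\ z ∈ y)).
  apply is_set_sub with x. intros u [h _]; exact h.
Qed.

Lemma powerset_spec x z : z ∈ powerset x <-> z ⊆ x.
Proof. apply (setof_spec (fun z => z ⊆ x)), power_ax. Qed.

Lemma is_set_union a b : is_set (fun z => z ∈ a \/ z ∈ b).
Proof.
  exists (union (upair a b)). intro z. rewrite union_spec. split.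
  - intros (y & hy & hz). apply upair_spec in hy. destruct hy as [-> | ->]; auto.
  - intros [h | h]; [exists a | exists b]; rewrite upair_spec; auto.
Qed.

Lemma succ_spec x z : z ∈ succ x <-> z ∈ x \/ z = x.
Proof.
  apply (setof_spec (fun z => z ∈ x \/ z = x)).
  destruct (is_set_union x (upair x x)) as [s hs].
  exists s. intro u. rewrite hs, upair_spec. tauto.
Qed.

Lemma upair_inj x y x' y' : upair x y = upair x' y' ->
  (x = x' /\ y = y') \/ (x = y' /\ y = x').
Proof.
  intro h.
  assert (h1 : x ∈ upair x' y') by (rewrite <- h; apply upair_spec; auto).
  assert (h2 : y ∈ upair x' y') by (rewrite <- h; apply upair_spec; auto).
  assert (h3 : x' ∈ upair x y) by (rewrite h; apply upair_spec; auto).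
  assert (h4 : y' ∈ upair x y) by (rewrite h; apply upair_spec; auto).
  apply upair_spec in h1, h2, h3, h4. intuition congruence.
Qed.

Lemma opair_inj x y x' y' : opair x y = opair x' y' -> x = x' /\ y = y'.
Proof.
  intro h. apply upair_inj in h. destruct h as [[h1 h2] | [h1 h2]];
  apply upair_inj in h1, h2; intuition congruence.
Qed.

Definition img a (F : U -> U) : U := setof (fun z => exists x, x ∈ a /\ z = F x).

Lemma img_spec a F z : z ∈ img a F <-> exists x, x ∈ a /\ z = F x.
Proof.
  apply (setof_spec (fun z => exists x, x ∈ a /\ z = F x)).
  destruct (replacement U a (fun x y => y = F x)) as [s hs].
  { intros; congruence. }
  exists s. exact hs.
Qed.

Definition big_union a (F : U -> U) : U := union (img a F).

Lemma big_union_spec a F z : z ∈ big_union a F <-> exists x, x ∈ a /\ z ∈ F x.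
Proof.
  unfold big_union. rewrite union_spec. split.
  - intros (y & hy & hz). apply img_spec in hy. destruct hy as (x & hx & ->). eauto.
  - intros (x & hx & hz). exists (F x). rewrite img_spec. eauto.
Qed.

Lemma mem_ind (Q : U -> Prop) :
  (forall x, (forall y, y ∈ x -> Q y) -> Q x) -> forall x, Q x.
Proof. apply well_founded_ind, foundation. Qed.

Lemma mem_fix_eq (F : forall x, (forall y, y ∈ x -> U) -> U) x :
  Fix (foundation U) (fun _ => U : Type) F x =
  F x (fun y _ => Fix (foundation U) (fun _ => U : Type) F y).
Proof.
  apply (Fix_eq (foundation U) (fun _ => U : Type) F).
  intros u f g h. f_equal.
  apply functional_extensionality_dep; intro v.
  apply functional_extensionality_dep; intro hv. apply h.
Qed.

(** * Numerals and countability *)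

Lemma succ_inj x y : succ x = succ y -> x = y.
Proof.
  intro h.
  assert (h1 : x ∈ succ y) by (rewrite <- h; apply succ_spec; auto).
  assert (h2 : y ∈ succ x) by (rewrite h; apply succ_spec; auto).
  apply succ_spec in h1, h2. destruct h1 as [h1 | h1]; [|auto].
  destruct h2 as [h2 | h2]; [|auto]. destruct (mem_asym _ _ h1 h2).
Qed.

Lemma succ_neq_empty x : succ x <> empty.
Proof. intro h. apply (empty_ax U x). rewrite <- h. apply succ_spec; auto. Qed.

Lemma numeral_inj n m : numeral (U := U) n = numeral m -> n = m.
Proof.
  revert m. induction n as [|n IH]; intros [|m] h; simpl in h.
  - reflexivity.
  - symmetry in h. destruct (succ_neq_empty _ h).
  - destruct (succ_neq_empty _ h).
  - f_equal. apply IH, succ_inj, h.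
Qed.

Lemma omega_spec z : z ∈ omega <-> exists n, z = numeral n.
Proof.
  apply (setof_spec (fun z => exists n, z = numeral n)).
  destruct (infinity U) as (w & h0 & hs). apply is_set_sub with w.
  intros u [n ->]. induction n as [|n IH]; [exact h0|].
  destruct (hs _ IH) as (s & hsw & hz). replace (numeral (S n)) with s; [exact hsw|].
  apply set_ext. intro v. rewrite hz. simpl. rewrite succ_spec. reflexivity.
Qed.

(** Replacement accepts every relation of the ambient logic, so sequences indexed by [nat] can be
    transported along the numerals. *)
Lemma is_set_range (f : nat -> U) : is_set (fun z => exists n, z = f n).
Proof.
  destruct (replacement U omega (fun x y => exists n, x = numeral n /\ y = f n))
    as [s hs].
  { intros x y z (n & hn & ->) (m & hm & ->).
    f_equal. apply numeral_inj. congruence. }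
  exists s. intro z. rewrite hs. split.
  - intros (x & _ & n & _ & ->). eauto.
  - intros [n ->]. exists (numeral n). rewrite omega_spec. eauto.
Qed.

(** Maps are functions of the ambient logic instead of sets of ordered pairs; choice and replacement
    convert between the two in [equinum_bij] and [lec_inj]. *)
Definition inj a b : Prop := exists F : U -> U,
  (forall x, x ∈ a -> F x ∈ b) /\
  (forall x y, x ∈ a -> y ∈ a -> F x = F y -> x = y).

Definition bij a b : Prop := exists F : U -> U,
  (forall x, x ∈ a -> F x ∈ b) /\
  (forall x y, x ∈ a -> y ∈ a -> F x = F y -> x = y) /\
  (forall y, y ∈ b -> exists x, x ∈ a /\ F x = y).

Lemma equinum_bij a b : equinum a b <-> bij a b.
Proof.
  split.
  - intros (f & h1 & h2 & h3).
    set (F := fun x => epsilon (inhabits empty) (fun y => opair x y ∈ f)).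
    assert (hF : forall x, x ∈ a -> opair x (F x) ∈ f).
    { intros x hx. apply (epsilon_spec (inhabits empty) (fun y => opair x y ∈ f)).
      destruct (h2 x hx) as (y & hy & _). eauto. }
    exists F. split; [|split].
    + intros x hx. destruct (h1 _ (hF x hx)) as (u & v & _ & hv & e).
      apply opair_inj in e. destruct e as [_ ->]. exact hv.
    + intros x y hx hy e.
      destruct (h1 _ (hF x hx)) as (u & v & _ & hv & e').
      apply opair_inj in e'. destruct e' as [_ e']. rewrite <- e' in hv.
      destruct (h3 _ hv) as (w & _ & hw).
      rewrite <- (hw x (hF x hx)). apply hw. rewrite e. apply hF, hy.
    + intros y hy. destruct (h3 y hy) as (x & hx & _).
      destruct (h1 _ hx) as (u & v & hu & hv & e).
      apply opair_inj in e. destruct e as [<- <-].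
      exists x. split; [exact hu|].
      destruct (h2 x hu) as (w & _ & hw).
      rewrite <- (hw _ (hF x hu)). apply hw, hx.
  - intros (F & h1 & h2 & h3). exists (img a (fun x => opair x (F x))).
    split; [|split].
    + intros z hz. apply img_spec in hz. destruct hz as (x & hx & ->).
      exists x, (F x). auto.
    + intros x hx. exists (F x). split.
      * apply img_spec. eauto.
      * intros y hy. apply img_spec in hy. destruct hy as (u & hu & e).
        apply opair_inj in e. destruct e as [<- ->]. reflexivity.
    + intros y hy. destruct (h3 y hy) as (x & hx & <-). exists x. split.
      * apply img_spec. eauto.
      * intros u hu. apply img_spec in hu. destruct hu as (v & hv & e).
        apply opair_inj in e. destruct e as [<- e]. auto.
Qed.

Lemma inj_sub a a' b b' : inj a b -> a' ⊆ a -> b ⊆ b' -> inj a' b'.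
Proof. intros (F & h1 & h2) ha hb. exists F. split; auto. Qed.

Lemma inj_trans a b c : inj a b -> inj b c -> inj a c.
Proof.
  intros (F & h1 & h2) (G & h3 & h4). exists (fun x => G (F x)). split; auto.
Qed.

Lemma inj_refl a : inj a a.
Proof. exists (fun x => x). auto. Qed.

Lemma bij_inj a b : bij a b -> inj a b.
Proof. intros (F & h1 & h2 & _). exists F. auto. Qed.

Lemma bij_sym a b : bij a b -> bij b a.
Proof.
  intros (F & h1 & h2 & h3).
  set (G := fun y => epsilon (inhabits empty) (fun x => x ∈ a /\ F x = y)).
  assert (hG : forall y, y ∈ b -> G y ∈ a /\ F (G y) = y).
  { intros y hy. apply (epsilon_spec (inhabits empty) (fun x => x ∈ a /\ F x = y)).
    auto. }
  exists G. split; [|split].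
  - intros y hy. apply hG, hy.
  - intros x y hx hy e. rewrite <- (proj2 (hG x hx)), <- (proj2 (hG y hy)), e.
    reflexivity.
  - intros x hx. exists (F x). split; [auto|]. apply h2; [apply hG; auto|exact hx|].
    apply hG; auto.
Qed.

Lemma bij_img a b F : (forall x, x ∈ a -> F x ∈ b) ->
  (forall x y, x ∈ a -> y ∈ a -> F x = F y -> x = y) -> bij a (img a F).
Proof.
  intros h1 h2. exists F. split; [|split]; [|exact h2|].
  - intros x hx. apply img_spec. eauto.
  - intros y hy. apply img_spec in hy. destruct hy as (x & hx & ->). eauto.
Qed.

Lemma lec_inj a b : lec a b <-> inj a b.
Proof.
  split.
  - intros (c & hc & e). apply equinum_bij, bij_inj in e.
    apply inj_sub with (1 := e); auto.
  - intros (F & h1 & h2). exists (img a F). split.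
    + intros z hz. apply img_spec in hz. destruct hz as (x & hx & ->). auto.
    + apply equinum_bij. apply bij_img with b; auto.
Qed.

(** The enumeration may repeat values and leave [a], so the empty set and subsets need no separate
    treatment. *)
Definition cnt a : Prop := exists f : nat -> U, forall z, z ∈ a -> exists n, z = f n.

Lemma inj_omega_cnt a : inj a omega <-> cnt a.
Proof.
  split.
  - intros (F & h1 & h2).
    exists (fun n => epsilon (inhabits empty) (fun z => z ∈ a /\ F z = numeral n)).
    intros z hz. destruct (proj1 (omega_spec _) (h1 z hz)) as [n hn]. exists n.
    destruct (epsilon_spec (inhabits empty) (fun z => z ∈ a /\ F z = numeral n))
      as [h3 h4]; [eauto|]. apply h2; auto. congruence.
  - intros [f hf].
    set (n := fun z => epsilon (inhabits 0) (fun n => z = f n)).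
    assert (hn : forall z, z ∈ a -> z = f (n z)).
    { intros z hz. apply (epsilon_spec (inhabits 0) (fun n => z = f n)). auto. }
    exists (fun z => numeral (n z)). split.
    + intros z _. apply omega_spec. eauto.
    + intros x y hx hy e. apply numeral_inj in e.
      rewrite (hn x hx), (hn y hy), e. reflexivity.
Qed.

Lemma countable_cnt a : countable a <-> cnt a.
Proof. unfold countable. rewrite lec_inj. apply inj_omega_cnt. Qed.

Lemma cnt_sub a b : cnt b -> a ⊆ b -> cnt a.
Proof. intros [f hf] h. exists f. auto. Qed.

Lemma cnt_inj a b : inj a b -> cnt b -> cnt a.
Proof. rewrite <- !inj_omega_cnt. apply inj_trans. Qed.

Lemma cnt_range (f : nat -> U) : cnt (setof (fun z => exists n, z = f n)).
Proof. exists f. intros z hz. apply (setof_spec _ (is_set_range f)) in hz. exact hz. Qed.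

Lemma cnt_img a F : cnt a -> cnt (img a F).
Proof.
  intros [f hf]. exists (fun n => F (f n)). intros z hz. apply img_spec in hz.
  destruct hz as (x & hx & ->). destruct (hf x hx) as [n ->]. eauto.
Qed.

Lemma cnt_bigunion (s : nat -> U) a : (forall n, cnt (s n)) ->
  (forall z, z ∈ a -> exists n, z ∈ s n) -> cnt a.
Proof.
  intros h ha. apply choice in h. destruct h as [f hf].
  exists (fun k => f (fst (of_nat k)) (snd (of_nat k))).
  intros z hz. destruct (ha z hz) as [n hn]. destruct (hf n z hn) as [m ->].
  exists (to_nat (n, m)). rewrite cancel_of_to. reflexivity.
Qed.

Lemma cnt_finite a : finite a -> cnt a.
Proof.
  intros [l hl]. exists (fun n => nth n l empty). intros z hz. apply hl in hz.
  destruct (In_nth l z empty hz) as (n & _ & hn). eauto.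
Qed.

Lemma cnt_upair x y : cnt (upair x y).
Proof.
  exists (fun n => match n with 0 => x | _ => y end). intros z hz.
  apply upair_spec in hz. destruct hz as [-> | ->]; [exists 0 | exists 1]; reflexivity.
Qed.

(** * Ordinals *)

Lemma ord_elem a x : ordinal a -> x ∈ a -> ordinal x.
Proof.
  intros [h1 h2] hx. split; [auto|]. intros y hy. apply h2. apply (h1 x hx), hy.
Qed.

Lemma ord_trans a x y : ordinal a -> x ∈ a -> y ∈ x -> y ∈ a.
Proof. intros [h1 _] hx. apply h1, hx. Qed.

Lemma ord_intro a : transitive a -> (forall x, x ∈ a -> ordinal x) -> ordinal a.
Proof. intros h1 h2. split; [exact h1|]. intros y hy. apply h2, hy. Qed.

Lemma ord_tricho a b : ordinal a -> ordinal b -> a ∈ b \/ a = b \/ b ∈ a.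
Proof.
  revert b. induction a as [a IHa] using mem_ind.
  intro b. induction b as [b IHb] using mem_ind. intros ha hb.
  destruct (classic (a ∈ b)) as [|n1]; [auto|].
  destruct (classic (b ∈ a)) as [|n2]; [auto|].
  right; left. apply set_ext. intro z. split; intro hz.
  - destruct (IHa z hz b (ord_elem _ _ ha hz) hb) as [h | [-> | h]]; [auto|tauto|].
    destruct n2. exact (ord_trans _ _ _ ha hz h).
  - destruct (IHb z hz ha (ord_elem _ _ hb hz)) as [h | [-> | h]]; [|tauto|auto].
    destruct n1. exact (ord_trans _ _ _ hb hz h).
Qed.

Lemma ord_sub a b : ordinal a -> ordinal b -> a ⊆ b -> a ∈ b \/ a = b.
Proof.
  intros ha hb h. destruct (ord_tricho a b ha hb) as [|[|h']]; auto.
  destruct (mem_irrefl _ (h _ h')).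
Qed.

Lemma ord_not_mem a b : ordinal a -> ordinal b -> ~ a ∈ b -> b ⊆ a.
Proof.
  intros ha hb h. destruct (ord_tricho a b ha hb) as [|[ -> |h']]; auto; [tauto|].
  intros z hz. exact (ord_trans _ _ _ ha h' hz).
Qed.

Lemma ord_sub_mem a b c : ordinal a -> ordinal b -> ordinal c ->
  a ⊆ b -> b ∈ c -> a ∈ c.
Proof.
  intros ha hb hc h1 h2. destruct (ord_sub a b ha hb h1) as [h | ->]; [|exact h2].
  exact (ord_trans _ _ _ hc h2 h).
Qed.

Lemma ord_succ a : ordinal a -> ordinal (succ a).
Proof.
  intro ha. apply ord_intro.
  - intros y hy z hz. apply succ_spec. apply succ_spec in hy.
    destruct hy as [hy | ->]; [|auto]. left. exact (ord_trans _ _ _ ha hy hz).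
  - intros x hx. apply succ_spec in hx. destruct hx as [hx | ->]; [|exact ha].
    exact (ord_elem _ _ ha hx).
Qed.

Lemma ord_union c : (forall x, x ∈ c -> ordinal x) -> ordinal (union c).
Proof.
  intro h. apply ord_intro.
  - intros y hy z hz. apply union_spec in hy. destruct hy as (x & hx & hy).
    apply union_spec. exists x. split; [exact hx|]. exact (ord_trans _ _ _ (h x hx) hy hz).
  - intros x hx. apply union_spec in hx. destruct hx as (y & hy & hx).
    exact (ord_elem _ _ (h y hy) hx).
Qed.

Lemma ord_least (Phi : U -> Prop) a : ordinal a -> Phi a ->
  exists b, ordinal b /\ Phi b /\ forall c, ordinal c -> Phi c -> b ⊆ c.
Proof.
  induction a as [a IH] using mem_ind. intros ha hPhi.
  destruct (classic (exists b, b ∈ a /\ Phi b)) as [(b & hb & h)|n].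
  - apply (IH b hb); [exact (ord_elem _ _ ha hb)|exact h].
  - exists a. split; [|split]; auto. intros c hc h. apply ord_not_mem; eauto.
Qed.

Lemma least_ord_spec (Phi : U -> Prop) a : ordinal a -> Phi a ->
  ordinal (least_ord Phi) /\ Phi (least_ord Phi) /\
  forall c, ordinal c -> Phi c -> least_ord Phi ⊆ c.
Proof.
  intros ha hPhi. destruct (ord_least Phi a ha hPhi) as (b & hb & h & hmin).
  assert (e : least_ord Phi = b).
  { apply set_ext. intro z. unfold least_ord. rewrite setof_spec.
    - split; [auto|]. intros hz c hc h'. apply (hmin c); auto.
    - apply is_set_sub with b. auto. }
  rewrite e. auto.
Qed.

Lemma ord_numeral n : ordinal (numeral (U := U) n).
Proof.
  induction n as [|n IH]; [|apply ord_succ, IH].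
  split; intros y hy; destruct (empty_ax U _ hy).
Qed.

Lemma ord_omega : ordinal (omega (U := U)).
Proof.
  apply ord_intro.
  - intros y hy. apply omega_spec in hy. destruct hy as [n ->].
    induction n as [|n IH]; intros z hz; simpl in hz; [destruct (empty_ax U _ hz)|].
    apply succ_spec in hz. destruct hz as [hz | ->]; [auto|]. apply omega_spec. eauto.
  - intros x hx. apply omega_spec in hx. destruct hx as [n ->]. apply ord_numeral.
Qed.

(** The Burali-Forti paradox: the set of all ordinals would be an ordinal, hence a member of
    itself. *)
Lemma no_set_of_ordinals o : ~ (forall a, ordinal a -> a ∈ o).
Proof.
  intro h.
  assert (hs : is_set (fun a => ordinal a)) by (apply is_set_sub with o; exact h).
  destruct hs as [s hs]. apply (mem_irrefl s). apply hs. apply ord_intro.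
  - intros y hy z hz. apply hs. apply hs in hy. exact (ord_elem _ _ hy hz).
  - intros x hx. apply hs, hx.
Qed.

(** * The well-ordering theorem and cardinals *)

Section Enumeration.

Variable x : U.

(** Zermelo's recursion. Once [x] is exhausted the value is arbitrary, which is why the lemmas about
    a stage assume that some element is still left there. *)
Definition enumerator : U -> U :=
  Fix (foundation U) (fun _ => U : Type) (fun a rec =>
    epsilon (inhabits empty) (fun y => y ∈ x /\ forall b (h : b ∈ a), rec b h <> y)).

Lemma enumerator_spec a :
  (exists y, y ∈ x /\ forall b, b ∈ a -> enumerator b <> y) ->
  enumerator a ∈ x /\ forall b, b ∈ a -> enumerator b <> enumerator a.
Proof.
  intro h. unfold enumerator at 1 3. rewrite mem_fix_eq.
  exact (epsilon_spec (inhabits empty)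
    (fun y => y ∈ x /\ forall b, b ∈ a -> enumerator b <> y) h).
Qed.

(** The class [Q] of stages stays open because [bij_ordinal] needs two instances: the stages below
    the first exhausting one, and, in the contradiction, all ordinals. *)
Lemma enumerator_inj (Q : U -> Prop) :
  (forall a, Q a -> ordinal a /\ exists y, y ∈ x /\ forall b, b ∈ a -> enumerator b <> y) ->
  forall a b, Q a -> Q b -> enumerator a = enumerator b -> a = b.
Proof.
  intros h a b ha hb e. destruct (h a ha) as [oa ya], (h b hb) as [ob yb].
  destruct (ord_tricho a b oa ob) as [i | [i | i]]; [|exact i|].
  - destruct (proj2 (enumerator_spec b yb) a i e).
  - symmetry in e. destruct (proj2 (enumerator_spec a ya) b i e).
Qed.

(** If no stage exhausted [x], the recursion would inject all ordinals into [x], and replacement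
    along the inverse would make them a set. *)
Lemma bij_ordinal : exists a, ordinal a /\ bij a x.
Proof.
  set (full := fun a => forall y, y ∈ x -> exists b, b ∈ a /\ enumerator b = y).
  assert (notfull : forall a, ~ full a ->
    exists y, y ∈ x /\ forall b, b ∈ a -> enumerator b <> y).
  { intros a h. apply not_all_ex_not in h. destruct h as [y h].
    apply imply_to_and in h. destruct h as [hy h]. exists y. split; eauto. }
  destruct (classic (exists a, ordinal a /\ full a)) as [(a & ha & hf) | n].
  - destruct (ord_least full a ha hf) as (b & hb & hfb & hmin).
    assert (hlow : forall c, c ∈ b ->
      exists y, y ∈ x /\ forall d, d ∈ c -> enumerator d <> y).
    { intros c hc. apply notfull. intro hfc.
      apply (mem_irrefl c), (hmin c); [exact (ord_elem _ _ hb hc)|exact hfc|exact hc]. }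
    exists b. split; [exact hb|]. exists enumerator. split; [|split].
    + intros c hc. apply enumerator_spec. auto.
    + apply (enumerator_inj (fun c => c ∈ b)). intros c hc.
      split; [exact (ord_elem _ _ hb hc)|auto].
    + exact hfb.
  - exfalso.
    assert (hall : forall a, ordinal a ->
      exists y, y ∈ x /\ forall d, d ∈ a -> enumerator d <> y).
    { intros a ha. apply notfull. eauto. }
    destruct (replacement U x (fun y a => ordinal a /\ enumerator a = y)) as [o ho].
    { intros y a b [ha ea] [hb eb].
      apply (enumerator_inj (fun c => ordinal c)); auto. congruence. }
    apply (no_set_of_ordinals o). intros a ha. apply ho. exists (enumerator a).
    split; [|auto]. apply enumerator_spec. auto.
Qed.

End Enumeration.

Lemma card_spec x : ordinal (card x) /\ bij (card x) x /\
  forall k, ordinal k -> bij k x -> card x ⊆ k.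
Proof.
  destruct (bij_ordinal x) as (a & ha & hb).
  destruct (least_ord_spec (fun k => equinum k x) a ha) as (h1 & h2 & h3).
  { apply equinum_bij, hb. }
  split; [exact h1|]. split; [apply equinum_bij, h2|].
  intros k hk hbk. apply h3; [exact hk|]. apply equinum_bij, hbk.
Qed.

(** * Order types of sets of ordinals and comparison of cardinals *)

Section Collapse.

Variables (k c : U) (hk : ordinal k) (hc : c ⊆ k).

(** The Mostowski collapse of the order on [c]: at an ordinal [a] its value is the order type of the
    part of [c] below [a]. *)
Definition collapse : U -> U :=
  Fix (foundation U) (fun _ => U : Type) (fun a rec =>
    setof (fun z => exists b (h : b ∈ a), b ∈ c /\ z = rec b h)).

Lemma collapse_spec a z : z ∈ collapse a <-> exists b, b ∈ a /\ b ∈ c /\ z = collapse b.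
Proof.
  unfold collapse at 1. rewrite mem_fix_eq. rewrite setof_spec.
  - split.
    + intros (b & h & hb & ->). eauto.
    + intros (b & h & hb & ->). exists b, h. auto.
  - apply is_set_sub with (img a collapse). intros u (b & h & hb & ->).
    apply img_spec. eauto.
Qed.

Lemma collapse_ord a : ordinal a -> ordinal (collapse a) /\ collapse a ⊆ a.
Proof.
  induction a as [a IH] using mem_ind. intro ha. split.
  - apply ord_intro.
    + intros y hy z hz. apply collapse_spec in hy. destruct hy as (b & hb & _ & ->).
      apply collapse_spec in hz. destruct hz as (d & hd & hdc & ->).
      apply collapse_spec. exists d. split; [|auto]. exact (ord_trans _ _ _ ha hb hd).
    + intros y hy. apply collapse_spec in hy. destruct hy as (b & hb & _ & ->).
      apply IH; [exact hb|]. exact (ord_elem _ _ ha hb).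
  - intros y hy. apply collapse_spec in hy. destruct hy as (b & hb & _ & ->).
    pose proof (ord_elem _ _ ha hb) as ob. destruct (IH b hb ob) as [o s].
    exact (ord_sub_mem _ _ _ o ob ha s hb).
Qed.

Lemma collapse_bij : exists b, ordinal b /\ b ⊆ k /\ bij b c.
Proof.
  exists (img c collapse).
  assert (ho : forall a, a ∈ c -> ordinal a) by (intros a ha; exact (ord_elem _ _ hk (hc a ha))).
  split; [|split].
  - apply ord_intro.
    + intros y hy z hz. apply img_spec in hy. destruct hy as (a & ha & ->).
      apply collapse_spec in hz. destruct hz as (b & _ & hb & ->). apply img_spec. eauto.
    + intros y hy. apply img_spec in hy. destruct hy as (a & ha & ->).
      apply collapse_ord; auto.
  - intros y hy. apply img_spec in hy. destruct hy as (a & ha & ->).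
    destruct (collapse_ord a (ho a ha)) as [o s].
    exact (ord_sub_mem _ _ _ o (ho a ha) hk s (hc a ha)).
  - apply bij_sym. apply bij_img with (img c collapse).
    + intros a ha. apply img_spec. eauto.
    + intros a b ha hb e. destruct (ord_tricho a b (ho a ha) (ho b hb)) as [h | [h | h]].
      * exfalso. apply (mem_irrefl (collapse b)). rewrite <- e at 1.
        apply collapse_spec. eauto.
      * exact h.
      * exfalso. apply (mem_irrefl (collapse a)). rewrite e at 1.
        apply collapse_spec. eauto.
Qed.

End Collapse.

Lemma bij_trans a b c : bij a b -> bij b c -> bij a c.
Proof.
  intros (F & h1 & h2 & h3) (G & h4 & h5 & h6). exists (fun x => G (F x)).
  split; [|split]; auto. intros z hz. destruct (h6 z hz) as (y & hy & <-).
  destruct (h3 y hy) as (x & hx & <-). eauto.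
Qed.

(** [card] is a minimum over equinumerous ordinals, so a mere injection into [k] is first improved
    to a bijection with an ordinal included in [k], by collapsing its range. *)
Lemma card_le x k : ordinal k -> inj x k -> card x ⊆ k.
Proof.
  intros hk (F & h1 & h2). destruct (collapse_bij k (img x F) hk) as (b & ob & hb & e).
  - intros z hz. apply img_spec in hz. destruct hz as (y & hy & ->). auto.
  - intros z hz. apply hb. apply (proj2 (proj2 (card_spec x)) b ob); [|exact hz].
    apply bij_trans with (1 := e). apply bij_sym. apply bij_img with k; auto.
Qed.

(** A set included in a transitive set [t] that injects into [a] is coded by a
    relation on [a] together with a distinguished subset, the latter being
    attached to the extra point [a]. *)
Definition hereditarily_in a z : Prop := exists t, transitive t /\ z ⊆ t /\ inj t a.

Definition codes_set a c z : Prop := exists t (F : U -> U),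
  transitive t /\ z ⊆ t /\ (forall x, x ∈ t -> F x ∈ a) /\
  (forall x y, x ∈ t -> y ∈ t -> F x = F y -> x = y) /\
  (forall w, w ∈ c <->
    (exists u v, u ∈ v /\ v ∈ t /\ w = opair (F u) (F v)) \/
    (exists u, u ∈ z /\ w = opair (F u) a)).

(** Decoding is functional: by membership induction, points with the same code are equal, since the
    code of a point determines the codes of its members. The two kinds of pairs in [c] cannot be
    confused, because [F] takes values in [a] and [a] is not a member of itself. *)
Lemma codes_set_sub a c z z' : codes_set a c z -> codes_set a c z' -> z ⊆ z'.
Proof.
  intros (t & F & ht & hzt & hFa & hFi & hc) (t' & F' & ht' & hzt' & hFa' & hFi' & hc').
  assert (key : forall u u', u ∈ t -> u' ∈ t' -> F u = F' u' -> u = u').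
  { induction u as [u IH] using mem_ind. intros u' hu hu' e.
    apply set_ext. intro w. split; intro hw.
    - assert (h : opair (F w) (F u) ∈ c) by (apply hc; left; eauto).
      apply hc' in h. destruct h as [(p & q & hpq & hq & h) | (p & _ & h)];
      apply opair_inj in h; destruct h as [h1 h2].
      + rewrite e in h2. apply hFi' in h2; auto. subst q.
        rewrite (IH w hw p (ht u hu w hw) (ht' u' hu' p hpq) h1). exact hpq.
      + destruct (mem_irrefl a). rewrite <- h2 at 1. auto.
    - assert (h : opair (F' w) (F' u') ∈ c) by (apply hc'; left; eauto).
      apply hc in h. destruct h as [(p & q & hpq & hq & h) | (p & _ & h)];
      apply opair_inj in h; destruct h as [h1 h2].
      + rewrite <- e in h2. apply hFi in h2; auto. subst q.
        rewrite <- (IH p hpq w (ht u hu p hpq) (ht' u' hu' w hw) (eq_sym h1)). exact hpq.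
      + destruct (mem_irrefl a). rewrite <- h2 at 1. auto. }
  intros u hu. assert (h : opair (F u) a ∈ c) by (apply hc; right; eauto).
  apply hc' in h. destruct h as [(p & q & hpq & hq & h) | (p & hp & h)];
  apply opair_inj in h; destruct h as [h1 h2].
  - destruct (mem_irrefl a). rewrite h2 at 1. auto.
  - rewrite (key u p); auto.
Qed.

(** Without it neither [hartogs] nor [H] would be known to be a set. Ordered pairs over [d] lie in
    its second power set, so codes lie in the third, and replacement along decoding applies. *)
Lemma is_set_hereditarily_in a : exists s, forall z, hereditarily_in a z -> z ∈ s.
Proof.
  destruct (is_set_union a (upair a a)) as [d hd].
  destruct (replacement U (powerset (powerset (powerset d))) (codes_set a)) as [s hs].
  { intros c z z' h h'. apply set_ext. intro w. split; eapply codes_set_sub; eauto. }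
  assert (hp : forall u v, u ∈ d -> v ∈ d -> opair u v ∈ powerset (powerset d)).
  { intros u v hu hv. apply powerset_spec. intros w hw. apply powerset_spec.
    intros q hq. apply upair_spec in hw.
    destruct hw as [-> | ->]; apply upair_spec in hq; destruct hq as [-> | ->]; auto. }
  exists s. intros z (t & ht & hz & F & hF & hFi). apply hs.
  set (Phi := fun w =>
    (exists u v, u ∈ v /\ v ∈ t /\ w = opair (F u) (F v)) \/
    (exists u, u ∈ z /\ w = opair (F u) a)).
  assert (hPhi : forall w, Phi w -> w ∈ powerset (powerset d)).
  { assert (ha : a ∈ d) by (apply hd; right; apply upair_spec; auto).
    assert (hFd : forall u, u ∈ t -> F u ∈ d) by (intros u hu; apply hd; auto).
    intros w [(u & v & huv & hv & ->) | (u & hu & ->)]; apply hp; auto.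
    apply hFd, (ht v); auto. }
  assert (hset : is_set Phi) by (apply is_set_sub with (1 := hPhi)).
  exists (setof Phi). split.
  - apply powerset_spec. intros w hw. apply (setof_spec Phi hset) in hw. auto.
  - exists t, F. split; [exact ht|]. split; [exact hz|]. split; [exact hF|].
    split; [exact hFi|]. exact (setof_spec Phi hset).
Qed.

(** * Hartogs ordinals, [omega1] and [omega2] *)

Lemma hartogs_spec x a : a ∈ hartogs x <-> ordinal a /\ inj a x.
Proof.
  rewrite <- lec_inj.
  apply (setof_spec (fun a => ordinal a /\ lec a x)).
  destruct (is_set_hereditarily_in x) as [s hs]. apply is_set_sub with s.
  intros z [hz hl]. apply hs. exists z. split; [exact (proj1 hz)|]. split; [auto|].
  apply lec_inj, hl.
Qed.

Lemma ord_hartogs x : ordinal (hartogs x).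
Proof.
  apply ord_intro.
  - intros y hy z hz. apply hartogs_spec in hy. destruct hy as [oy hy].
    apply hartogs_spec. split; [exact (ord_elem _ _ oy hz)|].
    apply inj_sub with (1 := hy); auto. exact (proj1 oy z hz).
  - intros y hy. apply hartogs_spec in hy. apply hy.
Qed.

Lemma omega1_spec a : a ∈ omega1 <-> ordinal a /\ cnt a.
Proof. unfold omega1. rewrite hartogs_spec, inj_omega_cnt. reflexivity. Qed.

Lemma omega2_spec a : a ∈ omega2 <-> ordinal a /\ inj a omega1.
Proof. apply hartogs_spec. Qed.

Lemma ord_omega1 : ordinal (omega1 (U := U)).
Proof. apply ord_hartogs. Qed.

Lemma ord_omega2 : ordinal (omega2 (U := U)).
Proof. apply ord_hartogs. Qed.

Lemma omega_in_omega1 : omega (U := U) ∈ omega1.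
Proof. apply omega1_spec. split; [apply ord_omega|]. apply inj_omega_cnt, inj_refl. Qed.

Lemma omega1_in_omega2 : omega1 (U := U) ∈ omega2.
Proof. apply omega2_spec. split; [apply ord_omega1|apply inj_refl]. Qed.

Lemma omega_sub_omega1 : omega (U := U) ⊆ omega1.
Proof. exact (proj1 ord_omega1 _ omega_in_omega1). Qed.

(** * Infinite ordinals absorb a countable factor *)

Lemma iter_succ_inj n m a b : (forall x, a <> succ x) -> (forall x, b <> succ x) ->
  Nat.iter n succ a = Nat.iter m succ b -> n = m /\ a = b.
Proof.
  intros ha hb. revert m. induction n as [|n IH]; intros [|m] e; simpl in e.
  - auto.
  - destruct (ha _ e).
  - symmetry in e. destruct (hb _ e).
  - apply succ_inj, IH in e. destruct e; auto.
Qed.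

(** For an ordinal this is the decomposition into a limit part and a natural number. It is available
    at every set, so [choice] turns it into a total function. *)
Lemma iter_succ_exists x : exists p : U * nat,
  x = Nat.iter (snd p) succ (fst p) /\ forall y, fst p <> succ y.
Proof.
  induction x as [x IH] using mem_ind.
  destruct (classic (exists y, x = succ y)) as [[y ->] | n].
  - destruct (IH y) as ([a n] & e & h); [apply succ_spec; auto|].
    exists (a, S n). simpl in *. split; [congruence|exact h].
  - exists (x, 0). simpl. split; [reflexivity|]. intros y e. eauto.
Qed.

Definition absorbs_nat k : Prop := exists g : U -> nat -> U,
  (forall x n, x ∈ k -> g x n ∈ k) /\
  (forall x y n m, x ∈ k -> y ∈ k -> g x n = g y m -> x = y /\ n = m).

Lemma iter_succ_mem k a n : (forall x, x ∈ k -> succ x ∈ k) -> a ∈ k ->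
  Nat.iter n succ a ∈ k.
Proof. intros h ha. induction n; simpl; auto. Qed.

Lemma iter_succ_base k a n : ordinal k -> Nat.iter n succ a ∈ k -> a ∈ k.
Proof.
  intro hk. induction n as [|n IH]; simpl; [auto|]. intro h. apply IH.
  apply (ord_trans k _ _ hk h). apply succ_spec; auto.
Qed.

(** Keep the limit part, and replace the finite part [m] of the first argument by the Cantor code of
    [(m, n)]. *)
Lemma limit_absorbs_nat k : ordinal k -> (forall x, x ∈ k -> succ x ∈ k) -> absorbs_nat k.
Proof.
  intros hk hs. destruct (choice _ iter_succ_exists) as [d hd].
  exists (fun x n => Nat.iter (to_nat (snd (d x), n)) succ (fst (d x))). split.
  - intros x n hx. apply iter_succ_mem; [exact hs|].
    apply (iter_succ_base k _ (snd (d x)) hk).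
    rewrite <- (proj1 (hd x)). exact hx.
  - intros x y n m hx hy e. apply iter_succ_inj in e; try apply hd.
    destruct e as [e1 e2]. apply (f_equal of_nat) in e1. rewrite !cancel_of_to in e1.
    injection e1 as e1 ->. split; [|reflexivity].
    rewrite (proj1 (hd x)), (proj1 (hd y)), e1, e2. reflexivity.
Qed.

(** Hilbert's hotel: the new point goes to 0, the natural numbers move up by one, and everything
    else stays. *)
Lemma inj_succ_infinite a : omega ⊆ a -> inj (succ a) a.
Proof.
  intro hw.
  exists (fun x => if excluded_middle_informative (x = a) then empty
    else if excluded_middle_informative (x ∈ omega) then succ x else x).
  split.
  - intros x hx. destruct (excluded_middle_informative (x = a)) as [->|n].
    + apply hw, omega_spec. exists 0. reflexivity.
    + destruct (excluded_middle_informative (x ∈ omega)) as [h|n'].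
      * apply hw. apply omega_spec in h. destruct h as [m ->]. apply omega_spec.
        exists (S m). reflexivity.
      * apply succ_spec in hx. tauto.
  - intros x y hx hy.
    assert (h0 : empty ∈ (omega (U := U))) by (apply omega_spec; exists 0; reflexivity).
    assert (hS : forall u, u ∈ (omega (U := U)) -> succ u ∈ (omega (U := U))).
    { intros u hu. apply omega_spec in hu. destruct hu as [m ->]. apply omega_spec.
      exists (S m). reflexivity. }
    destruct (excluded_middle_informative (x = a)), (excluded_middle_informative (y = a)),
      (excluded_middle_informative (x ∈ omega)), (excluded_middle_informative (y ∈ omega));
    intro E; try congruence; try (apply succ_inj; exact E); exfalso;
    solve [destruct (succ_neq_empty _ E) | destruct (succ_neq_empty _ (eq_sym E))
          | subst; auto].
Qed.

Lemma omega_sub_pred a : omega ⊆ succ a -> omega ⊆ a.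
Proof.
  intros h z hz. destruct (proj1 (succ_spec a z) (h z hz)) as [| ->]; [auto|].
  destruct (mem_irrefl (succ a)). apply h. apply omega_spec in hz.
  destruct hz as [n ->]. apply omega_spec. exists (S n). reflexivity.
Qed.

Lemma infinite_absorbs_nat k : ordinal k -> omega ⊆ k -> absorbs_nat k.
Proof.
  induction k as [k IH] using mem_ind. intros hk hw.
  destruct (classic (exists x, x ∈ k /\ ~ succ x ∈ k)) as [(x & hx & hn) | n].
  - assert (e : k = succ x).
    { pose proof (ord_elem _ _ hk hx) as ox.
      destruct (ord_tricho k (succ x) hk (ord_succ x ox)) as [h | [h | h]];
        [|exact h|tauto].
      apply succ_spec in h. destruct h as [h | ->].
      - destruct (mem_asym _ _ h hx).
      - destruct (mem_irrefl _ hx). }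
    subst k. pose proof (omega_sub_pred _ hw) as hwx.
    destruct (IH x hx (ord_elem _ _ hk hx) hwx) as (g & g1 & g2).
    destruct (inj_succ_infinite x hwx) as (F & F1 & F2).
    exists (fun y n => g (F y) n). split.
    + intros y n hy. apply succ_spec. left. auto.
    + intros y z n m hy hz e. apply g2 in e; auto. destruct e. auto.
  - apply limit_absorbs_nat; [exact hk|]. intros x hx. apply NNPP. eauto.
Qed.

(** All regularity facts rest on this: closure of [omega2] under successors and countable suprema,
    and closure of [H lam] under countable subsets. *)
Lemma inj_cover k (s : nat -> U) a : ordinal k -> omega ⊆ k ->
  (forall n, inj (s n) k) -> (forall z, z ∈ a -> exists n, z ∈ s n) -> inj a k.
Proof.
  intros hk hw hs ha. destruct (infinite_absorbs_nat k hk hw) as (g & g1 & g2).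
  destruct (choice _ hs) as [F hF].
  set (n := fun z => epsilon (inhabits 0) (fun n => z ∈ s n)).
  assert (hn : forall z, z ∈ a -> z ∈ s (n z)).
  { intros z hz. apply (epsilon_spec (inhabits 0) (fun n => z ∈ s n)). auto. }
  exists (fun z => g (F (n z) z) (n z)). split.
  - intros z hz. apply g1, hF, hn, hz.
  - intros x y hx hy e.
    apply g2 in e; [|apply hF, hn, hx|apply hF, hn, hy].
    destruct e as [e1 e2]. pose proof (hn x hx) as i1. pose proof (hn y hy) as i2.
    rewrite <- e2 in e1, i2. apply (hF (n x)); auto.
Qed.

Lemma inj_singleton x k : omega ⊆ k -> inj (upair x x) k.
Proof.
  intro h. exists (fun _ => empty). split.
  - intros _ _. apply h, omega_spec. exists 0. reflexivity.
  - intros y z hy hz _. apply upair_spec in hy, hz. intuition congruence.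
Qed.

Lemma inj_adjoin k t x a : ordinal k -> omega ⊆ k -> inj t k ->
  (forall z, z ∈ a -> z ∈ t \/ z = x) -> inj a k.
Proof.
  intros hk hw ht ha.
  apply inj_cover with (fun n => match n with 0 => t | _ => upair x x end); auto.
  - intros [|n]; [exact ht|]. apply inj_singleton, hw.
  - intros z hz. destruct (ha z hz) as [h | ->]; [exists 0; exact h|].
    exists 1. apply upair_spec. auto.
Qed.

Lemma omega2_succ a : a ∈ omega2 -> succ a ∈ omega2.
Proof.
  rewrite !omega2_spec. intros [h1 h2]. split; [apply ord_succ, h1|].
  apply inj_adjoin with a a; auto using ord_omega1, omega_sub_omega1.
  intros z hz. apply succ_spec, hz.
Qed.

Lemma omega2_sup c : cnt c -> c ⊆ omega2 -> union c ∈ omega2.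
Proof.
  intros [f hf] hc. apply omega2_spec. split.
  { apply ord_union. intros x hx. apply hc, omega2_spec in hx. apply hx. }
  set (s := fun n => if excluded_middle_informative (f n ∈ c) then f n else empty).
  apply inj_cover with s; [apply ord_omega1|apply omega_sub_omega1| |].
  - intro n. unfold s. destruct excluded_middle_informative as [h|_].
    + apply hc, omega2_spec in h. apply h.
    + exists (fun x => x). split; [intros x hx | intros x y hx]; destruct (empty_ax U _ hx).
  - intros z hz. apply union_spec in hz. destruct hz as (x & hx & hz).
    destruct (hf x hx) as [n ->]. exists n. unfold s.
    destruct excluded_middle_informative; tauto.
Qed.

(** * The continuum *)

Lemma powerset_omega_uncountable : ~ cnt (powerset (omega (U := U))).
Proof.
  intros [f hf].
  set (d := setof (fun z => exists n, z = numeral n /\ ~ z ∈ f n)).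
  assert (hd : forall z, z ∈ d <-> exists n, z = numeral n /\ ~ z ∈ f n).
  { apply setof_spec. apply is_set_sub with omega. intros z (n & -> & _).
    apply omega_spec. eauto. }
  destruct (hf d) as [n hn].
  { apply powerset_spec. intros z hz. apply hd in hz. destruct hz as (n & -> & _).
    apply omega_spec. eauto. }
  destruct (classic (numeral n ∈ f n)) as [h | h].
  - pose proof h as h'. rewrite <- hn in h'. apply hd in h'.
    destruct h' as (m & e & h'). apply numeral_inj in e. subst m. tauto.
  - apply h. rewrite <- hn. apply hd. eauto.
Qed.

Lemma ord_continuum : ordinal (continuum (U := U)).
Proof. apply card_spec. Qed.

Lemma omega1_sub_continuum : omega1 (U := U) ⊆ continuum.
Proof.
  apply ord_not_mem; [apply ord_continuum|apply ord_omega1|].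
  intro h. apply omega1_spec in h. destruct h as [_ h].
  apply powerset_omega_uncountable. apply cnt_inj with (2 := h).
  apply bij_inj, bij_sym. apply card_spec.
Qed.

(** An infinite cardinal is a limit ordinal: otherwise the power set of omega would inject into
    [succ i], hence into [i], against the minimality of [card]. The next index is what settles the
    empty real in [iso_fix_continuum]. *)
Lemma continuum_succ (i : U) : i ∈ continuum -> succ i ∈ continuum.
Proof.
  intro hi. apply NNPP. intro n.
  pose proof ord_continuum as hk. pose proof (ord_elem _ _ hk hi) as oi.
  pose proof (ord_not_mem _ _ (ord_succ _ oi) hk n) as hsub.
  assert (hw : omega ⊆ i).
  { apply omega_sub_pred. intros z hz. apply hsub, omega1_sub_continuum, omega_sub_omega1, hz. }
  apply (mem_irrefl i). apply (card_le (powerset omega) i oi); [|exact hi].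
  apply inj_trans with (succ i); [|apply inj_succ_infinite, hw].
  apply inj_sub with (powerset omega) continuum; auto.
  apply bij_inj, bij_sym, card_spec.
Qed.

(** * The sets of hereditary cardinality less than [lam] *)

Lemma transitive_closure_exists x : exists t, transitive t /\ x ⊆ t.
Proof.
  set (f := fun n => Nat.iter n union x).
  set (s := setof (fun z => exists n, z = f n)).
  assert (hs : forall z, z ∈ s <-> exists n, z = f n) by (apply setof_spec, is_set_range).
  exists (union s). split.
  - intros y hy z hz. apply union_spec in hy. destruct hy as (u & hu & hy).
    apply hs in hu. destruct hu as [n ->]. apply union_spec. exists (f (S n)).
    split; [apply hs; eauto|]. simpl. apply union_spec. eauto.
  - intros z hz. apply union_spec. exists x. split; [|exact hz]. apply hs.
    exists 0. reflexivity.
Qed.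

Lemma trcl_spec x : transitive (trcl x) /\ x ⊆ trcl x /\
  forall t, transitive t -> x ⊆ t -> trcl x ⊆ t.
Proof.
  assert (h : forall y, y ∈ trcl x <-> forall t, transitive t -> x ⊆ t -> y ∈ t).
  { apply setof_spec. destruct (transitive_closure_exists x) as (t & h1 & h2).
    apply is_set_sub with t. auto. }
  split; [|split].
  - intros y hy z hz. apply h. intros t h1 h2. apply (h1 y); [|exact hz].
    apply h; auto.
  - intros z hz. apply h. auto.
  - intros t h1 h2 z hz. apply h; auto.
Qed.

Section HLam.

Variables (lam : U) (hlam : ordinal lam).

(** Any transitive superset and any injection into an ordinal below [lam] suffice, so that closure
    arguments compute neither transitive closures nor cardinals. *)
Lemma H_spec z : z ∈ H lam <-> exists k, k ∈ lam /\ hereditarily_in k z.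
Proof.
  assert (key : forall z, card (trcl z) ∈ lam <-> exists k, k ∈ lam /\ hereditarily_in k z).
  { intro x. destruct (card_spec (trcl x)) as (h1 & h2 & h3).
    destruct (trcl_spec x) as (t1 & t2 & t3). split.
    - intro h. exists (card (trcl x)). split; [exact h|]. exists (trcl x).
      split; [exact t1|]. split; [exact t2|]. apply bij_inj, bij_sym, h2.
    - intros (k & hk & t & ht & hx & hi). pose proof (ord_elem _ _ hlam hk) as ok.
      apply ord_sub_mem with k; auto. apply card_le; [exact ok|].
      apply inj_sub with (1 := hi); auto. }
  rewrite <- key. unfold H. apply (setof_spec (fun x => card (trcl x) ∈ lam)).
  destruct (is_set_hereditarily_in lam) as [s hs]. apply is_set_sub with s.
  intros x hx. apply hs. apply key in hx. destruct hx as (k & hk & t & ht & hxt & hi).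
  exists t. split; [exact ht|]. split; [exact hxt|]. apply inj_sub with (1 := hi); auto.
  exact (proj1 hlam k hk).
Qed.

Lemma H_transitive x y : x ∈ H lam -> y ∈ x -> y ∈ H lam.
Proof.
  rewrite !H_spec. intros (k & hk & t & ht & hx & hi) hy. exists k.
  split; [exact hk|]. exists t. split; [exact ht|]. split; [|exact hi].
  apply ht. auto.
Qed.

Lemma H_union x : x ∈ H lam -> union x ∈ H lam.
Proof.
  rewrite !H_spec. intros (k & hk & t & ht & hx & hi). exists k.
  split; [exact hk|]. exists t. split; [exact ht|]. split; [|exact hi].
  intros z hz. apply union_spec in hz. destruct hz as (y & hy & hz).
  apply (ht y); auto.
Qed.

Lemma H_ord a : a ∈ lam -> a ∈ H lam.
Proof.
  intro ha. apply H_spec. exists a. split; [exact ha|]. exists a.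
  split; [exact (proj1 (ord_elem _ _ hlam ha))|]. split; [auto|apply inj_refl].
Qed.

Hypothesis hcf : ~ countable (cf lam).
Hypothesis hw : omega ∈ lam.

(** Otherwise the range of [f] is unbounded in [lam], and its countable cardinality bounds
    [cf lam]. *)
Lemma uncountable_cofinality (f : nat -> U) : (forall n, f n ∈ lam) ->
  exists b, b ∈ lam /\ forall n, f n ∈ b.
Proof.
  intro hf. apply NNPP. intro n. apply hcf. apply countable_cnt.
  set (c := setof (fun z => exists n, z = f n)).
  assert (hc : forall z, z ∈ c <-> exists n, z = f n) by (apply setof_spec, is_set_range).
  destruct (card_spec c) as (h1 & h2 & h3).
  assert (hcnt : cnt (card c)).
  { apply cnt_inj with c; [apply bij_inj, h2|]. apply cnt_range. }
  apply cnt_sub with (1 := hcnt).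
  (* [card c] serves both as a witness that the minimum exists and as the bound on it, which leaves
     the same goal twice. *)
  apply (least_ord_spec (fun kappa => exists c, c ⊆ lam /\ equinum kappa c /\
    forall beta, beta ∈ lam -> exists gamma, gamma ∈ c /\ beta ⊆ gamma) (card c)); auto;
  exists c; (split; [intros z hz; apply hc in hz; destruct hz as [m ->]; auto|]);
  (split; [apply equinum_bij, h2|]); intros b hb;
  apply NNPP; intro hn; apply n; exists b; (split; [exact hb|]); intro m;
  apply NNPP; intro hm; apply hn; exists (f m); (split; [apply hc; eauto|]);
  apply ord_not_mem; auto; apply (ord_elem lam); auto.
Qed.

(** Uncountable cofinality gives one ordinal [b] below [lam] above the bounds of all elements of
    [c]. The union of their transitive witnesses, with the elements themselves added, is transitive
    and still injects into the infinite ordinal [b]. *)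
Lemma H_countable c : cnt c -> c ⊆ H lam -> c ∈ H lam.
Proof.
  intros [f hf] hc.
  assert (hd : forall n, exists kt : U * U,
    (fst kt ∈ lam /\ transitive (snd kt) /\ inj (snd kt) (fst kt)) /\
    (f n ∈ c -> f n ⊆ snd kt)).
  { intro n. destruct (classic (f n ∈ c)) as [h | h].
    - apply hc, H_spec in h. destruct h as (k & hk & t & ht & hx & hi).
      exists (k, t). simpl. auto.
    (* A default for the indices whose value lies outside [c]. *)
    - exists (omega, omega). simpl. split; [|tauto]. split; [exact hw|].
      split; [exact (proj1 ord_omega)|apply inj_refl]. }
  apply choice in hd. destruct hd as [d hd].
  (* Entry 0 makes [b] infinite; the actual bounds are shifted by one. *)
  destruct (uncountable_cofinality (fun n => match n with 0 => omega | S n => fst (d n) end))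
    as (b & hb & hlt).
  { intros [|n]; [exact hw|]. apply hd. }
  pose proof (ord_elem _ _ hlam hb) as ob.
  assert (hwb : omega ⊆ b) by exact (proj1 ob _ (hlt 0)).
  assert (hset : forall n, exists s, forall z, z ∈ s <-> z ∈ snd (d n) \/ (z = f n /\ z ∈ c)).
  { intro n. destruct (is_set_union (snd (d n)) (upair (f n) (f n))) as [u hu].
    apply (is_set_sub u). intros z hz. apply hu. rewrite upair_spec. tauto. }
  apply choice in hset. destruct hset as [s hs].
  set (t := union (setof (fun z => exists n, z = s n))).
  assert (ht : forall z, z ∈ t <-> exists n, z ∈ s n).
  { intro z. unfold t. rewrite union_spec. split.
    - intros (y & hy & hz). apply (setof_spec _ (is_set_range s)) in hy.
      destruct hy as [n ->]. eauto.
    - intros [n hz]. exists (s n). split; [|exact hz].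
      apply (setof_spec _ (is_set_range s)). eauto. }
  apply H_spec. exists b. split; [exact hb|]. exists t. split; [|split].
  - intros y hy z hz. apply ht in hy. destruct hy as [n hy]. apply ht. exists n.
    apply hs. left. apply hs in hy. destruct (hd n) as [(_ & h1 & _) h2].
    destruct hy as [hy | [-> hy]]; [apply (h1 y); auto|]. apply h2; auto.
  - intros z hz. apply ht. destruct (hf z hz) as [n ->]. exists n. apply hs. auto.
  - apply inj_cover with s; auto.
    + intro n. apply inj_adjoin with (snd (d n)) (f n); auto.
      * destruct (hd n) as [(_ & _ & h) _]. apply inj_sub with (1 := h); auto.
        exact (proj1 ob _ (hlt (S n))).
      * intros z hz. apply hs in hz. tauto.
    + intros z hz. apply ht, hz.
Qed.

Lemma H_upair x y : x ∈ H lam -> y ∈ H lam -> upair x y ∈ H lam.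
Proof.
  intros hx hy. apply H_countable; [apply cnt_upair|]. intros z hz.
  apply upair_spec in hz. destruct hz as [-> | ->]; auto.
Qed.

Lemma H_opair x y : x ∈ H lam -> y ∈ H lam -> opair x y ∈ H lam.
Proof. intros hx hy. unfold opair. auto using H_upair. Qed.

Lemma H_tuple xs A : (forall x, In x xs -> x ∈ H lam) -> A ∈ H lam -> tuple xs A ∈ H lam.
Proof.
  intros h hA. induction xs as [|x xs IH]; simpl; [exact hA|].
  apply H_opair; [apply h; left; reflexivity|]. apply IH. intros y hy. apply h.
  right. exact hy.
Qed.

End HLam.

End SetBasics.

(** * Formulas *)

Definition fNot (A : form) : form := Imp A Bot.
Definition fAnd (A B : form) : form := fNot (Imp A (fNot B)).
Definition fOr (A B : form) : form := Imp (fNot A) B.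
Definition fIff (A B : form) : form := fAnd (Imp A B) (Imp B A).
Definition fEx (A : form) : form := fNot (All (fNot A)).

Definition fTrans (i : nat) : form :=
  All (Imp (Mem 0 (S i)) (All (Imp (Mem 0 1) (Mem 0 (S (S i)))))).
Definition fOrd (i : nat) : form :=
  fAnd (fTrans i) (All (Imp (Mem 0 (S i)) (fTrans 0))).
Definition fUpair (i j k : nat) : form :=
  All (fIff (Mem 0 (S i)) (fOr (Eq 0 (S j)) (Eq 0 (S k)))).
Definition fOpair (i j k : nat) : form :=
  fEx (fEx (fAnd (fUpair 0 (S (S j)) (S (S j)))
           (fAnd (fUpair 1 (S (S j)) (S (S k))) (fUpair (S (S i)) 0 1)))).
Definition fPairIn (g i j : nat) : form :=
  fEx (fAnd (Mem 0 (S g)) (fOpair 0 (S i) (S j))).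

(* The free variables are [g = 0], [a = 1], [x = 2] of [generated] below. *)
Definition fCntBody : form :=
  fAnd (All (All (All (Imp (fPairIn 3 2 1) (Imp (fPairIn 3 2 0) (Eq 1 0))))))
       (All (Imp (Mem 2 0)
         (Imp (All (All (Imp (Mem 1 2) (Imp (fPairIn 3 1 0) (Mem 0 2)))))
              (All (Imp (Mem 0 4) (Mem 0 1)))))).
Definition fCnt : form := fEx (fEx fCntBody).

Section Models.

Context {U : universe}.
Implicit Types x y z a b c g M N : U.

Section Sat.

Variables (D Y : U).

Lemma sat_not A (e : nat -> U) : sat D Y (fNot A) e <-> ~ sat D Y A e.
Proof. reflexivity. Qed.

Lemma sat_and A B (e : nat -> U) : sat D Y (fAnd A B) e <-> sat D Y A e /\ sat D Y B e.
Proof. simpl. split; [|tauto]. intro h. apply NNPP. tauto. Qed.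

Lemma sat_or A B (e : nat -> U) : sat D Y (fOr A B) e <-> sat D Y A e \/ sat D Y B e.
Proof. simpl. split; [|tauto]. intro h. apply NNPP. tauto. Qed.

Lemma sat_iff A B (e : nat -> U) :
  sat D Y (fIff A B) e <-> (sat D Y A e <-> sat D Y B e).
Proof. unfold fIff. rewrite sat_and. simpl. tauto. Qed.

Lemma sat_ex A (e : nat -> U) :
  sat D Y (fEx A) e <-> exists x, x ∈ D /\ sat D Y A (scons x e).
Proof.
  simpl. split.
  - intro h. apply NNPP. intro n. apply h. intros x hx h'. eauto.
  - intros (x & hx & h) n. exact (n x hx h).
Qed.

Definition env_in (e : nat -> U) : Prop := forall n, e n ∈ D.

Lemma env_in_scons x e : x ∈ D -> env_in e -> env_in (scons x e).
Proof. intros hx he [|n]; simpl; auto. Qed.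

Lemma env_in_const x : x ∈ D -> env_in (fun _ => x).
Proof. intros hx n. exact hx. Qed.

End Sat.

Local Hint Resolve env_in_scons env_in_const : env.

(** * Absoluteness in [H lam] and a formula for countability *)

Section HModel.

Variables (lam Y : U) (hlam : ordinal lam).
Hypothesis hcf : ~ countable (cf lam).
Hypothesis hw : omega ∈ lam.

Notation D := (H lam).

Lemma D_trans x y : x ∈ D -> y ∈ x -> y ∈ D.
Proof. exact (H_transitive lam hlam x y). Qed.

Local Hint Resolve D_trans : core.

Lemma sat_trans i e : env_in D e -> (sat D Y (fTrans i) e <-> transitive (e i)).
Proof.
  intro he. unfold fTrans. simpl. split.
  - intros h y hy z hz. apply (h y); eauto.
  - intros h y _ hy z _ hz. exact (h y hy z hz).
Qed.

Lemma sat_ord i e : env_in D e -> (sat D Y (fOrd i) e <-> ordinal (e i)).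
Proof.
  intro he. unfold fOrd. rewrite sat_and, sat_trans; [|exact he].
  unfold ordinal. apply and_iff_compat_l. split.
  - intros h y hy. assert (hyD : y ∈ D) by eauto.
    apply (sat_trans 0 (scons y e)); [auto with env|]. exact (h y hyD hy).
  - intros h y hyD hy. apply (sat_trans 0 (scons y e)); [auto with env|]. exact (h y hy).
Qed.

Lemma sat_upair i j k e : env_in D e ->
  (sat D Y (fUpair i j k) e <-> e i = upair (e j) (e k)).
Proof.
  intro he. unfold fUpair. split.
  - intro h. apply set_ext. intro z. rewrite upair_spec.
    assert (hz : z ∈ D -> (z ∈ e i <-> z = e j \/ z = e k)).
    { intro hz. specialize (h z hz). rewrite sat_iff, sat_or in h. exact h. }
    split.
    + intro h'. apply hz; eauto.
    + intro h'. apply hz; [|exact h']. destruct h' as [-> | ->]; apply he.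
  - intros h z hz. rewrite sat_iff, sat_or. simpl. rewrite h. apply upair_spec.
Qed.

Lemma sat_opair i j k e : env_in D e ->
  (sat D Y (fOpair i j k) e <-> e i = opair (e j) (e k)).
Proof.
  intro he. unfold fOpair. rewrite sat_ex. split.
  - intros (v & hv & h). rewrite sat_ex in h. destruct h as (u & hu & h).
    rewrite !sat_and, !sat_upair in h; auto with env. simpl in h.
    destruct h as (h1 & h2 & h3). rewrite h3, h1, h2. reflexivity.
  - intro h. exists (upair (e j) (e k)).
    assert (h1 : upair (e j) (e k) ∈ D) by (apply H_upair; auto).
    assert (h2 : upair (e j) (e j) ∈ D) by (apply H_upair; auto).
    split; [exact h1|]. rewrite sat_ex. exists (upair (e j) (e j)). split; [exact h2|].
    rewrite !sat_and, !sat_upair; auto with env.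
Qed.

Lemma sat_pair_in k i j e : env_in D e ->
  (sat D Y (fPairIn k i j) e <-> opair (e i) (e j) ∈ e k).
Proof.
  intro he. unfold fPairIn. rewrite sat_ex. split.
  - intros (p & hp & h). rewrite sat_and, sat_opair in h; auto with env. simpl in h.
    destruct h as [h ->]. exact h.
  - intro h. exists (opair (e i) (e j)). assert (hD : opair (e i) (e j) ∈ D) by eauto.
    split; [exact hD|]. rewrite sat_and, sat_opair; auto with env.
Qed.

(** A countable [x] is the set of points reached from a point [a] by iterating a
    partial function [g]; quantifying over the sets closed under [g] expresses
    this without mentioning the natural numbers. *)
Definition generated x a g : Prop :=
  (forall u v w, opair u v ∈ g -> opair u w ∈ g -> v = w) /\
  (forall c, c ∈ D -> a ∈ c -> (forall u v, u ∈ c -> opair u v ∈ g -> v ∈ c) -> x ⊆ c).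

Lemma opair_components g u v : g ∈ D -> opair u v ∈ g -> u ∈ D /\ v ∈ D.
Proof.
  intros hg h. assert (hp : opair u v ∈ D) by eauto.
  assert (hq : upair u v ∈ D) by (apply (D_trans _ _ hp), upair_spec; auto).
  split; apply (D_trans _ _ hq), upair_spec; auto.
Qed.

Lemma sat_cnt_body x a g e : x ∈ D -> a ∈ D -> g ∈ D -> env_in D e ->
  (sat D Y fCntBody (scons g (scons a (scons x e))) <-> generated x a g).
Proof.
  intros hx ha hg he. unfold fCntBody. rewrite sat_and. unfold generated.
  assert (he' : env_in D (scons g (scons a (scons x e)))) by auto with env.
  split; intros [h1 h2]; split.
  - intros u v w huv huw.
    destruct (opair_components _ _ _ hg huv) as [hu hv].
    destruct (opair_components _ _ _ hg huw) as [_ hw'].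
    specialize (h1 u hu v hv w hw').
    assert (hee : env_in D (scons w (scons v (scons u (scons g (scons a (scons x e))))))).
    { auto with env. }
    apply h1; apply sat_pair_in; auto.
  - intros c hc hac hcl z hz. apply (h2 c hc hac); [|eauto|exact hz].
    intros u hu v hv huc huv. simpl. apply (hcl u v huc).
    apply (sat_pair_in 3 1 0) in huv; [exact huv|auto with env].
  - intros u hu v hv w hw' huv huw. simpl.
    apply (sat_pair_in 3 2 1) in huv; [|auto with env].
    apply (sat_pair_in 3 2 0) in huw; [|auto with env]. exact (h1 u v w huv huw).
  - intros c hc hac hcl z hz hzx. change (z ∈ c). apply (h2 c hc hac); [|exact hzx].
    intros u v huc huv. destruct (opair_components _ _ _ hg huv) as [hu hv].
    apply (hcl u hu v hv huc). apply (sat_pair_in 3 1 0); [auto with env|exact huv].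
Qed.

(** Order [x] by the least index [h] in an enumeration, let [a] be the first element and [g] the
    graph of the immediate successor. The order has type at most omega, so each element other than
    [a] has an immediate predecessor. *)
Lemma generated_exists x : x ∈ D -> cnt x -> exists a g, a ∈ D /\ g ∈ D /\ generated x a g.
Proof.
  intros hx hc. destruct hc as [f hf].
  destruct (classic (exists b, b ∈ x)) as [[b hb] | hempty].
  (* The empty set contains no pairs, so it can be its own [g]. *)
  2: { exists x, x. split; [exact hx|]. split; [exact hx|]. split.
       - intros u v w h. destruct hempty; eauto.
       - intros c _ _ _ z hz. destruct hempty; eauto. }
  assert (hn : forall z, exists n, z ∈ x -> z = f n /\ forall m, z = f m -> n <= m).
  { intro z. destruct (classic (z ∈ x)) as [hz | hz]; [|exists 0; tauto].
    destruct (hf z hz) as [n hn].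
    induction n as [n IH] using (well_founded_ind lt_wf).
    destruct (classic (exists m, m < n /\ z = f m)) as [(m & hm & e) | hno].
    - exact (IH m hm e).
    - exists n. intros _. split; [exact hn|]. intros m e.
      destruct (le_lt_dec n m); [auto|]. destruct hno; eauto. }
  apply choice in hn. destruct hn as [h hh].
  assert (hinj : forall u v, u ∈ x -> v ∈ x -> h u = h v -> u = v).
  { intros u v hu hv e. rewrite (proj1 (hh u hu)), (proj1 (hh v hv)), e. reflexivity. }
  assert (hleast : forall Q : U -> Prop, (exists b, b ∈ x /\ Q b) ->
    exists b, b ∈ x /\ Q b /\ forall c, c ∈ x -> Q c -> h b <= h c).
  { clear b hb. intros Q (b & hb & hQ). remember (h b) as n eqn:e. revert b hb hQ e.
    induction n as [n IH] using (well_founded_ind lt_wf). intros b hb hQ ->.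
    destruct (classic (exists c, c ∈ x /\ Q c /\ h c < h b)) as [(c & hc & hQc & hlt) | no].
    - exact (IH _ hlt c hc hQc eq_refl).
    - exists b. split; [exact hb|]. split; [exact hQ|]. intros c hc hQc.
      destruct (le_lt_dec (h b) (h c)); [auto|]. destruct no; eauto. }
  destruct (hleast (fun _ => True)) as (a & ha & _ & hmin); [eauto|].
  set (next := fun u v => u ∈ x /\ v ∈ x /\ h u < h v /\
    forall w, w ∈ x -> h u < h w -> h v <= h w).
  set (G := fun p => exists u v, next u v /\ p = opair u v).
  assert (hG : forall p, p ∈ setof G <-> G p).
  { apply setof_spec. apply is_set_sub with (big_union x (fun u => img x (opair u))).
    intros p (u & v & (hu & hv & _) & ->). apply big_union_spec. exists u.
    split; [exact hu|]. apply img_spec. eauto. }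
  assert (hGp : forall u v, opair u v ∈ setof G <-> next u v).
  { intros u v. rewrite hG. split.
    - intros (u' & v' & hnx & e). apply opair_inj in e. destruct e as [-> ->]. exact hnx.
    - intro. exists u, v. auto. }
  exists a, (setof G). split; [eauto|]. split.
  { apply H_countable; auto.
    - exists (fun k => opair (f (fst (of_nat k))) (f (snd (of_nat k)))).
      intros p hp. apply hG in hp. destruct hp as (u & v & (hu & hv & _) & ->).
      exists (to_nat (h u, h v)). rewrite cancel_of_to. simpl.
      rewrite <- (proj1 (hh u hu)), <- (proj1 (hh v hv)). reflexivity.
    - intros p hp. apply hG in hp. destruct hp as (u & v & (hu & hv & _) & ->).
      apply H_opair; eauto. }
  split.
  - intros u v w h1 h2. apply hGp in h1, h2.
    destruct h1 as (hu & hv & l1 & m1), h2 as (_ & hw' & l2 & m2).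
    apply hinj; auto. apply Nat.le_antisymm; auto.
  - intros c hc hac hcl. apply NNPP. intro no.
    apply not_all_ex_not in no. destruct no as [z no].
    apply imply_to_and in no. destruct no as [hz hzc].
    (* the first element [v] missing from [c] has a predecessor [u] in [c] *)
    destruct (hleast (fun v => ~ v ∈ c)) as (v & hv & hvc & hvmin); [eauto|].
    assert (hav : h a < h v).
    { specialize (hmin v hv I). destruct (Nat.eq_dec (h a) (h v)) as [e|]; [|lia].
      destruct hvc. rewrite <- (hinj a v ha hv e). exact hac. }
    assert (hpred : exists u, u ∈ x /\ h u < h v /\ forall w, w ∈ x -> h w < h v -> h w <= h u).
    (* Downward search from [h v]: after [n] steps either [h a] has been reached, or a predecessor
       has been found, or no index occurs in the [n] places just below [h v]. *)
    { assert (hb' : forall n, n <= h v -> h v - n <= h a \/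
        (exists u, u ∈ x /\ h u < h v /\ forall w, w ∈ x -> h w < h v -> h w <= h u) \/
        (forall w, w ∈ x -> h w < h v -> h w < h v - n)).
      { induction n as [|n IH]; intro hn.
        - right; right. intros w _ hwv. lia.
        - destruct IH as [IH | [IH | IH]]; [lia|left; lia|auto|].
          destruct (classic (exists u, u ∈ x /\ h u = h v - S n)) as [(u & hu & e) | no].
          + right; left. exists u. split; [exact hu|]. split; [lia|].
            intros w hwx hwv. specialize (IH w hwx hwv). lia.
          + right; right. intros w hwx hwv. specialize (IH w hwx hwv).
            destruct (Nat.eq_dec (h w) (h v - S n)) as [e|]; [destruct no; eauto|lia]. }
      destruct (hb' (h v - h a)) as [hb'' | [hb'' | hb'']]; [lia| |exact hb''|].
      (* One step fewer stops just above [h a]; if nothing has been found by then, [a] itself is the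
         predecessor. *)
      - destruct (hb' (h v - S (h a))) as [h3 | [h3 | h3]]; [lia|lia|exact h3|].
        exists a. split; [exact ha|]. split; [exact hav|]. intros w hwx hwv.
        specialize (h3 w hwx hwv). lia.
      - specialize (hb'' a ha hav). lia. }
    destruct hpred as (u & hu & huv & hmax). apply hvc. apply (hcl u v).
    + apply NNPP. intro huc. specialize (hvmin u hu huc). lia.
    + apply hGp. split; [exact hu|]. split; [exact hv|]. split; [exact huv|].
      intros w hwx huw. destruct (le_lt_dec (h v) (h w)); [auto|].
      specialize (hmax w hwx l). lia.
Qed.

(** * Countable elementary submodels *)

Lemma XX_spec N : N ∈ XX lam Y <-> countable N /\ elementary N D Y.
Proof.
  apply (setof_spec (fun N => countable N /\ elementary N D Y)).
  apply is_set_sub with (powerset D). intros N' (_ & h & _). apply powerset_spec, h.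
Qed.

Section Submodel.

Variables (N : U) (hN : N ∈ XX lam Y).

Lemma model_cnt : cnt N.
Proof. apply XX_spec in hN. apply countable_cnt, hN. Qed.

Lemma model_sub x : x ∈ N -> x ∈ D.
Proof. apply XX_spec in hN. destruct hN as (_ & h & _). apply h. Qed.

Lemma model_in_H : N ∈ D.
Proof. apply H_countable; auto. - apply model_cnt. - apply model_sub. Qed.

Lemma model_sat A e : env_in N e -> (sat N Y A e <-> sat D Y A e).
Proof. apply XX_spec in hN. destruct hN as (_ & _ & _ & h). apply h. Qed.

Lemma model_env e : env_in N e -> env_in D e.
Proof. intros h n. apply model_sub, h. Qed.

(** The witness moves into [N] while satisfaction stays in [H lam], where the formulas have their
    intended meaning. *)
Lemma model_ex A e : env_in N e -> (exists x, x ∈ D /\ sat D Y A (scons x e)) ->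
  exists x, x ∈ N /\ sat D Y A (scons x e).
Proof.
  intros he h. apply sat_ex, model_sat, sat_ex in h; [|exact he].
  destruct h as (x & hx & h). exists x. split; [exact hx|].
  apply model_sat; [auto with env|exact h].
Qed.

Lemma model_definable A e y : env_in N e -> y ∈ D ->
  (forall z, z ∈ D -> (sat D Y A (scons z e) <-> z = y)) -> y ∈ N.
Proof.
  intros he hy h. destruct (model_ex A e he) as (x & hx & hs).
  - exists y. split; [exact hy|]. apply h; auto.
  - apply h in hs; [subst; exact hx|apply model_sub, hx].
Qed.

(** Elementarity transfers extensionality: [N] need not be transitive, but it sees a difference
    between any two of its members. *)
Lemma model_ext a b : a ∈ N -> b ∈ N -> (forall z, z ∈ N -> (z ∈ a <-> z ∈ b)) -> a = b.
Proof.
  intros ha hb h. set (e := scons a (fun _ => b)).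
  assert (he : env_in N e) by (unfold e; auto with env).
  assert (hs : sat N Y (All (fIff (Mem 0 1) (Mem 0 2))) e).
  { intros z hz. rewrite sat_iff. exact (h z hz). }
  apply model_sat in hs; [|exact he]. apply set_ext. intro z.
  assert (hz : z ∈ D -> (z ∈ a <-> z ∈ b)).
  { intro hz. specialize (hs z hz). rewrite sat_iff in hs. exact hs. }
  split; intro h'; apply hz; eauto using model_sub.
Qed.

Lemma model_inhabited : exists x, x ∈ N.
Proof. apply XX_spec in hN. apply hN. Qed.

Lemma model_empty : empty ∈ N.
Proof.
  destruct model_inhabited as [x hx].
  apply (model_definable (All (fNot (Mem 0 1))) (fun _ => x)); auto with env.
  - apply H_countable; auto.
    + exists (fun _ => empty). intros z hz. destruct (empty_ax U _ hz).
    + intros z hz. destruct (empty_ax U _ hz).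
  - intros z hz. split.
    + intro h. apply set_ext. intro w. split; intro hw'.
      * exfalso. apply (h w); [eauto|exact hw'].
      * destruct (empty_ax U _ hw').
    + intros -> w _. simpl. apply empty_ax.
Qed.

Lemma model_succ x : x ∈ N -> succ x ∈ D -> succ x ∈ N.
Proof.
  intros hx hs.
  apply (model_definable (All (fIff (Mem 0 1) (fOr (Mem 0 2) (Eq 0 2)))) (fun _ => x));
    auto with env.
  intros z hz. split.
  - intro h. apply set_ext. intro w. rewrite succ_spec.
    assert (hw' : w ∈ D -> (w ∈ z <-> w ∈ x \/ w = x)).
    { intro hw'. specialize (h w hw'). rewrite sat_iff, sat_or in h. exact h. }
    split; intro h'; apply hw'; eauto.
    destruct h' as [h' | ->]; eauto using model_sub.
  - intros -> w _. rewrite sat_iff, sat_or. simpl. apply succ_spec.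
Qed.

Lemma model_union x : x ∈ N -> union x ∈ N.
Proof.
  intro hx.
  apply (model_definable (All (fIff (Mem 0 1) (fEx (fAnd (Mem 0 3) (Mem 1 0))))) (fun _ => x));
    auto with env.
  { apply H_union; auto. apply model_sub, hx. }
  assert (key : forall w z, sat D Y (fEx (fAnd (Mem 0 3) (Mem 1 0)))
    (scons w (scons z (fun _ => x))) <-> w ∈ union x).
  { intros w z. rewrite sat_ex, union_spec. split.
    - intros (y & _ & h). rewrite sat_and in h. eauto.
    - intros (y & hy & h). exists y. rewrite sat_and. split; [|auto].
      apply (D_trans x); [apply model_sub, hx|exact hy]. }
  intros z hz. split.
  - intro h. apply set_ext. intro w.
    assert (hw' : w ∈ D -> (w ∈ z <-> w ∈ union x)).
    { intro hw'. specialize (h w hw'). rewrite sat_iff, key in h. exact h. }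
    split; intro h'; apply hw'; eauto.
    apply (D_trans (union x)); [|exact h']. apply H_union; auto. apply model_sub, hx.
  - intros -> w _. rewrite sat_iff, key. reflexivity.
Qed.

(** [N] is an element of [H lam] and, since [g] is functional, is closed under [g] by elementarity.
    It is therefore one of the sets over which [generated] quantifies. *)
Lemma generated_sub_model x a g : a ∈ N -> g ∈ N -> generated x a g -> x ⊆ N.
Proof.
  intros ha hg [h1 h2]. apply h2; [apply model_in_H|exact ha|].
  intros u v hu huv.
  destruct (model_ex (fPairIn 2 1 0) (scons u (fun _ => g))) as (w & hw' & h).
  - auto with env.
  - exists v. destruct (opair_components g u v (model_sub g hg) huv) as [hu' hv].
    split; [exact hv|]. apply (sat_pair_in 2 1 0); [auto using model_sub with env|exact huv].
  - apply (sat_pair_in 2 1 0) in h; [|auto using model_sub with env].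
    simpl in h. rewrite (h1 u v w huv h). exact hw'.
Qed.

(** From left to right the model does the work: generators found in [N] place [x] inside the
    countable set [N], so no enumeration is constructed by recursion. *)
Lemma sat_cnt x : x ∈ N -> (sat D Y fCnt (fun _ => x) <-> cnt x).
Proof.
  intro hx. pose proof (model_sub x hx) as hxD.
  assert (ex : forall e : nat -> U, e = (fun _ => x) -> e = scons x (fun _ => x)).
  { intros e ->. apply functional_extensionality. intros [|n]; reflexivity. }
  split.
  - intro h. unfold fCnt in h. apply sat_ex, model_ex in h; [|auto with env].
    destruct h as (a & ha & h). apply sat_ex, model_ex in h; [|auto with env].
    destruct h as (g & hg & h).
    rewrite (ex _ eq_refl) in h.
    apply sat_cnt_body in h; auto using model_sub with env.
    apply cnt_sub with N; [apply model_cnt|]. exact (generated_sub_model x a g ha hg h).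
  - intro hc. destruct (generated_exists x hxD hc) as (a & g & ha & hg & h).
    unfold fCnt. rewrite sat_ex. exists a. split; [exact ha|].
    rewrite sat_ex. exists g. split; [exact hg|]. rewrite (ex _ eq_refl).
    apply sat_cnt_body; auto with env.
Qed.

(** This is what makes [delta N] an initial segment of [omega1]. *)
Lemma model_countable_sub x : x ∈ N -> cnt x -> x ⊆ N.
Proof.
  intros hx hc. apply (sat_cnt x hx) in hc.
  assert (ex : (fun _ : nat => x) = scons x (fun _ => x)).
  { apply functional_extensionality. intros [|n]; reflexivity. }
  unfold fCnt in hc. apply sat_ex, model_ex in hc; [|auto with env].
  destruct hc as (a & ha & h). apply sat_ex, model_ex in h; [|auto with env].
  destruct h as (g & hg & h). rewrite ex in h.
  apply sat_cnt_body in h; auto using model_sub with env.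
  exact (generated_sub_model x a g ha hg h).
Qed.

Definition delta : U := inter N omega1.

Lemma delta_spec a : a ∈ delta <-> a ∈ N /\ a ∈ omega1.
Proof. apply inter_spec. Qed.

Lemma delta_ord : ordinal delta.
Proof.
  apply ord_intro.
  - intros y hy z hz. apply delta_spec in hy. destruct hy as [h1 h2].
    apply delta_spec. split.
    + apply (model_countable_sub y h1); [|exact hz]. apply omega1_spec in h2. apply h2.
    + exact (ord_trans _ _ _ ord_omega1 h2 hz).
  - intros x hx. apply delta_spec in hx. exact (ord_elem _ _ ord_omega1 (proj2 hx)).
Qed.

Lemma delta_in_omega1 : delta ∈ omega1.
Proof.
  apply omega1_spec. split; [apply delta_ord|]. apply cnt_sub with N; [apply model_cnt|].
  intros z hz. apply delta_spec in hz. apply hz.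
Qed.

Lemma delta_notin : ~ delta ∈ N.
Proof.
  intro h. apply (mem_irrefl delta). apply delta_spec. split; [exact h|].
  apply delta_in_omega1.
Qed.

Lemma numeral_in_model n : numeral n ∈ N.
Proof.
  induction n as [|n IH]; simpl; [apply model_empty|]. apply model_succ; [exact IH|].
  apply H_ord; auto. apply (ord_trans lam omega); auto. apply omega_spec.
  exists (S n). reflexivity.
Qed.

End Submodel.

(** [delta M] is definable from [M] alone, as the only ordinal outside [M] all of whose members
    belong to [M]. *)
Lemma delta_mem M N : M ∈ XX lam Y -> N ∈ XX lam Y -> M ∈ N -> delta M ∈ delta N.
Proof.
  intros hM hN hMN. apply delta_spec. split; [|apply delta_in_omega1, hM].
  set (A := fAnd (fOrd 0) (fAnd (fNot (Mem 0 1)) (All (Imp (Mem 0 1) (Mem 0 2))))).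
  apply (model_definable N hN A (fun _ => M)); auto with env.
  - apply H_countable; auto.
    + apply (cnt_sub _ M); [apply model_cnt, hM|]. intros z hz.
      apply delta_spec in hz. apply hz.
    + intros z hz. apply delta_spec in hz. apply (model_sub M hM). apply hz.
  - intros z hz. unfold A. rewrite !sat_and, sat_ord, sat_not; simpl.
    2: { apply env_in_scons; [exact hz|]. apply env_in_const, (model_sub N hN), hMN. }
    pose proof (delta_ord M hM) as od. split.
    + intros (oz & hzM & hsub).
      destruct (ord_tricho z (delta M) oz od) as [h | [h | h]]; [|exact h|].
      * apply delta_spec in h. tauto.
      * destruct (delta_notin M hM). apply hsub; [|exact h]. eauto.
    + intros ->. split; [exact od|]. split; [apply delta_notin, hM|].
      intros w _ hwd. apply delta_spec in hwd. apply hwd.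
Qed.

(** * Isomorphisms of models *)

Lemma is_iso_inj M N s a b : is_iso Y M N s -> a ∈ M -> b ∈ M -> s a = s b -> a = b.
Proof.
  intros (h1 & h2 & _) ha hb e. destruct (h2 (s b) (h1 b hb)) as (c & _ & hc).
  rewrite <- (hc a (conj ha e)). apply hc. auto.
Qed.

Lemma isomorphic_refl M : isomorphic Y M M.
Proof.
  exists (fun x => x). split; [auto|]. split; [|split; reflexivity].
  intros b hb. exists b. split; [auto|]. intros c [_ hc]. auto.
Qed.

Lemma isomorphic_sym M N : isomorphic Y M N -> isomorphic Y N M.
Proof.
  intros [s hs]. destruct hs as (h1 & h2 & h3 & h4).
  set (t := fun b => epsilon (inhabits empty) (fun a => a ∈ M /\ s a = b)).
  assert (ht : forall b, b ∈ N -> t b ∈ M /\ s (t b) = b).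
  { intros b hb. apply (epsilon_spec (inhabits empty) (fun a => a ∈ M /\ s a = b)).
    destruct (h2 b hb) as (a & ha & _). eauto. }
  exists t. split; [|split; [|split]].
  - intros b hb. apply ht, hb.
  - intros a ha. exists (s a). split.
    + split; [auto|]. destruct (ht (s a) (h1 a ha)) as [h5 h6].
      apply (is_iso_inj M N s); auto. unfold is_iso; auto.
    + intros b [hb <-]. apply ht, hb.
  - intros a b ha hb. destruct (ht a ha) as [h5 h6], (ht b hb) as [h7 h8].
    rewrite (h3 _ _ h5 h7), h6, h8. reflexivity.
  - intros a ha. destruct (ht a ha) as [h5 h6]. rewrite (h4 _ h5), h6. reflexivity.
Qed.

Lemma sigma_iso M N : isomorphic Y M N -> is_iso Y M N (sigma Y M N).
Proof. intro h. exact (epsilon_spec _ _ h). Qed.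

Lemma sat_iso M N s A e : is_iso Y M N s -> env_in M e ->
  (sat M Y A e <-> sat N Y A (fun n => s (e n))).
Proof.
  intro hs. pose proof hs as (h1 & h2 & h3 & h4). revert e.
  assert (hsc : forall x e, (fun n => s (scons x e n)) = scons (s x) (fun n => s (e n))).
  { intros x e. apply functional_extensionality. intros [|n]; reflexivity. }
  induction A as [i j | i j | i | | A IHA B IHB | A IH]; intros e he; simpl.
  - apply h3; apply he.
  - split; [congruence|]. apply (is_iso_inj M N s); auto.
  - apply h4, he.
  - reflexivity.
  - rewrite IHA, IHB by exact he. reflexivity.
  - split.
    + intros h y hy. destruct (h2 y hy) as (x & [hx <-] & _).
      rewrite <- hsc. apply IH; auto with env.
    + intros h x hx. apply IH; [auto with env|]. rewrite hsc. auto.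
Qed.

Section Iso.

Variables (M N : U) (s : U -> U).
Hypotheses (hM : M ∈ XX lam Y) (hN : N ∈ XX lam Y) (hs : is_iso Y M N s).

Lemma iso_mem a : a ∈ M -> s a ∈ N.
Proof. destruct hs as (h & _). apply h. Qed.

Lemma iso_sat_H A e : env_in M e -> (sat D Y A e <-> sat D Y A (fun n => s (e n))).
Proof.
  intro he. rewrite <- (model_sat M hM A e he), (sat_iso M N s A e hs he).
  apply (model_sat N hN). intro n. apply iso_mem, he.
Qed.

Lemma iso_cnt x : x ∈ M -> (cnt x <-> cnt (s x)).
Proof.
  intro hx. rewrite <- (sat_cnt M hM x hx), <- (sat_cnt N hN (s x) (iso_mem x hx)).
  apply (iso_sat_H fCnt (fun _ => x)). auto with env.
Qed.

Lemma iso_ord x : x ∈ M -> (ordinal x <-> ordinal (s x)).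
Proof.
  intro hx.
  assert (hx' : env_in M (fun _ => x)) by auto with env.
  pose proof (iso_sat_H (fOrd 0) _ hx') as h.
  rewrite !sat_ord in h; [exact h| |].
  - apply env_in_const, (model_sub N hN), iso_mem, hx.
  - apply (model_env M hM), hx'.
Qed.

Lemma iso_omega1 x : x ∈ M -> (x ∈ omega1 <-> s x ∈ omega1).
Proof. intro hx. rewrite !omega1_spec, <- iso_ord, <- iso_cnt by exact hx. reflexivity. Qed.

(** Membership induction: [a] and [s a] are countable, hence included in their models, so the
    members of [s a] are exactly the images of the members of [a]. *)
Lemma iso_fix_delta a : a ∈ delta M -> s a = a.
Proof.
  induction a as [a IH] using mem_ind. intro ha.
  pose proof (proj1 (delta_spec M a) ha) as [haM haw].
  assert (hin : forall b, b ∈ a -> b ∈ delta M).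
  { intros b hb. exact (ord_trans _ _ _ (delta_ord M hM) ha hb). }
  assert (hsw : s a ∈ omega1) by exact (proj1 (iso_omega1 a haM) haw).
  destruct hs as (h1 & h2 & h3 & _).
  apply set_ext. intro z. split; intro hz.
  - assert (hzN : z ∈ N).
    { apply (model_countable_sub N hN (s a)); [auto| |exact hz].
      apply omega1_spec in hsw. apply hsw. }
    destruct (h2 z hzN) as (b & [hb <-] & _). apply h3 in hz; auto.
    rewrite IH; auto.
  - pose proof (proj1 (delta_spec M z) (hin z hz)) as [hzM _].
    rewrite <- (IH z hz (hin z hz)). apply (h3 z a hzM haM), hz.
Qed.

Lemma iso_delta : delta M = delta N.
Proof.
  apply set_ext. intro a. split; intro ha.
  - pose proof (proj1 (delta_spec M a) ha) as [haM haw]. apply delta_spec.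
    split; [|exact haw]. rewrite <- (iso_fix_delta a ha). apply iso_mem, haM.
  - pose proof (proj1 (delta_spec N a) ha) as [haN haw].
    destruct hs as (_ & h2 & _). destruct (h2 a haN) as (b & [hb e] & _).
    assert (hbd : b ∈ delta M).
    { apply delta_spec. split; [exact hb|]. apply (iso_omega1 b hb). congruence. }
    rewrite <- e, (iso_fix_delta b hbd). exact hbd.
Qed.

Lemma iso_numeral n : s (numeral n) = numeral n.
Proof.
  apply iso_fix_delta. apply delta_spec. split; [apply numeral_in_model, hM|].
  apply omega_sub_omega1, omega_spec. eauto.
Qed.

Lemma iso_codes (R : U -> U -> Prop) a b : codes D Y R -> a ∈ M -> b ∈ M ->
  (R a b <-> R (s a) (s b)).
Proof.
  intros [A hA] ha hb.
  assert (he : env_in M (scons a (fun _ => b))) by auto with env.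
  rewrite (hA a b), (hA (s a) (s b));
    try (apply (model_sub M hM); assumption); try (apply (model_sub N hN), iso_mem; assumption).
  rewrite (iso_sat_H A _ he).
  replace (fun n => s (scons a (fun _ => b) n)) with (scons (s a) (fun _ : nat => s b));
    [reflexivity|].
  apply functional_extensionality. intros [|n]; reflexivity.
Qed.

Section Continuum.

Variable r : U.
Hypotheses (hr : is_bij r continuum (powerset omega)) (hZ : codes D Y (Zrel r)).
Hypothesis hcont : continuum ∈ lam.

(** That both are indices matters: [Zrel] holds of nothing outside [continuum], so any other set
    would look like the index of the empty real. *)
Lemma real_eq i j : i ∈ continuum -> j ∈ continuum ->
  (forall n, Zrel r i (numeral n) <-> Zrel r j (numeral n)) -> i = j.
Proof.
  destruct hr as (r1 & r2 & r3). intros hi hj h.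
  destruct (r2 i hi) as (x & hx & ux), (r2 j hj) as (y & hy & uy).
  assert (hxw : forall k z, opair k z ∈ r -> z ∈ powerset omega).
  { intros k z hz. destruct (r1 _ hz) as (u & v & _ & hv & e).
    apply opair_inj in e. destruct e as [_ ->]. exact hv. }
  assert (e : x = y).
  { apply set_ext. intro z. split; intro hz.
    - pose proof (hxw _ _ hx) as hp. rewrite powerset_spec in hp.
      destruct (proj1 (omega_spec z) (hp z hz)) as [n ->].
      assert (hZi : Zrel r i (numeral n)) by (split; eauto).
      apply h in hZi. destruct hZi as (_ & y' & hy' & hn). rewrite (uy y' hy'). exact hn.
    - pose proof (hxw _ _ hy) as hp. rewrite powerset_spec in hp.
      destruct (proj1 (omega_spec z) (hp z hz)) as [n ->].
      assert (hZj : Zrel r j (numeral n)) by (split; eauto).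
      apply h in hZj. destruct hZj as (_ & x' & hx' & hn). rewrite (ux x' hx'). exact hn. }
  subst y. destruct (r3 x (hxw _ _ hx)) as (k & _ & uk).
  rewrite <- (uk i hx), <- (uk j hy). reflexivity.
Qed.

Lemma iso_real i : i ∈ M -> i ∈ continuum -> s i ∈ continuum -> s i = i.
Proof.
  intros hi hic hsc. apply real_eq; auto. intro n.
  rewrite (iso_codes (Zrel r) i (numeral n) hZ hi (numeral_in_model M hM n)), iso_numeral.
  reflexivity.
Qed.

(* At most one index codes the empty real; there [Zrel] does not see that [s i]
   is an index, which is recovered from the next index [succ i]. *)
Lemma iso_fix_continuum i : i ∈ M -> i ∈ continuum -> s i = i.
Proof.
  intros hi hic. apply iso_real; auto.
  assert (key : forall j n, j ∈ M -> Zrel r j (numeral n) -> s j ∈ continuum).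
  { intros j n hj h.
    apply (iso_codes (Zrel r) j (numeral n) hZ hj (numeral_in_model M hM n)) in h. apply h. }
  destruct (classic (exists n, Zrel r i (numeral n))) as [[n h] | no]; [eauto|].
  pose proof (continuum_succ i hic) as hsuc.
  assert (hsM : succ i ∈ M).
  { apply (model_succ M hM); [exact hi|]. apply H_ord; auto.
    exact (ord_trans _ _ _ hlam hcont hsuc). }
  destruct (classic (exists n, Zrel r (succ i) (numeral n))) as [[n h] | no'].
  - assert (e : s (succ i) = succ i) by (apply iso_real; eauto).
    assert (hm : s i ∈ succ i).
    { rewrite <- e. destruct hs as (_ & _ & h3 & _). apply (h3 i (succ i) hi hsM).
      apply succ_spec; auto. }
    exact (ord_trans _ _ _ ord_continuum hsuc hm).
  - exfalso. apply (mem_irrefl i).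
    assert (e : i = succ i).
    { apply real_eq; auto. intro n. split; intro h; exfalso; eauto. }
    rewrite e at 2. apply succ_spec; auto.
Qed.

End Continuum.

End Iso.

(** An extensional structure with well-founded membership is rigid. This identifies [sigma Y N N],
    which is picked by epsilon. *)
Lemma automorphism_id M s : M ∈ XX lam Y -> is_iso Y M M s -> forall a, a ∈ M -> s a = a.
Proof.
  intros hM (h1 & h2 & h3 & _). induction a as [a IH] using mem_ind. intro ha.
  apply (model_ext M hM); auto. intros z hz. split; intro h.
  - destruct (h2 z hz) as (b & [hb <-] & _). apply h3 in h; auto. rewrite IH; auto.
  - rewrite <- (IH z h hz). apply (h3 z a hz ha), h.
Qed.

Lemma isomorphic_continuum M N r : M ∈ XX lam Y -> N ∈ XX lam Y -> isomorphic Y M N ->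
  is_bij r continuum (powerset omega) -> codes D Y (Zrel r) -> continuum ∈ lam ->
  inter M continuum = inter N continuum.
Proof.
  intros hM hN h hr hZ hc.
  assert (half : forall M N, M ∈ XX lam Y -> N ∈ XX lam Y -> isomorphic Y M N ->
    inter M continuum ⊆ inter N continuum).
  { clear M N hM hN h. intros M N hM hN [s hs] i hi. apply inter_spec in hi.
    apply inter_spec. split; [|apply hi].
    destruct hi as [hiM hic].
    rewrite <- (iso_fix_continuum M N s hM hN hs r hr hZ hc i hiM hic).
    apply (iso_mem M N s); auto. }
  apply set_ext. intro i. split; apply half; auto using isomorphic_sym.
Qed.

(** If [M < N], coherence provides a copy [N'] of [N] with [M ∈ N'], so [delta M] belongs to
    [delta N'], which is [delta N]. Equal traces thus exclude both strict comparisons, adequacy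
    leaves [M ~ N], and coherence makes the two models isomorphic. *)
Lemma coherent_same_continuum A M N r : coherent_adequate lam Y A ->
  is_bij r continuum (powerset omega) -> codes D Y (Zrel r) -> continuum ∈ lam ->
  M ∈ A -> N ∈ A -> delta M = delta N -> inter M continuum = inter N continuum.
Proof.
  intros ([hA htri] & h1 & h2 & _) hr hZ hc hM hN e.
  assert (hlt : forall M N, M ∈ A -> N ∈ A -> mlt M N -> delta M ∈ delta N).
  { clear M N hM hN e. intros M N hM hN hlt.
    destruct (h2 M N hM hN hlt) as (N' & hN' & [s hs] & hmem).
    rewrite (iso_delta N N' s); auto. apply delta_mem; auto. }
  destruct (htri M N hM hN) as [h | [h | h]].
  - apply hlt in h; auto. rewrite e in h. destruct (mem_irrefl _ h).
  - apply (isomorphic_continuum M N r); auto. apply (h1 M N hM hN h).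
  - apply hlt in h; auto. rewrite e in h. destruct (mem_irrefl _ h).
Qed.

(** * A single model is a coherent adequate set *)

Section Singleton.

Variable S : U.
Hypothesis hSstat : stationary_omega2 (setof (fun alpha => alpha ∈ S /\ cf alpha = omega1)).
Hypothesis hge : omega2 ⊆ lam.

Lemma Lambda_spec b : b ∈ Lambda <-> b ∈ omega2 /\ cf b = omega1.
Proof.
  apply (setof_spec (fun beta => beta ∈ omega2 /\ cf beta = omega1)).
  apply is_set_sub with omega2. intros z [h _]; exact h.
Qed.

(** The stationary set meets the club of ordinals above [a]; this avoids computing the cofinality of
    any particular ordinal. *)
Lemma Lambda_unbounded a : a ∈ omega2 -> exists b, b ∈ Lambda /\ a ∈ b.
Proof.
  intro ha. set (C := setof (fun b => b ∈ omega2 /\ a ∈ b)).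
  assert (hC : forall b, b ∈ C <-> b ∈ omega2 /\ a ∈ b).
  { apply setof_spec. apply is_set_sub with omega2. intros z [h _]; exact h. }
  destruct (hSstat C) as (b & hb & hbS).
  - split; [|split].
    + intros z hz. apply hC, hz.
    + intros x hx.
      pose proof (ord_elem _ _ ord_omega2 ha) as oa.
      pose proof (ord_elem _ _ ord_omega2 hx) as ox.
      destruct (classic (a ∈ x)) as [h | h].
      * exists (succ x). rewrite hC. split; [|apply succ_spec; auto].
        split; [apply omega2_succ, hx|apply succ_spec; auto].
      * exists (succ a). rewrite hC. split.
        { split; [apply omega2_succ, ha|apply succ_spec; auto]. }
        apply succ_spec. destruct (ord_sub x a ox oa); auto.
        apply ord_not_mem; auto.
    + intros d hd hne hu. apply hC. split; [exact hd|].
      assert (hex : exists z, z ∈ d).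
      { apply NNPP. intro no. apply hne. apply set_ext. intro z. split; intro hz.
        - destruct no; eauto.
        - destruct (empty_ax U _ hz). }
      destruct hex as [z hz]. rewrite <- hu in hz. apply union_spec in hz.
      destruct hz as (y & hy & _). apply inter_spec in hy. destruct hy as [hyC hyd].
      apply hC in hyC. destruct hyC as [_ hay].
      exact (ord_trans _ _ _ (ord_elem _ _ ord_omega2 hd) hyd hay).
  - exists b. apply hC in hb. split; [|apply hb]. apply Lambda_spec.
    split; [apply hb|].
    apply (setof_spec (fun alpha => alpha ∈ S /\ cf alpha = omega1)) in hbS; [apply hbS|].
    apply is_set_sub with S. intros z [h _]; exact h.
Qed.

Variables (N : U) (hN : N ∈ XX lam Y).

Definition sup_omega2 : U := union (inter N omega2).

Notation sup := sup_omega2.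

Lemma model_sup : sup ∈ omega2 /\ forall a, a ∈ N -> a ∈ omega2 -> a ∈ sup.
Proof.
  split.
  - apply omega2_sup.
    + apply cnt_sub with N; [apply model_cnt, hN|]. intros z hz. apply inter_spec in hz.
      apply hz.
    + intros z hz. apply inter_spec in hz. apply hz.
  - intros a ha haw. apply union_spec. exists (succ a).
    pose proof (omega2_succ a haw) as hs. split; [|apply succ_spec; auto].
    apply inter_spec. split; [|exact hs]. apply (model_succ N hN); [exact ha|].
    apply H_ord; auto.
Qed.

Lemma model_inter_above_sup b : b ⊆ omega2 -> sup ⊆ b -> inter N b = inter N omega2.
Proof.
  intros hb h. apply set_ext. intro z. rewrite !inter_spec.
  split; intros [h1 h2]; split; auto. apply h. apply model_sup; auto.
Qed.

(** [cmp N N] is the least element of [Lambda] that is at least [sup], so cutting [N] there keeps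
    all its ordinals below [omega2]. *)
Lemma cmp_self : cmp N N ∈ omega2 /\ inter N (cmp N N) = inter N omega2.
Proof.
  destruct model_sup as [hsw hsup].
  assert (osup : ordinal sup) by exact (ord_elem _ _ ord_omega2 hsw).
  assert (oL : forall b, b ∈ Lambda -> ordinal b /\ b ⊆ omega2).
  { intros b hb. apply Lambda_spec in hb. destruct hb as [hb _].
    split; [exact (ord_elem _ _ ord_omega2 hb)|exact (proj1 ord_omega2 b hb)]. }
  assert (hLN : forall b, b ∈ Lambda_of N <->
    b ∈ Lambda /\ is_min Lambda (union (inter N b)) b).
  { apply setof_spec. apply is_set_sub with Lambda. intros z [h _]; exact h. }
  destruct (Lambda_unbounded sup hsw) as (b0 & hb0 & hsb0).
  destruct (ord_least (fun b => b ∈ Lambda /\ sup ⊆ b) b0) as (b & ob & [hb hsb] & hmin).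
  { apply oL, hb0. }
  { split; [exact hb0|]. exact (proj1 (proj1 (oL _ hb0)) _ hsb0). }
  assert (hNb : inter N b = inter N omega2).
  { apply model_inter_above_sup; [apply oL, hb|exact hsb]. }
  assert (hbL : b ∈ Lambda_of N).
  { apply hLN. split; [exact hb|]. rewrite hNb. split; [exact hb|].
    split; [apply Lambda_spec, hb|]. split; [exact hsb|].
    intros d hd _ hsd. apply hmin; [apply oL, hd|auto]. }
  assert (hmax : forall c, c ∈ Lambda_of N -> c ⊆ b).
  { intros c hc. apply hLN in hc. destruct hc as [hcL (_ & _ & hcs & hcm)].
    destruct (oL c hcL) as [oc hcw].
    (* If [b] is below [c], then [N] has the same part below [c] as below [omega2], so [b] competes
       for the minimum that [c] attains. *)
    destruct (classic (b ∈ c)) as [h | h]; [|apply ord_not_mem; auto].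
    apply (hcm b hb); [apply Lambda_spec, hb|].
    rewrite (model_inter_above_sup c hcw); [exact hsb|].
    intros z hz. apply (ord_trans c b); auto. }
  destruct (epsilon_spec (inhabits empty)
    (fun beta => beta ∈ Lambda_of N /\ beta ∈ Lambda_of N /\
      forall gamma, gamma ∈ Lambda_of N -> gamma ∈ Lambda_of N -> gamma ⊆ beta))
    as (h1 & _ & h2).
  { exists b. split; [exact hbL|]. split; [exact hbL|].
    intros c hc _. exact (hmax c hc). }
  fold (the (fun beta => beta ∈ Lambda_of N /\ beta ∈ Lambda_of N /\
      forall gamma, gamma ∈ Lambda_of N -> gamma ∈ Lambda_of N -> gamma ⊆ beta)) in h1, h2.
  fold (cmp N N) in h1, h2.
  assert (e : cmp N N = b).
  { apply set_ext. intro z. split; [apply hmax, h1|apply h2; exact hbL]. }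
  rewrite e. split; [apply Lambda_spec, hb|exact hNb].
Qed.

(** [N ~ N] holds and [N < N] fails. There are no remainder points, because no ordinal of [N] below
    [omega2] lies at or above [cmp N N], so the condition on [S] is vacuous. *)
Lemma singleton_S_coherent_adequate : S_coherent_adequate lam Y S (upair N N).
Proof.
  destruct cmp_self as [hcw hce]. destruct model_sup as [hsw hsup].
  assert (eN : forall M, M ∈ upair N N -> M = N).
  { intros M h. apply upair_spec in h. tauto. }
  assert (hcmp : forall a, a ∈ N -> a ∈ omega2 -> a ∈ cmp N N).
  { intros a h1 h2. assert (h : a ∈ inter N omega2) by (apply inter_spec; auto).
    rewrite <- hce in h. apply inter_spec in h. apply h. }
  (* [N < N] would put [inter N omega2] into [N], hence also its union [sup], which would then be a
     member of itself. *)
  assert (hnlt : ~ mlt N N).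
  { unfold mlt. rewrite hce. intro h. apply (model_union N hN) in h.
    apply (mem_irrefl sup). apply hsup; [exact h|exact hsw]. }
  pose proof (isomorphic_refl N) as hiso.
  split; [split; [split|split; [|split]]|].
  - intros M hM. rewrite (eN M hM). exact hN.
  - intros M M' hM hM'. rewrite (eN M hM), (eN M' hM'). right; left. reflexivity.
  - intros M M' hM hM' _. rewrite (eN M hM), (eN M' hM'). split; [exact hiso|].
    intros a ha _. apply (automorphism_id N); auto. apply sigma_iso, hiso.
  - intros M M' hM hM'. rewrite (eN M hM), (eN M' hM'). tauto.
  - intros M M' K hM hM' _ hK hKN. rewrite (eN M hM), (eN K hKN) in hK.
    destruct (mem_irrefl _ hK).
  - intros M M' b hM hM'. rewrite (eN M hM), (eN M' hM').
    intros [(_ & h1 & h2 & h3 & _) | (g & og & hg & hgc & h1 & h2 & h3 & _)]; exfalso.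
    + apply (mem_irrefl b). apply h3. auto.
    + apply hgc. apply hcmp; [exact hg|].
      apply (ord_sub_mem g b); auto using ord_omega2. exact (ord_elem _ _ ord_omega2 h2).
Qed.

End Singleton.

End HModel.

End Models.

(** * Density below a condition *)

Section Forcing.

Context {U : universe}.
Variables (P : U) (le : U -> U -> Prop).
Hypothesis hpo : forcing_poset P le.
Implicit Types p q r s a b c x y z : U.
Implicit Types (A B : fml (U := U)) (F : U -> fml (U := U)).

Notation "p ⊩ A" := (forces P le p A) (at level 70).
Notation feq := (forces_eq P le).

Lemma le_refl p : p ∈ P -> le p p.
Proof. apply hpo. Qed.

Lemma le_trans p q r : p ∈ P -> q ∈ P -> r ∈ P -> le p q -> le q r -> le p r.
Proof. apply hpo. Qed.

Local Hint Resolve le_refl : core.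

(** Forced disjunctions, existentials and memberships are decided only densely. [densely p] behaves
    as a modality, with [densely_now] as unit and [densely_bind] as bind, and keeps passages to
    stronger conditions out of the arguments. *)
Definition densely p (Q : U -> Prop) : Prop :=
  forall q, q ∈ P -> le q p -> exists r, r ∈ P /\ le r q /\ Q r.

Lemma densely_step p (Q R : U -> Prop) : p ∈ P -> densely p Q ->
  (forall r, r ∈ P -> le r p -> Q r -> exists s, s ∈ P /\ le s r /\ R s) -> densely p R.
Proof.
  intros hp h1 h2 q hq hqp. destruct (h1 q hq hqp) as (r & hr & hrq & hQ).
  destruct (h2 r hr (le_trans _ _ _ hr hq hp hrq hqp) hQ) as (s & hs & hsr & hR).
  exists s. split; [exact hs|]. split; [|exact hR]. exact (le_trans _ _ _ hs hr hq hsr hrq).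
Qed.

Lemma densely_bind p (Q R : U -> Prop) : p ∈ P -> densely p Q ->
  (forall r, r ∈ P -> le r p -> Q r -> densely r R) -> densely p R.
Proof.
  intros hp h1 h2. apply densely_step with (2 := h1); [exact hp|].
  intros r hr hrp hQ. exact (h2 r hr hrp hQ r hr (le_refl r hr)).
Qed.

Lemma densely_impl p (Q R : U -> Prop) : p ∈ P -> densely p Q ->
  (forall r, r ∈ P -> le r p -> Q r -> R r) -> densely p R.
Proof.
  intros hp h1 h2. apply densely_step with (2 := h1); [exact hp|].
  intros r hr hrp hQ. exists r. auto.
Qed.

Lemma densely_mono p q (Q : U -> Prop) : p ∈ P -> q ∈ P -> le q p ->
  densely p Q -> densely q Q.
Proof.
  intros hp hq hqp h r hr hrq. apply h; [exact hr|]. exact (le_trans _ _ _ hr hq hp hrq hqp).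
Qed.

Lemma densely_now p (Q : U -> Prop) : p ∈ P ->
  (forall q, q ∈ P -> le q p -> Q q) -> densely p Q.
Proof. intros hp h q hq hqp. exists q. auto. Qed.

Lemma densely_ex p (Q : U -> Prop) : p ∈ P -> densely p Q -> exists r, r ∈ P /\ le r p /\ Q r.
Proof. intros hp h. apply h; auto. Qed.

(** * Equality of names *)

(** The component [c] lies three membership steps below [a], whence the induction along the
    transitive closure of membership. *)
Lemma name_ind (Q : U -> Prop) :
  (forall a, (forall c s, opair c s ∈ a -> Q c) -> Q a) -> forall a, Q a.
Proof.
  intro h.
  apply (well_founded_ind (wf_clos_trans _ _ (foundation U))).
  intros a IH. apply h. intros c s hcs. apply IH.
  apply Relation_Operators.t_trans with (opair c s); [|apply Relation_Operators.t_step, hcs].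
  apply Relation_Operators.t_trans with (upair c s); apply Relation_Operators.t_step; apply upair_spec; auto.
Qed.

Lemma feq_iff p a b : feq p a b <->
  (forall c s, opair c s ∈ a -> forall q, q ∈ P -> le q p -> le q s ->
     exists r d t, r ∈ P /\ le r q /\ opair d t ∈ b /\ le r t /\ feq r c d) /\
  (forall d t, opair d t ∈ b -> forall q, q ∈ P -> le q p -> le q t ->
     exists r c s, r ∈ P /\ le r q /\ opair c s ∈ a /\ le r s /\ feq r c d).
Proof. split; [intros []; split; assumption|]. intros []. constructor; assumption. Qed.

Lemma feq_mono p q a b : p ∈ P -> q ∈ P -> le q p -> feq p a b -> feq q a b.
Proof.
  rewrite !feq_iff. intros hp hq hqp [h1 h2]. split.
  - intros c s hc r hr hrq. apply (h1 c s hc r hr). exact (le_trans _ _ _ hr hq hp hrq hqp).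
  - intros c s hc r hr hrq. apply (h2 c s hc r hr). exact (le_trans _ _ _ hr hq hp hrq hqp).
Qed.

Lemma feq_refl a p : feq p a a.
Proof.
  revert p. induction a as [a IH] using name_ind. intro p.
  constructor; intros c s hc q hq _ hqs; exists q, c, s; eauto 10.
Qed.

Lemma feq_sym a b p : feq p a b -> feq p b a.
Proof.
  revert b p. induction a as [a IH] using name_ind. intros b p h.
  apply feq_iff in h. destruct h as [h1 h2]. constructor.
  - intros d t hd q hq hqp hqt. destruct (h2 d t hd q hq hqp hqt)
      as (r & c & s & hr & hrq & hc & hrs & e). exists r, c, s. eauto 10.
  - intros c s hc q hq hqp hqs. destruct (h1 c s hc q hq hqp hqs)
      as (r & d & t & hr & hrq & hd & hrt & e). exists r, d, t. eauto 10.
Qed.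

Lemma feq_trans a b c p : p ∈ P -> feq p a b -> feq p b c -> feq p a c.
Proof.
  revert b c p. induction a as [a IH] using name_ind.
  intros b c p hp hab hbc. apply feq_iff in hab, hbc.
  destruct hab as [h1 h2], hbc as [h3 h4]. constructor.
  - intros x s hx q hq hqp hqs.
    destruct (h1 x s hx q hq hqp hqs) as (r & y & t & hr & hrq & hy & hrt & e).
    assert (hrp : le r p) by exact (le_trans _ _ _ hr hq hp hrq hqp).
    destruct (h3 y t hy r hr hrp hrt) as (r' & z & u & hr' & hrr & hz & hru & e').
    exists r', z, u. split; [exact hr'|].
    split; [exact (le_trans _ _ _ hr' hr hq hrr hrq)|]. split; [exact hz|].
    split; [exact hru|]. apply (IH x s hx y); auto. apply (feq_mono r); auto.
  - intros z u hz q hq hqp hqu.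
    destruct (h4 z u hz q hq hqp hqu) as (r & y & t & hr & hrq & hy & hrt & e).
    assert (hrp : le r p) by exact (le_trans _ _ _ hr hq hp hrq hqp).
    destruct (h2 y t hy r hr hrp hrt) as (r' & x & s & hr' & hrr & hx & hrs & e').
    exists r', x, s. split; [exact hr'|].
    split; [exact (le_trans _ _ _ hr' hr hq hrr hrq)|]. split; [exact hx|].
    split; [exact hrs|]. apply (IH x s hx y); auto. apply (feq_mono r); auto.
Qed.

Notation name := (is_name P).

Lemma name_cond a c s : name a -> opair c s ∈ a -> name c /\ s ∈ P.
Proof.
  intros [a' h] hc. destruct (h _ hc) as (c' & s' & e & h1 & h2).
  apply opair_inj in e. destruct e as [-> ->]. auto.
Qed.

(** Being names puts the conditions that occur in [a] and [b] into [P], where [le] is transitive. *)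
Lemma feq_densely p a b : name a -> name b ->
  p ∈ P -> densely p (fun r => feq r a b) -> feq p a b.
Proof.
  intros ha hb hp h. constructor; intros c s hc q hq hqp hqs;
  destruct (h q hq hqp) as (r & hr & hrq & e); apply feq_iff in e; destruct e as [h1 h2].
  - destruct (h1 c s hc r hr (le_refl r hr)) as (r' & d & t & hr' & hrr & H).
    { exact (le_trans _ _ _ hr hq (proj2 (name_cond _ _ _ ha hc)) hrq hqs). }
    exists r', d, t. split; [exact hr'|]. split; [|exact H].
    exact (le_trans _ _ _ hr' hr hq hrr hrq).
  - destruct (h2 c s hc r hr (le_refl r hr)) as (r' & d & t & hr' & hrr & H).
    { exact (le_trans _ _ _ hr hq (proj2 (name_cond _ _ _ hb hc)) hrq hqs). }
    exists r', d, t. split; [exact hr'|]. split; [|exact H].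
    exact (le_trans _ _ _ hr' hr hq hrr hrq).
Qed.

(** * The forcing relation *)

Lemma forces_mem p a b : p ⊩ FMem a b <->
  densely p (fun r => exists c s, opair c s ∈ b /\ le r s /\ feq r a c).
Proof.
  simpl. unfold densely. split; intros h q hq hqp.
  - destruct (h q hq hqp) as (r & c & s & hr & hrq & H). exists r. eauto 6.
  - destruct (h q hq hqp) as (r & hr & hrq & c & s & H). exists r, c, s. auto.
Qed.

Lemma forces_mono A p q : p ∈ P -> q ∈ P -> le q p -> p ⊩ A -> q ⊩ A.
Proof.
  intros hp hq hqp. induction A as [a b | a b | A IHA B IHB | A IH | F IH]; simpl.
  - intros h r hr hrq. apply h; [exact hr|]. exact (le_trans _ _ _ hr hq hp hrq hqp).
  - apply feq_mono; auto.
  - intros [h1 h2]. auto.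
  - intros h r hr hrq. apply h; [exact hr|]. exact (le_trans _ _ _ hr hq hp hrq hqp).
  - intros h a ha. apply IH, h, ha.
Qed.

Lemma forces_and_intro p A B : p ⊩ A -> p ⊩ B -> p ⊩ FAnd A B.
Proof. split; assumption. Qed.

Lemma forces_mem_densely p a b : p ∈ P -> densely p (fun r => r ⊩ FMem a b) -> p ⊩ FMem a b.
Proof.
  intros hp h. apply forces_mem. apply densely_bind with (2 := h); [exact hp|].
  intros r hr _ h'. apply forces_mem, h'.
Qed.

Lemma forces_or p A B : p ∈ P ->
  (p ⊩ FOr A B <-> densely p (fun r => r ⊩ A \/ r ⊩ B)).
Proof.
  intro hp. split.
  - intros h q hq hqp. apply NNPP. intro no. apply (h q hq hqp). split.
    + intros r hr hrq h'. apply no. exists r. auto.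
    + intros r hr hrq h'. apply no. exists r. auto.
  - intros h q hq hqp [h1 h2]. destruct (h q hq hqp) as (r & hr & hrq & [h' | h']).
    + exact (h1 r hr hrq h').
    + exact (h2 r hr hrq h').
Qed.

Lemma forces_ex p F : p ∈ P ->
  (p ⊩ FEx F <-> densely p (fun r => exists a, name a /\ r ⊩ F a)).
Proof.
  intro hp. split.
  - intros h q hq hqp. apply NNPP. intro no. apply (h q hq hqp).
    intros a ha r hr hrq h'. apply no. exists r. eauto.
  - intros h q hq hqp h'. destruct (h q hq hqp) as (r & hr & hrq & a & ha & h'').
    exact (h' a ha r hr hrq h'').
Qed.

Lemma forces_imp_intro p A B :
  (forall q, q ∈ P -> le q p -> q ⊩ A -> densely q (fun r => r ⊩ B)) -> p ⊩ FImp A B.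
Proof.
  intros h q hq hqp [h1 h2].
  destruct (densely_ex q _ hq (h q hq hqp h1)) as (r & hr & hrq & hB).
  exact (h2 r hr hrq hB).
Qed.

Lemma densely_forces p A : p ∈ P -> p ⊩ A -> densely p (fun r => r ⊩ A).
Proof.
  intros hp h. apply densely_now; [exact hp|]. intros q hq hqp.
  exact (forces_mono A p q hp hq hqp h).
Qed.

Lemma forces_imp_elim p A B : p ∈ P -> p ⊩ FImp A B -> p ⊩ A -> densely p (fun r => r ⊩ B).
Proof.
  intros hp h hA q hq hqp. apply NNPP. intro no. apply (h q hq hqp). split.
  - exact (forces_mono A p q hp hq hqp hA).
  - intros r hr hrq hB. apply no. eauto.
Qed.

Lemma forces_iff_intro p A B : p ∈ P ->
  (forall q, q ∈ P -> le q p -> (q ⊩ A <-> q ⊩ B)) -> p ⊩ FIff A B.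
Proof.
  intros hp h. split; apply forces_imp_intro; intros q hq hqp hA;
  (apply densely_forces; [exact hq|]); apply h; auto.
Qed.

(** The shape shared by [FUpair] and [FSucc]. *)
Lemma forces_mem_iff_or p q b F G w : p ∈ P -> q ∈ P -> le q p -> name w ->
  p ⊩ FAll (fun w => FIff (FMem w b) (FOr (F w) (G w))) ->
  (q ⊩ FMem w b <-> densely q (fun r => r ⊩ F w \/ r ⊩ G w)).
Proof.
  intros hp hq hqp hw h. apply (forces_mono _ p q hp hq hqp) in h.
  destruct (h w hw) as [h1 h2]. split; intro h'.
  - apply densely_bind with (2 := forces_imp_elim q (FMem w b) (FOr (F w) (G w)) hq h1 h');
      [exact hq|].
    intros r hr _ h3. apply forces_or, h3. exact hr.
  - apply forces_mem_densely; [exact hq|]. apply (forces_imp_elim q (FOr (F w) (G w))); auto.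
    apply forces_or; auto.
Qed.

Lemma forces_ex_intro p F a : p ∈ P -> name a -> p ⊩ F a -> p ⊩ FEx F.
Proof.
  intros hp ha h. apply forces_ex; [exact hp|]. apply densely_now; [exact hp|].
  intros q hq hqp. exists a. split; [exact ha|]. exact (forces_mono _ p q hp hq hqp h).
Qed.

Lemma forces_exin_intro p a F x : p ∈ P -> name x -> p ⊩ FMem x a -> p ⊩ F x ->
  p ⊩ FExIn a F.
Proof. intros hp hx h1 h2. apply forces_ex_intro with x; auto. split; auto. Qed.

Lemma forces_exin p a F : p ∈ P -> p ⊩ FExIn a F ->
  densely p (fun r => exists x, name x /\ r ⊩ FMem x a /\ r ⊩ F x).
Proof.
  intros hp h. apply forces_ex in h; [|exact hp]. exact h.
Qed.

Lemma forces_allin_intro p a F :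
  (forall x q, name x -> q ∈ P -> le q p -> q ⊩ FMem x a -> densely q (fun r => r ⊩ F x)) ->
  p ⊩ FAllIn a F.
Proof. intros h x hx. apply forces_imp_intro; auto. Qed.

Lemma forces_allin_elim p a F x : p ∈ P -> name x -> p ⊩ FAllIn a F -> p ⊩ FMem x a ->
  densely p (fun r => r ⊩ F x).
Proof. intros hp hx h hm. exact (forces_imp_elim p (FMem x a) (F x) hp (h x hx) hm). Qed.

Lemma forces_mem_child c s b p : name b -> opair c s ∈ b -> p ∈ P -> le p s -> p ⊩ FMem c b.
Proof.
  intros hb hc hp hps. apply forces_mem. apply densely_now; [exact hp|].
  intros q hq hqp. exists c, s. split; [exact hc|]. split; [|apply feq_refl].
  exact (le_trans _ _ _ hq hp (proj2 (name_cond _ _ _ hb hc)) hqp hps).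
Qed.

Lemma forces_ext p a b : name a -> name b -> p ∈ P ->
  (forall w q, name w -> q ∈ P -> le q p -> (q ⊩ FMem w a <-> q ⊩ FMem w b)) -> feq p a b.
Proof.
  intros ha hb hp h. constructor.
  - intros c s hc q hq hqp hqs. destruct (name_cond _ _ _ ha hc) as [hcn _].
    pose proof (forces_mem_child c s a q ha hc hq hqs) as hm.
    apply (h c q hcn hq hqp) in hm. apply forces_mem in hm.
    destruct (densely_ex _ _ hq hm) as (r & hr & hrq & d & t & H). exists r, d, t. tauto.
  - intros d t hd q hq hqp hqt. destruct (name_cond _ _ _ hb hd) as [hdn _].
    pose proof (forces_mem_child d t b q hb hd hq hqt) as hm.
    apply (h d q hdn hq hqp) in hm. apply forces_mem in hm.
    destruct (densely_ex _ _ hq hm) as (r & hr & hrq & c & s & h1 & h2 & h3).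
    exists r, c, s. auto 10 using feq_sym.
Qed.

(** * Substitution of equal names *)

(** Not automatic: binders are functions on names, and an arbitrary [F] may depend on the name
    itself rather than on the set it denotes. Hence the property is proved connective by
    connective. *)
Definition congruent F : Prop :=
  forall p x y, p ∈ P -> feq p x y -> p ⊩ F x -> p ⊩ F y.

Lemma congruent_const A : congruent (fun _ => A).
Proof. intros p x y _ _ h. exact h. Qed.

Lemma congruent_mem_l b : congruent (fun x => FMem x b).
Proof.
  intros p x y hp e h. apply forces_mem in h. apply forces_mem.
  apply densely_impl with (2 := h); [exact hp|].
  intros r hr hrp (c & s & hc & hrs & e'). exists c, s. split; [exact hc|].
  split; [exact hrs|]. apply (feq_trans y x c); auto. apply feq_sym, (feq_mono p); auto.
Qed.

Lemma congruent_mem_r b : congruent (fun x => FMem b x).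
Proof.
  intros p x y hp e h. apply forces_mem in h. apply forces_mem.
  apply feq_iff in e. destruct e as [h1 _].
  apply densely_step with (2 := h); [exact hp|].
  intros r hr hrp (c & s & hc & hrs & e').
  destruct (h1 c s hc r hr hrp hrs) as (r1 & d & t & hr1 & hr1r & hd & hrt & e1).
  exists r1. split; [exact hr1|]. split; [exact hr1r|]. exists d, t.
  split; [exact hd|]. split; [exact hrt|]. apply (feq_trans b c d); auto.
  apply (feq_mono r); auto.
Qed.

Lemma congruent_eq_l b : congruent (fun x => FEq x b).
Proof. intros p x y hp e h. apply (feq_trans y x b); auto. apply feq_sym, e. Qed.

Lemma congruent_eq_r b : congruent (fun x => FEq b x).
Proof. intros p x y hp e h. apply (feq_trans b x y); auto. Qed.

Lemma congruent_and F G : congruent F -> congruent G -> congruent (fun x => FAnd (F x) (G x)).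
Proof. intros hF hG p x y hp e [h1 h2]. split; [apply (hF p x)|apply (hG p x)]; auto. Qed.

Lemma congruent_not F : congruent F -> congruent (fun x => FNot (F x)).
Proof.
  intros hF p x y hp e h q hq hqp h'. apply (h q hq hqp). apply (hF q y); auto.
  apply feq_sym, (feq_mono p); auto.
Qed.

Lemma congruent_all (F : U -> U -> fml) : (forall a, congruent (fun x => F x a)) ->
  congruent (fun x => FAll (F x)).
Proof. intros hF p x y hp e h a ha. apply (hF a p x y); auto. Qed.

Ltac congruent := repeat (intros; first
  [ apply congruent_const | apply congruent_mem_l | apply congruent_mem_r
  | apply congruent_eq_l | apply congruent_eq_r | apply congruent_and
  | apply congruent_not | apply congruent_all ]).

Lemma congruent_opair_1 x y : congruent (fun z => FOpair z x y).
Proof. unfold FOpair, FUpair, FIff, FImp, FOr, FEx. congruent. Qed.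

Lemma congruent_pair_in_1 f y : congruent (fun x => FPairIn f x y).
Proof. unfold FPairIn, FExIn, FOpair, FUpair, FIff, FImp, FOr, FEx. congruent. Qed.

Lemma congruent_pair_in_2 f x : congruent (fun y => FPairIn f x y).
Proof. unfold FPairIn, FExIn, FOpair, FUpair, FIff, FImp, FOr, FEx. congruent. Qed.

Lemma congruent_exunique (F : U -> U -> fml) : (forall y, congruent (fun x => F x y)) ->
  congruent (fun x => FExUnique (F x)).
Proof.
  intro h. unfold FExUnique, FImp, FEx.
  repeat (intros; first [ apply h | apply congruent_const | apply congruent_and
    | apply congruent_not | apply congruent_all ]).
Qed.

Lemma congruent_transitive : congruent FTransitive.
Proof. unfold FTransitive, FSub, FAllIn, FImp. congruent. Qed.

Lemma congruent_countable : congruent FCountable.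
Proof.
  unfold FCountable, FOmega, FLec, FEquinum, FBij, FSub, FOrdinal, FTransitive, FEmpty, FSucc,
    FAllIn, FExIn, FExUnique, FPairIn, FOpair, FUpair, FIff, FImp, FOr, FEx. congruent.
Qed.

(** * Canonical names *)

Lemma check_spec x z :
  z ∈ check P x <-> exists y p, y ∈ x /\ p ∈ P /\ z = opair (check P y) p.
Proof.
  unfold check at 1. rewrite mem_fix_eq. fold (check P).
  rewrite setof_spec.
  - split.
    + intros (y & h & p & hp & ->). eauto 6.
    + intros (y & p & h & hp & ->). exists y, h, p. auto.
  - apply is_set_sub with (big_union x (fun y => img P (opair (check P y)))).
    intros u (y & h & p & hp & ->). apply big_union_spec. exists y.
    split; [exact h|]. apply img_spec. eauto.
Qed.

Lemma check_name x : name (check P x).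
Proof.
  induction x as [x IH] using mem_ind. constructor. intros z hz.
  apply check_spec in hz. destruct hz as (y & p & hy & hp & ->). exists (check P y), p. auto.
Qed.

Local Hint Resolve check_name : core.

Lemma forces_mem_check p x a : p ∈ P ->
  (p ⊩ FMem x (check P a) <-> densely p (fun r => exists y, y ∈ a /\ feq r x (check P y))).
Proof.
  intro hp. rewrite forces_mem. split; intro h; (apply densely_impl with (2 := h); [exact hp|]).
  - intros r hr _ (c & s & hc & hrs & e). apply check_spec in hc.
    destruct hc as (y & q & hy & hq & e'). apply opair_inj in e'. destruct e' as [-> ->]. eauto.
  - intros r hr _ (y & hy & e). exists (check P y), r. split; [|auto].
    apply check_spec. eauto.
Qed.

Lemma forces_check_mem p x a : p ∈ P -> x ∈ a -> p ⊩ FMem (check P x) (check P a).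
Proof.
  intros hp hx. apply forces_mem_check; [exact hp|]. apply densely_now; [exact hp|].
  intros q hq _. exists x. split; [exact hx|apply feq_refl].
Qed.

Lemma feq_check_inv x y p : p ∈ P -> feq p (check P x) (check P y) -> x = y.
Proof.
  revert y p. induction x as [x IH] using mem_ind. intros y p hp e.
  apply feq_iff in e. destruct e as [h1 h2].
  apply set_ext. intro z. split; intro hz.
  - destruct (h1 (check P z) p) with (q := p) as (r & d & t & hr & _ & hd & _ & e); auto.
    { apply check_spec. eauto. }
    apply check_spec in hd. destruct hd as (w & q & hw & _ & e').
    apply opair_inj in e'. destruct e' as [-> _]. rewrite (IH z hz w r hr e). exact hw.
  - destruct (h2 (check P z) p) with (q := p) as (r & d & t & hr & _ & hd & _ & e); auto.
    { apply check_spec. eauto. }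
    apply check_spec in hd. destruct hd as (w & q & hw & _ & e').
    apply opair_inj in e'. destruct e' as [-> _]. rewrite <- (IH w hw z r hr e). exact hw.
Qed.

Lemma forces_allin_check p a F : p ∈ P -> congruent F ->
  (forall x, x ∈ a -> p ⊩ F (check P x)) -> p ⊩ FAllIn (check P a) F.
Proof.
  intros hp hF h. apply forces_allin_intro. intros x q hx hq hqp hm.
  apply forces_mem_check in hm; [|exact hq].
  apply densely_impl with (2 := hm); [exact hq|].
  intros r hr hrq (y & hy & e). apply (hF r (check P y)); [exact hr|apply feq_sym, e|].
  apply (forces_mono _ p); auto. exact (le_trans _ _ _ hr hq hp hrq hqp).
Qed.

Lemma forces_exin_check p a F x : p ∈ P -> x ∈ a -> p ⊩ F (check P x) ->
  p ⊩ FExIn (check P a) F.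
Proof.
  intros hp hx h. apply forces_exin_intro with (check P x); auto.
  apply forces_check_mem; auto.
Qed.

Lemma forces_transitive p a : p ∈ P -> transitive a -> p ⊩ FTransitive (check P a).
Proof.
  intros hp ha. apply forces_allin_check; [exact hp| |].
  { unfold FSub, FAllIn, FImp. congruent. }
  intros x hx. apply forces_allin_check; [exact hp|apply congruent_mem_l|].
  intros y hy. apply forces_check_mem; [exact hp|]. exact (ha x hx y hy).
Qed.

Lemma forces_ordinal p a : p ∈ P -> ordinal a -> p ⊩ FOrdinal (check P a).
Proof.
  intros hp ha.
  apply forces_and_intro; [apply forces_transitive; [exact hp|exact (proj1 ha)]|].
  apply forces_allin_check; [exact hp|apply congruent_transitive|].
  intros x hx. apply forces_transitive; [exact hp|]. exact (proj2 ha x hx).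
Qed.

Lemma forces_empty p : p ∈ P -> p ⊩ FEmpty (check P empty).
Proof.
  intros hp x hx q hq _ h. apply forces_mem_check in h; [|exact hq].
  destruct (densely_ex _ _ hq h) as (r & _ & _ & y & hy & _). exact (empty_ax U _ hy).
Qed.

Lemma forces_succ p n : p ∈ P -> p ⊩ FSucc (check P (succ n)) (check P n).
Proof.
  intros hp w hw. apply forces_iff_intro; [exact hp|]. intros q hq hqp.
  rewrite forces_mem_check, forces_or by exact hq.
  split; intro h.
  - apply densely_impl with (2 := h); [exact hq|]. intros r hr _ (y & hy & e).
    apply succ_spec in hy. destruct hy as [hy | ->]; [left|right; exact e].
    apply (congruent_mem_l _ r (check P y)); [exact hr|apply feq_sym, e|].
    apply forces_check_mem; auto.
  - apply densely_bind with (2 := h); [exact hq|]. intros r hr _ [h' | h'].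
    + apply forces_mem_check in h'; [|exact hr].
      apply densely_impl with (2 := h'); [exact hr|]. intros r' _ _ (y & hy & e).
      exists y. rewrite succ_spec. auto.
    + apply densely_now; [exact hr|]. intros r' hr' hrr. exists n.
      rewrite succ_spec. split; [auto|]. apply (feq_mono r); auto.
Qed.

Lemma forces_omega p : p ∈ P -> p ⊩ FOmega (check P omega).
Proof.
  intro hp. repeat apply forces_and_intro.
  1, 2: apply (forces_ordinal p omega hp ord_omega).
  - apply forces_exin_check with empty; [exact hp| |apply forces_empty, hp].
    apply omega_spec. exists 0. reflexivity.
  - apply forces_allin_check; [exact hp| |].
    { unfold FSucc, FExIn, FEx, FIff, FImp, FOr. congruent. }
    intros x hx. apply forces_exin_check with (succ x); [exact hp| |apply forces_succ, hp].
    apply omega_spec in hx. destruct hx as [n ->]. apply omega_spec. exists (S n). reflexivity.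
  - apply forces_allin_check; [exact hp| |].
    { unfold FSucc, FEmpty, FEx, FIff, FImp, FOr. congruent. }
    intros x hx. apply forces_or; [exact hp|]. apply densely_now; [exact hp|].
    intros q hq _. apply omega_spec in hx. destruct hx as [[|n] ->].
    + left. apply forces_empty, hq.
    + right. apply forces_ex_intro with (check P (numeral n)); auto.
      apply forces_succ, hq.
Qed.

(* Induction on the name: if [x] is a successor, its predecessor belongs to [x] and
   is therefore densely equal to a name that occurs in [x]. *)
Lemma forces_omega_elem o x p : name o -> name x -> p ∈ P -> p ⊩ FOmega o -> p ⊩ FMem x o ->
  densely p (fun r => exists n, feq r x (check P (numeral n))).
Proof.
  intros ho hx hp hO. revert p hp hO. induction x as [x IH] using name_ind.
  intros p hp hO hm.
  pose proof hO as ([htr _] & _ & _ & hor).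
  apply densely_bind with (2 := forces_allin_elim p o _ x hp hx hor hm); [exact hp|].
  intros r hr hrp h. apply forces_or in h; [|exact hr].
  apply densely_bind with (2 := h); [exact hr|]. clear h.
  intros q hq hqr [h | h].
  - apply densely_now; [exact hq|]. intros q' hq' hqq. exists 0.
    apply forces_ext; auto. intros w s hw hs hsq. split; intro hws; exfalso.
    + apply (h w hw s hs); [|exact hws]. exact (le_trans _ _ _ hs hq' hq hsq hqq).
    + exact (forces_empty s hs w hw s hs (le_refl s hs) hws).
  - apply forces_ex in h; [|exact hq].
    apply densely_bind with (2 := h); [exact hq|]. clear h.
    intros q1 hq1 hq1q (m & hm' & hsucc).
    assert (hq1p : le q1 p).
    { apply (le_trans q1 r p); auto. apply (le_trans q1 q r); auto. }
    assert (hmx : densely q1 (fun r => r ⊩ FMem m x)).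
    { apply (forces_imp_elim q1 (FOr (FMem m m) (FEq m m))).
      - exact hq1.
      - exact (proj2 (hsucc m hm')).
      - apply forces_or; [exact hq1|]. apply densely_now; [exact hq1|].
        intros; right. apply feq_refl. }
    apply densely_bind with (2 := hmx); [exact hq1|].
    intros q2 hq2 hq21 hmx2. pose proof (proj1 (forces_mem q2 m x) hmx2) as hmx3.
    apply densely_bind with (2 := hmx3); [exact hq2|].
    intros q3 hq3 hq32 (c & s & hc & hq3s & e).
    destruct (name_cond _ _ _ hx hc) as [hcn hsP].
    assert (hq31 : le q3 q1) by (apply (le_trans q3 q2); auto).
    assert (hq3p : le q3 p) by (apply (le_trans q3 q1); auto).
    assert (hco : densely q3 (fun r => r ⊩ FMem c o)).
    { pose proof (forces_mono _ p q3 hp hq3 hq3p htr) as htr3.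
      pose proof (forces_mono _ p q3 hp hq3 hq3p hm) as hm3.
      apply densely_bind with (2 := forces_allin_elim q3 o _ x hq3 hx htr3 hm3); [exact hq3|].
      intros q4 hq4 hq43 hsub.
      apply (forces_allin_elim q4 x (fun y => FMem y o) c hq4 hcn hsub).
      apply (forces_mem_child c s); auto. apply (le_trans q4 q3); auto. }
    apply densely_bind with (2 := hco); [exact hq3|]. intros q4 hq4 hq43 hco4.
    assert (hq4p : le q4 p) by (apply (le_trans q4 q3); auto).
    apply densely_impl with (2 := IH c s hc hcn q4 hq4 (forces_mono _ p q4 hp hq4 hq4p hO) hco4);
      [exact hq4|].
    intros q5 hq5 hq54 [n en]. exists (S n).
    assert (hq53 : le q5 q3) by (apply (le_trans q5 q4); auto).
    assert (hq51 : le q5 q1) by (apply (le_trans q5 q3); auto).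
    assert (em : feq q5 m (check P (numeral n))).
    { apply (feq_trans m c); auto. apply (feq_mono q3); auto. }
    assert (hS : q5 ⊩ FSucc x (check P (numeral n))).
    { assert (hcong : congruent (fun y => FSucc x y)).
      { unfold FSucc, FIff, FImp, FOr. congruent. }
      apply (hcong q5 m); auto. apply (forces_mono _ q1); auto. }
    (* [x] and the next numeral are now both forced to be successors of the same set, so they are
       equal by extensionality. *)
    pose proof (forces_succ q5 (numeral n) hq5) as hS'.
    apply forces_ext; auto. intros w t hw ht ht5.
    rewrite (forces_mem_iff_or q5 t x _ _ w hq5 ht ht5 hw hS).
    rewrite (forces_mem_iff_or q5 t _ _ _ w hq5 ht ht5 hw hS'). reflexivity.
Qed.

(** * Ordered pairs of names *)

(** As in check names, each component is paired with every condition because no greatest one is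
    assumed. *)
Definition upair_name a b : U :=
  setof (fun z => exists p, p ∈ P /\ (z = opair a p \/ z = opair b p)).
Definition opair_name a b : U := upair_name (upair_name a a) (upair_name a b).

Lemma upair_name_spec a b z :
  z ∈ upair_name a b <-> exists p, p ∈ P /\ (z = opair a p \/ z = opair b p).
Proof.
  apply (setof_spec (fun z => exists p, p ∈ P /\ (z = opair a p \/ z = opair b p))).
  destruct (is_set_union (img P (opair a)) (img P (opair b))) as [s hs].
  apply is_set_sub with s. intros u (p & hp & [-> | ->]); apply hs; [left|right];
  apply img_spec; eauto.
Qed.

Lemma upair_name_name a b : name a -> name b -> name (upair_name a b).
Proof.
  intros ha hb. constructor. intros z hz. apply upair_name_spec in hz.
  destruct hz as (p & hp & [-> | ->]); eauto.
Qed.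

Lemma opair_name_name a b : name a -> name b -> name (opair_name a b).
Proof. intros ha hb. unfold opair_name. auto using upair_name_name. Qed.

Local Hint Resolve upair_name_name opair_name_name : core.

Lemma forces_upair_name p a b : p ∈ P -> p ⊩ FUpair (upair_name a b) a b.
Proof.
  intros hp w hw. apply forces_iff_intro; [exact hp|]. intros q hq _.
  rewrite forces_mem, forces_or by exact hq.
  split; intro h; (apply densely_impl with (2 := h); [exact hq|]); intros r hr _.
  - intros (c & s & hc & hrs & e). apply upair_name_spec in hc.
    destruct hc as (t & ht & [e' | e']); apply opair_inj in e'; destruct e' as [-> ->]; auto.
  - intros [e | e]; [exists a, r | exists b, r]; rewrite upair_name_spec;
    (split; [exists r; auto|split; [auto|exact e]]).
Qed.

Lemma forces_opair_name p a b : p ∈ P -> name a -> name b -> p ⊩ FOpair (opair_name a b) a b.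
Proof.
  intros hp ha hb. apply forces_ex_intro with (upair_name a a); auto.
  apply forces_ex_intro with (upair_name a b); auto.
  repeat apply forces_and_intro; apply forces_upair_name; exact hp.
Qed.

Lemma forces_upair_inj p z z' x y x' y' : p ∈ P -> name x -> name y -> name x' -> name y' ->
  feq p z z' -> p ⊩ FUpair z x y -> p ⊩ FUpair z' x' y' ->
  densely p (fun r => (feq r x x' /\ feq r y y') \/ (feq r x y' /\ feq r y x')).
Proof.
  intros hp hx hy hx' hy' e h h'.
  (* Each member of one pair densely equals a member of the other. This is used four times, once per
     component, at successively stronger conditions. *)
  assert (half : forall z z' x y x' y' q w, q ∈ P -> le q p -> name w ->
    feq p z z' -> p ⊩ FUpair z x y -> p ⊩ FUpair z' x' y' -> feq q w x \/ feq q w y ->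
    densely q (fun r => feq r w x' \/ feq r w y')).
  { clear - hpo hp. intros z z' x y x' y' q w hq hqp hw e h h' hwxy.
    apply (proj1 (forces_mem_iff_or p q z' _ _ w hp hq hqp hw h')).
    apply (congruent_mem_r w q z z'); [exact hq|apply (feq_mono p); auto|].
    apply (proj2 (forces_mem_iff_or p q z _ _ w hp hq hqp hw h)).
    apply densely_now; [exact hq|]. intros r hr hrq.
    destruct hwxy as [hh | hh]; [left|right]; exact (feq_mono q r _ _ hq hr hrq hh). }
  pose proof (feq_sym _ _ _ e) as e'.
  apply densely_bind with (2 := half z z' x y x' y' p x hp (le_refl p hp) hx e h h'
    (or_introl (feq_refl x p))); [exact hp|].
  intros q1 hq1 l1 c1.
  apply densely_bind with (2 := half z z' x y x' y' q1 y hq1 l1 hy e h h'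
    (or_intror (feq_refl y q1))); [exact hq1|].
  intros q2 hq2 l2 c2. assert (l2p : le q2 p) by (apply (le_trans q2 q1); auto).
  apply densely_bind with (2 := half z' z x' y' x y q2 x' hq2 l2p hx' e' h' h
    (or_introl (feq_refl x' q2))); [exact hq2|].
  intros q3 hq3 l3 c3. assert (l3p : le q3 p) by (apply (le_trans q3 q2); auto).
  apply densely_impl with (2 := half z' z x' y' x y q3 y' hq3 l3p hy' e' h' h
    (or_intror (feq_refl y' q3))); [exact hq3|].
  intros q4 hq4 l4 c4.
  assert (l42 : le q4 q2) by (apply (le_trans q4 q3); auto).
  assert (l41 : le q4 q1) by (apply (le_trans q4 q2); auto).
  assert (m1 : feq q4 x x' \/ feq q4 x y').
  { destruct c1; [left|right]; apply (feq_mono q1); auto. }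
  assert (m2 : feq q4 y x' \/ feq q4 y y').
  { destruct c2; [left|right]; apply (feq_mono q2); auto. }
  assert (m3 : feq q4 x' x \/ feq q4 x' y).
  { destruct c3; [left|right]; apply (feq_mono q3); auto. }
  pose proof (fun a b c => feq_trans a b c q4 hq4) as tr.
  pose proof (fun a b => feq_sym a b q4) as sy.
  (* If [x] and [y] equal the same component of the second pair, the remaining component is located
     by [c4] or [m3]. *)
  destruct m1 as [m1 | m1], m2 as [m2 | m2]; auto.
  - left. split; [exact m1|]. destruct c4 as [c4 | c4]; [|auto].
    apply (tr y x' y'); [exact m2|]. apply (tr x' x y'); auto.
  - right. split; [exact m1|]. destruct m3 as [m3 | m3]; [|auto].
    apply (tr y y' x'); [exact m2|]. apply (tr y' x x'); auto.
Qed.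

(** The set-theoretic argument decides the equalities only densely; [feq_densely] brings them back
    to [p] itself. *)
Lemma forces_opair_inj p z x y x' y' : p ∈ P -> name x -> name y -> name x' -> name y' ->
  p ⊩ FOpair z x y -> p ⊩ FOpair z x' y' -> feq p x x' /\ feq p y y'.
Proof.
  intros hp hx hy hx' hy' h h'.
  assert (key : densely p (fun r => feq r x x' /\ feq r y y')).
  { apply forces_ex in h; [|exact hp]. apply densely_bind with (2 := h); [exact hp|].
    clear h. intros q1 hq1 l1 (u & hu & h). apply forces_ex in h; [|exact hq1].
    apply densely_bind with (2 := h); [exact hq1|]. clear h.
    intros q2 hq2 l2 (v & hv & hxu & hxv & huv).
    assert (l2p : le q2 p) by (apply (le_trans q2 q1); auto).
    apply (forces_mono _ p q2 hp hq2 l2p) in h'.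
    apply forces_ex in h'; [|exact hq2]. apply densely_bind with (2 := h'); [exact hq2|].
    clear h'. intros q3 hq3 l3 (u' & hu' & h'). apply forces_ex in h'; [|exact hq3].
    apply densely_bind with (2 := h'); [exact hq3|]. clear h'.
    intros q4 hq4 l4 (v' & hv' & hxu' & hxv' & huv').
    assert (l42 : le q4 q2) by (apply (le_trans q4 q3); auto).
    apply (forces_mono (FUpair u x x) q2 q4 hq2 hq4 l42) in hxu.
    apply (forces_mono (FUpair v x y) q2 q4 hq2 hq4 l42) in hxv.
    apply (forces_mono (FUpair z u v) q2 q4 hq2 hq4 l42) in huv.
    apply densely_bind with
      (2 := forces_upair_inj q4 z z u v u' v' hq4 hu hv hu' hv' (feq_refl z q4) huv huv');
      [exact hq4|].
    intros q5 hq5 l5 c5.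
    apply (forces_mono (FUpair u x x) q4 q5 hq4 hq5 l5) in hxu.
    apply (forces_mono (FUpair v x y) q4 q5 hq4 hq5 l5) in hxv.
    apply (forces_mono (FUpair u' x' x') q4 q5 hq4 hq5 l5) in hxu'.
    apply (forces_mono (FUpair v' x' y') q4 q5 hq4 hq5 l5) in hxv'.
    destruct c5 as [[e1 e2] | [e1 e2]].
    - apply densely_bind with
        (2 := forces_upair_inj q5 u u' x x x' x' hq5 hx hx hx' hx' e1 hxu hxu'); [exact hq5|].
      intros q6 hq6 l6 c6.
      assert (exx : feq q6 x x') by tauto.
      apply densely_impl with
        (2 := densely_mono q5 q6 _ hq5 hq6 l6
          (forces_upair_inj q5 v v' x y x' y' hq5 hx hy hx' hy' e2 hxv hxv')); [exact hq6|].
      intros q7 hq7 l7 c7. pose proof (feq_mono q6 q7 _ _ hq6 hq7 l7 exx) as exx7.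
      split; [exact exx7|]. destruct c7 as [[_ c7] | [c7 c7']]; [exact c7|].
      apply (feq_trans y x' y'); auto. apply (feq_trans x' x y'); auto. apply feq_sym, exx7.
    (* Here {x} equals {x', y'} and {x, y} equals {x'}, so all four names coincide. *)
    - apply densely_bind with
        (2 := forces_upair_inj q5 u v' x x x' y' hq5 hx hx hx' hy' e1 hxu hxv'); [exact hq5|].
      intros q6 hq6 l6 c6.
      assert (exx : feq q6 x x' /\ feq q6 x y') by tauto. destruct exx as [exx exy].
      apply densely_impl with
        (2 := densely_mono q5 q6 _ hq5 hq6 l6
          (forces_upair_inj q5 v u' x y x' x' hq5 hx hy hx' hx' e2 hxv hxu')); [exact hq6|].
      intros q7 hq7 l7 c7. pose proof (feq_mono q6 q7 _ _ hq6 hq7 l7 exx) as exx7.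
      pose proof (feq_mono q6 q7 _ _ hq6 hq7 l7 exy) as exy7.
      split; [exact exx7|]. apply (feq_trans y x' y'); [exact hq7|tauto|].
      apply (feq_trans x' x y'); auto. apply feq_sym, exx7. }
  split; apply feq_densely; auto; (apply densely_impl with (2 := key); [exact hp|]); tauto.
Qed.

(** * Names of bijections *)

Section BijectionName.

(* [T p x y] means that [p] decides that the bijection sends [x] to [y]. *)
Variables (a b : U) (T : U -> U -> U -> Prop).
Hypothesis Tmono : forall p q x y, p ∈ P -> q ∈ P -> le q p -> T p x y -> T q x y.
Hypothesis Tdom : forall p x y, T p x y -> x ∈ a /\ y ∈ b.
Hypothesis Tfun : forall p x y y', p ∈ P -> T p x y -> T p x y' -> y = y'.
Hypothesis Tinj : forall p x x' y, p ∈ P -> T p x y -> T p x' y -> x = x'.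
Hypothesis Ttotal : forall p x, p ∈ P -> x ∈ a -> exists q y, q ∈ P /\ le q p /\ T q x y.
Hypothesis Tonto : forall p y, p ∈ P -> y ∈ b -> exists q x, q ∈ P /\ le q p /\ T q x y.

Definition bij_name : U := setof (fun z => exists p x y,
  p ∈ P /\ T p x y /\ z = opair (opair_name (check P x) (check P y)) p).

Lemma bij_name_spec z : z ∈ bij_name <-> exists p x y,
  p ∈ P /\ T p x y /\ z = opair (opair_name (check P x) (check P y)) p.
Proof.
  apply (setof_spec (fun z => exists p x y,
    p ∈ P /\ T p x y /\ z = opair (opair_name (check P x) (check P y)) p)).
  apply is_set_sub with (big_union P (fun p => big_union a (fun x =>
    img b (fun y => opair (opair_name (check P x) (check P y)) p)))).
  intros u (p & x & y & hp & hT & ->). destruct (Tdom p x y hT) as [hx hy].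
  apply big_union_spec. exists p. split; [exact hp|].
  apply big_union_spec. exists x. split; [exact hx|]. apply img_spec. eauto.
Qed.

Lemma bij_name_name : name bij_name.
Proof.
  constructor. intros z hz. apply bij_name_spec in hz.
  destruct hz as (p & x & y & hp & _ & ->). eauto 10.
Qed.

Lemma forces_mem_bij_name p z : p ∈ P -> p ⊩ FMem z bij_name ->
  densely p (fun r => exists x y, T r x y /\ feq r z (opair_name (check P x) (check P y))).
Proof.
  intros hp h. apply forces_mem in h. apply densely_impl with (2 := h); [exact hp|].
  intros r hr _ (c & s & hc & hrs & e). apply bij_name_spec in hc.
  destruct hc as (q & x & y & hq & hT & e'). apply opair_inj in e'. destruct e' as [-> ->].
  exists x, y. split; [|exact e]. apply (Tmono q); auto.
Qed.

Lemma forces_pair_in_intro p x y : p ∈ P -> T p x y ->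
  p ⊩ FPairIn bij_name (check P x) (check P y).
Proof.
  intros hp hT. apply forces_exin_intro with (opair_name (check P x) (check P y)); auto.
  - apply (forces_mem_child _ p); auto using bij_name_name. apply bij_name_spec. eauto 6.
  - apply forces_opair_name; auto.
Qed.

Lemma forces_pair_in_elim p u v : p ∈ P -> name u -> name v -> p ⊩ FPairIn bij_name u v ->
  densely p (fun r => exists x y, T r x y /\ feq r u (check P x) /\ feq r v (check P y)).
Proof.
  intros hp hu hv h. apply forces_exin in h; [|exact hp].
  apply densely_bind with (2 := h); [exact hp|]. intros q hq _ (z & hz & hm & ho).
  apply densely_impl with (2 := forces_mem_bij_name q z hq hm); [exact hq|].
  intros r hr hrq (x & y & hT & e). exists x, y. split; [exact hT|].
  apply (forces_mono _ q r hq hr hrq) in ho.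
  apply (congruent_opair_1 u v r z _ hr e) in ho.
  apply (forces_opair_inj r _ u v (check P x) (check P y) hr) in ho; auto.
  apply forces_opair_name; auto.
Qed.

Lemma forces_bij_name p : p ∈ P -> p ⊩ FBij bij_name (check P a) (check P b).
Proof.
  intro hp. repeat apply forces_and_intro.
  - apply forces_allin_intro. intros z q hz hq _ hm.
    apply densely_impl with (2 := forces_mem_bij_name q z hq hm); [exact hq|].
    intros r hr _ (x & y & hT & e). destruct (Tdom r x y hT) as [hx hy].
    apply forces_exin_check with x; auto. apply forces_exin_check with y; auto.
    apply (congruent_opair_1 _ _ r (opair_name (check P x) (check P y))); auto.
    + apply feq_sym, e.
    + apply forces_opair_name; auto.
  - apply forces_allin_check; [exact hp| |].
    { apply congruent_exunique. intro y. apply congruent_pair_in_1. }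
    intros x hx. apply forces_ex; [exact hp|]. intros q hq hqp.
    destruct (Ttotal q x hq hx) as (r & y & hr & hrq & hT). exists r.
    split; [exact hr|]. split; [exact hrq|]. exists (check P y). split; [auto|].
    apply forces_and_intro; [apply forces_pair_in_intro; auto|].
    intros v hv. apply forces_imp_intro. intros s hs hsr h.
    apply densely_impl with (2 := forces_pair_in_elim s _ v hs (check_name x) hv h); [exact hs|].
    intros t ht hts (x' & y' & hT' & ex & ey).
    apply feq_check_inv in ex; [subst x'|exact ht].
    rewrite (Tfun t x y y'); auto.
    + apply feq_sym, ey.
    + apply (Tmono r); auto. apply (le_trans t s); auto.
  - apply forces_allin_check; [exact hp| |].
    { apply (congruent_exunique (fun y x => FPairIn bij_name x y)). intro x.
      apply congruent_pair_in_2. }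
    intros y hy. apply forces_ex; [exact hp|]. intros q hq hqp.
    destruct (Tonto q y hq hy) as (r & x & hr & hrq & hT). exists r.
    split; [exact hr|]. split; [exact hrq|]. exists (check P x). split; [auto|].
    apply forces_and_intro; [apply forces_pair_in_intro; auto|].
    intros u hu. apply forces_imp_intro. intros s hs hsr h.
    apply densely_impl with (2 := forces_pair_in_elim s u _ hs hu (check_name y) h); [exact hs|].
    intros t ht hts (x' & y' & hT' & ex & ey).
    apply feq_check_inv in ey; [subst y'|exact ht].
    rewrite (Tinj t x x' y); auto.
    + apply feq_sym, ex.
    + apply (Tmono r); auto. apply (le_trans t s); auto.
Qed.

Lemma forces_equinum p : p ∈ P -> p ⊩ FEquinum (check P a) (check P b).
Proof.
  intro hp. apply forces_ex_intro with bij_name; [exact hp|apply bij_name_name|].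
  apply forces_bij_name, hp.
Qed.

End BijectionName.

Lemma forces_countable p a : p ∈ P -> cnt a -> p ⊩ FCountable (check P a).
Proof.
  intros hp ha. apply inj_omega_cnt in ha. destruct ha as (F & h1 & h2).
  apply forces_ex_intro with (check P omega); auto.
  apply forces_and_intro; [apply forces_omega, hp|].
  apply forces_ex_intro with (check P (img a F)); auto. apply forces_and_intro.
  - apply forces_allin_check; [exact hp|apply congruent_mem_l|].
    intros x hx. apply forces_check_mem; [exact hp|]. apply img_spec in hx.
    destruct hx as (y & hy & ->). auto.
  - apply (forces_equinum a (img a F) (fun _ x y => x ∈ a /\ y = F x)); auto.
    + intros _ x y [hx ->]. split; [exact hx|]. apply img_spec. eauto.
    + intros _ x y y' _ [_ ->] [_ ->]. reflexivity.
    + intros _ x x' y _ [hx ->] [hx' e]. auto.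
    + intros q x hq hx. exists q, (F x). auto.
    + intros q y hq hy. apply img_spec in hy. destruct hy as (x & hx & ->).
      exists q, x. auto.
Qed.

(** * Preservation of [omega1] *)

(* [Q s x n]: the condition [s] decides that an injection into the natural numbers
   sends [x] to [n]. *)
Definition decides_injection r a (Q : U -> U -> nat -> Prop) : Prop :=
  (forall p q x n, p ∈ P -> q ∈ P -> le q p -> Q p x n -> Q q x n) /\
  (forall p x, p ∈ P -> le p r -> x ∈ a -> exists q n, q ∈ P /\ le q p /\ Q q x n) /\
  (forall p x y n, p ∈ P -> le p r -> x ∈ a -> y ∈ a -> Q p x n -> Q p y n -> x = y).

(** The name [f] is a bijection onto a subset [c] of a forced omega. Its values are densely numerals
    by [forces_omega_elem], so membership of a pair in [f] can be read as a relation with values in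
    [nat]. *)
Lemma forces_countable_inv p a : p ∈ P -> p ⊩ FCountable (check P a) ->
  exists r Q, r ∈ P /\ le r p /\ decides_injection r a Q.
Proof.
  intros hp h. apply forces_ex in h; [|exact hp].
  destruct (densely_ex _ _ hp h) as (p1 & hp1 & l1 & o & ho & hO & h1). clear h.
  apply forces_ex in h1; [|exact hp1].
  destruct (densely_ex _ _ hp1 h1) as (p2 & hp2 & l2 & c & hc & hco & h2). clear h1.
  apply forces_ex in h2; [|exact hp2].
  destruct (densely_ex _ _ hp2 h2) as (r & hr & l3 & f & hf & b1 & b2 & b3). clear h2.
  assert (hrp1 : le r p1) by (apply (le_trans r p2); auto).
  apply (forces_mono _ p1 r hp1 hr hrp1) in hO.
  apply (forces_mono (FSub c o) p2 r hp2 hr l3) in hco.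
  exists r, (fun s x n => s ⊩ FPairIn f (check P x) (check P (numeral n))).
  split; [exact hr|]. split; [apply (le_trans r p1); auto|].
  (* The first clause of [FBij] provides components of the pair with the second one in [c];
     injectivity of forced ordered pairs identifies that one with [y]. *)
  assert (hmem : forall q x y, q ∈ P -> le q r -> name x -> name y -> q ⊩ FPairIn f x y ->
    q ⊩ FMem y c).
  { intros q x y hq hqr hx hy h. apply forces_mem_densely; [exact hq|].
    apply forces_exin in h; [|exact hq]. apply densely_bind with (2 := h); [exact hq|].
    intros q1 hq1 k1 (z & hz & hzf & hzo).
    assert (k1r : le q1 r) by (apply (le_trans q1 q); auto).
    apply densely_bind with (2 := forces_allin_elim q1 f _ z hq1 hz
      (forces_mono _ r q1 hr hq1 k1r b1) hzf); [exact hq1|].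
    intros q2 hq2 k2 h2. apply forces_exin in h2; [|exact hq2].
    apply densely_bind with (2 := h2); [exact hq2|].
    intros q3 hq3 k3 (x' & hx' & _ & h3). apply forces_exin in h3; [|exact hq3].
    apply densely_impl with (2 := h3); [exact hq3|].
    intros q4 hq4 k4 (y' & hy' & hyc & h4).
    assert (k41 : le q4 q1).
    { apply (le_trans q4 q3); auto. apply (le_trans q3 q2); auto. }
    apply (forces_mono _ q1 q4 hq1 hq4 k41) in hzo.
    destruct (forces_opair_inj q4 z x' y' x y hq4 hx' hy' hx hy h4 hzo) as [_ e].
    exact (congruent_mem_l c q4 y' y hq4 e hyc). }
  split; [|split].
  - intros q q' x n hq hq' hqq. apply forces_mono; auto.
  - intros q x hq hqr hx.
    assert (hd : densely q (fun s => exists n,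
      s ⊩ FPairIn f (check P x) (check P (numeral n)))).
    { apply densely_bind with (2 := forces_allin_elim q _ _ (check P x) hq (check_name x)
        (forces_mono _ r q hr hq hqr b2) (forces_check_mem q x a hq hx)); [exact hq|].
      intros q1 hq1 k1 h. apply forces_ex in h; [|exact hq1].
      apply densely_bind with (2 := h); [exact hq1|].
      intros q2 hq2 k2 (y & hy & hxy & _).
      assert (k2r : le q2 r).
      { apply (le_trans q2 q1); auto. apply (le_trans q1 q); auto. }
      pose proof (hmem q2 _ y hq2 k2r (check_name x) hy hxy) as hyc.
      apply densely_bind with (2 := forces_allin_elim q2 c _ y hq2 hy
        (forces_mono _ r q2 hr hq2 k2r hco) hyc); [exact hq2|].
      intros q3 hq3 k3 hyo.
      assert (k3r : le q3 r) by (apply (le_trans q3 q2); auto).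
      apply densely_impl with (2 := forces_omega_elem o y q3 ho hy hq3
        (forces_mono _ r q3 hr hq3 k3r hO) hyo); [exact hq3|].
      intros q4 hq4 k4 [n e]. exists n.
      apply (congruent_pair_in_2 f (check P x) q4 y); auto.
      apply (forces_mono _ q2); auto. apply (le_trans q4 q3); auto. }
    destruct (densely_ex _ _ hq hd) as (s & hs & hsq & n & hn). eauto.
  - intros q x y n hq hqr hx hy h1 h2.
    pose proof (hmem q _ _ hq hqr (check_name x) (check_name _) h1) as hn.
    destruct (densely_ex _ _ hq (forces_allin_elim q c _ (check P (numeral n)) hq
      (check_name _) (forces_mono _ r q hr hq hqr b3) hn)) as (q1 & hq1 & k1 & h3).
    apply forces_ex in h3; [|exact hq1].
    destruct (densely_ex _ _ hq1 h3) as (q2 & hq2 & k2 & w & hw & _ & hu).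
    assert (k2q : le q2 q) by (apply (le_trans q2 q1); auto).
    (* [w] is the unique preimage of [n] given by the last clause of [FBij]; both check names are
       compared with it. *)
    assert (key : forall v, name v -> q ⊩ FPairIn f v (check P (numeral n)) -> feq q2 w v).
    { intros v hv h. apply feq_densely; auto.
      apply (forces_imp_elim q2 (FPairIn f v (check P (numeral n))) (FEq w v) hq2 (hu v hv)).
      apply (forces_mono _ q); auto. }
    apply (feq_check_inv x y q2 hq2). apply (feq_trans _ w); auto.
    apply feq_sym. auto.
Qed.

Lemma forces_omega1 p : p ∈ P ->
  (forall r Q, r ∈ P -> ~ decides_injection r omega1 Q) -> p ⊩ FOmega1 (check P omega1).
Proof.
  intros hp h. repeat apply forces_and_intro.
  1, 2: apply (forces_ordinal p omega1 hp ord_omega1).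
  - intros q hq _ hc. destruct (forces_countable_inv q omega1 hq hc) as (r & Q & hr & _ & hQ).
    exact (h r Q hr hQ).
  - apply forces_allin_check; [exact hp|apply congruent_countable|].
    intros x hx. apply forces_countable; [exact hp|]. apply omega1_spec in hx. apply hx.
Qed.

End Forcing.

(** * Decided injections and surjections *)

Section SchroederBernstein.

Context {U : universe}.
Variables (P : U) (le : U -> U -> Prop).
Hypothesis hpo : forcing_poset P le.

(* [J p x y] means that [p] decides that the injection of [b] into [a] sends [y] to [x]. *)
Variables (a b : U) (J : U -> U -> U -> Prop).
Hypothesis hab : a ⊆ b.
Hypothesis Jmono : forall p q x y, p ∈ P -> q ∈ P -> le q p -> J p x y -> J q x y.
Hypothesis Jdom : forall p x y, J p x y -> x ∈ a /\ y ∈ b.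
Hypothesis Jfun : forall p x x' y, p ∈ P -> J p x y -> J p x' y -> x = x'.
Hypothesis Jinj : forall p x y y', p ∈ P -> J p x y -> J p x y' -> y = y'.
Hypothesis Jtotal : forall p y, p ∈ P -> y ∈ b -> exists q x, q ∈ P /\ le q p /\ J q x y.

(** The orbit of [b] minus [a] under the injection, as in the proof of the Schroeder-Bernstein
    theorem for an inclusion of [a] in [b]. *)
Fixpoint in_chain (n : nat) (p y : U) : Prop :=
  match n with
  | O => y ∈ b /\ ~ y ∈ a
  | S n => exists z, in_chain n p z /\ J p y z
  end.

Lemma in_chain_mono n p q y : p ∈ P -> q ∈ P -> le q p -> in_chain n p y -> in_chain n q y.
Proof.
  intros hp hq hqp. revert y. induction n as [|n IH]; intro y; simpl; [auto|].
  intros (z & hz & hJ). exists z. split; [auto|]. apply (Jmono p); auto.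
Qed.

Definition chain p y : Prop := exists n, in_chain n p y.
(** A point may enter a chain at a stronger condition, so staying outside is required at all of
    them; this makes the property persist. *)
Definition no_chain p y : Prop := forall q, q ∈ P -> le q p -> ~ chain q y.

(** Follow the injection on chain points and stay put elsewhere. *)
Definition SB p x y : Prop :=
  (chain p y /\ J p x y) \/ (no_chain p y /\ x = y /\ x ∈ a).

Lemma decide_chain p y : p ∈ P -> exists q, q ∈ P /\ le q p /\ (chain q y \/ no_chain q y).
Proof.
  intro hp. destruct (classic (exists q, q ∈ P /\ le q p /\ chain q y)) as [(q & H) | no].
  - exists q. tauto.
  - exists p. split; [exact hp|]. split; [apply hpo, hp|]. right.
    intros q hq hqp h. eauto.
Qed.

Lemma forces_schroeder_bernstein p : p ∈ P ->
  forces P le p (FEquinum (check P a) (check P b)).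
Proof.
  assert (lt : forall p q r, p ∈ P -> q ∈ P -> r ∈ P -> le p q -> le q r -> le p r)
    by apply hpo.
  assert (lr : forall p, p ∈ P -> le p p) by apply hpo.
  assert (cm : forall p q y, p ∈ P -> q ∈ P -> le q p -> chain p y -> chain q y).
  { intros p' q y hp hq hqp [n h]. exists n. apply (in_chain_mono n p'); auto. }
  apply (forces_equinum P le hpo a b SB).
  - intros p' q x y hp hq hqp [[h1 h2] | [h1 h2]]; [left|right].
    + split; [apply (cm p'); auto|apply (Jmono p'); auto].
    + split; [|exact h2]. intros r hr hrq. apply h1; eauto.
  - intros p' x y [[_ h] | (_ & <- & h)]; [exact (Jdom _ _ _ h)|auto].
  - intros q x y y' hq [[h1 h2] | (h1 & <- & h2)] [[h3 h4] | (h3 & <- & h4)]; auto.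
    + apply (Jinj q x); auto.
    (* The image of a chain point is again a chain point, so it cannot also be a point that stays
       put. *)
    + exfalso. apply (h3 q hq (lr q hq)). destruct h1 as [n h1]. exists (S n), y. auto.
    + exfalso. apply (h1 q hq (lr q hq)). destruct h3 as [n h3]. exists (S n), y'. auto.
  - intros q x x' y hq [[h1 h2] | (h1 & -> & h2)] [[h3 h4] | (h3 & -> & h4)]; auto.
    + apply (Jfun q x x' y); auto.
    + exfalso. exact (h3 q hq (lr q hq) h1).
    + exfalso. exact (h1 q hq (lr q hq) h3).
  - intros q x hq hx. destruct (decide_chain q x hq) as (r & hr & hrq & [[n h] | h]).
    (* Since [x] lies in [a], its chain has positive length, and the preceding point is the one sent
       to [x]. *)
    + destruct n as [|n]; [destruct h as [_ h]; tauto|].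
      destruct h as (z & hz & hJ). exists r, z. split; [exact hr|]. split; [exact hrq|].
      left. split; [exists n; exact hz|exact hJ].
    + exists r, x. split; [exact hr|]. split; [exact hrq|]. right. auto.
  - intros q y hq hy. destruct (decide_chain q y hq) as (r & hr & hrq & [h | h]).
    + destruct (Jtotal r y hr hy) as (s & x & hs & hsr & hJ). exists s, x.
      split; [exact hs|]. split; [eauto|]. left. split; [apply (cm r); auto|exact hJ].
    + exists r, y. split; [exact hr|]. split; [exact hrq|]. right.
      split; [exact h|]. split; [reflexivity|]. apply NNPP. intro hn.
      apply (h r hr (lr r hr)). exists 0. split; auto.
Qed.

End SchroederBernstein.

Section Surjection.

Context {U : universe}.
Variables (P : U) (le : U -> U -> Prop).
Hypothesis hpo : forcing_poset P le.

(* [R p x y] means that [p] decides that the partial surjection of [a] onto [b]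
   sends [x] to [y]. *)
Variables (a b : U) (R : U -> U -> U -> Prop).
Hypothesis ha : ordinal a.
Hypothesis hab : a ⊆ b.
Hypothesis Rmono : forall p q x y, p ∈ P -> q ∈ P -> le q p -> R p x y -> R q x y.
Hypothesis Rdom : forall p x y, R p x y -> x ∈ a /\ y ∈ b.
Hypothesis Rfun : forall p x y y', p ∈ P -> R p x y -> R p x y' -> y = y'.
Hypothesis Ronto : forall p y, p ∈ P -> y ∈ b -> exists q x, q ∈ P /\ le q p /\ R q x y.

(** Minimality is taken against every preimage that a stronger condition could still decide, so the
    relation persists and has at most one value of [x] for each [y]. *)
Definition least_preimage p x y : Prop :=
  R p x y /\ forall x' q, x' ∈ x -> q ∈ P -> le q p -> ~ R q x' y.

(** Sending each [y] to its least preimage gives a decided injection of [b] into [a], and the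
    inclusion of [a] in [b] is the other injection. *)
Lemma forces_equinum_of_surjection p : p ∈ P ->
  forces P le p (FEquinum (check P a) (check P b)).
Proof.
  assert (lt : forall p q r, p ∈ P -> q ∈ P -> r ∈ P -> le p q -> le q r -> le p r)
    by apply hpo.
  assert (lr : forall p, p ∈ P -> le p p) by apply hpo.
  apply (forces_schroeder_bernstein P le hpo a b least_preimage hab).
  - intros q r x y hq hr hrq [h1 h2]. split; [apply (Rmono q); auto|].
    intros x' s hx' hs hsr. apply h2; eauto.
  - intros q x y [h _]. exact (Rdom _ _ _ h).
  - intros q x x' y hq [h1 h2] [h3 h4].
    destruct (Rdom _ _ _ h1) as [hx _]. destruct (Rdom _ _ _ h3) as [hx' _].
    destruct (ord_tricho x x' (ord_elem _ _ ha hx) (ord_elem _ _ ha hx')) as [i | [i | i]].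
    + destruct (h4 x q i hq (lr q hq) h1).
    + exact i.
    + destruct (h2 x' q i hq (lr q hq) h3).
  - intros q x y y' hq [h1 _] [h2 _]. apply (Rfun q x); auto.
  - intros q y hq hy. destruct (Ronto q y hq hy) as (r & x & hr & hrq & hR).
    (* Minimize over all conditions below [q], then pass to one that decides the minimum: nothing
       below it can decide a smaller preimage. *)
    destruct (ord_least (fun x => exists r, r ∈ P /\ le r q /\ R r x y) x)
      as (x0 & ox0 & (s & hs & hsq & hR0) & hmin).
    { exact (ord_elem _ _ ha (proj1 (Rdom _ _ _ hR))). }
    { eauto. }
    exists s, x0. split; [exact hs|]. split; [exact hsq|]. split; [exact hR0|].
    intros x' t hx' ht hts hR'. apply (mem_irrefl x'). apply (hmin x'); [|eauto 6|exact hx'].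
    exact (ord_elem _ _ ox0 hx').
Qed.

End Surjection.

(** * Countable sets closed under functions *)

Section ClosedSets.

Context {U : universe}.
Variables (X x0 : U) (fs : nat -> U -> U).
Hypothesis hx0 : x0 ∈ X.
Hypothesis hfs : forall n x, x ∈ X -> fs n x ∈ X.

Definition closed_sets : U := setof (fun c =>
  c ⊆ X /\ countable c /\ x0 ∈ c /\ forall n x, x ∈ c -> fs n x ∈ c).

Lemma closed_sets_spec c : c ∈ closed_sets <->
  c ⊆ X /\ countable c /\ x0 ∈ c /\ forall n x, x ∈ c -> fs n x ∈ c.
Proof.
  apply (setof_spec (fun c =>
    c ⊆ X /\ countable c /\ x0 ∈ c /\ forall n x, x ∈ c -> fs n x ∈ c)).
  apply is_set_sub with (powerset X). intros z (h & _). apply powerset_spec, h.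
Qed.

Lemma step_exists : exists step : U -> U, forall c z, z ∈ step c <->
  z ∈ c \/ exists n x, x ∈ c /\ z = fs n x.
Proof.
  apply (choice (fun c d => forall z, z ∈ d <-> z ∈ c \/ exists n x, x ∈ c /\ z = fs n x)).
  intro c. set (s := setof (fun z => exists n, z = img c (fs n))).
  assert (hs : forall z, z ∈ s <-> exists n, z = img c (fs n)).
  { exact (setof_spec _ (is_set_range (fun n => img c (fs n)))). }
  destruct (is_set_union c (union s)) as [d hd]. exists d. intro z. rewrite hd.
  apply or_iff_compat_l. rewrite union_spec. split.
  - intros (y & hy & hz). apply hs in hy. destruct hy as [n ->]. apply img_spec in hz.
    destruct hz as (x & hx & ->). eauto.
  - intros (n & x & hx & ->). exists (img c (fs n)). rewrite hs, img_spec. eauto.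
Qed.

Lemma club_closed_sets : club_countable X closed_sets.
Proof.
  split; [|split].
  - intros c hc. apply closed_sets_spec in hc. tauto.
  - intros c hcX hc. destruct step_exists as [step hstep].
    destruct (is_set_union c (upair x0 x0)) as [c0 hc0].
    set (s := fun n => Nat.iter n step c0).
    assert (hsX : forall n, s n ⊆ X).
    { induction n as [|n IH]; intros z hz; simpl in hz.
      - apply hc0 in hz. rewrite upair_spec in hz. destruct hz as [hz | [-> | ->]]; auto.
      - apply hstep in hz. destruct hz as [hz | (m & x & hx & ->)]; auto. }
    assert (hscnt : forall n, cnt (s n)).
    { induction n as [|n IH]; simpl.
      - apply cnt_bigunion with (fun n => match n with 0 => c | _ => upair x0 x0 end).
        + intros [|n]; [apply countable_cnt, hc|apply cnt_upair].
        + intros z hz. apply hc0 in hz. destruct hz; [exists 0 | exists 1]; auto.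
      - apply cnt_bigunion with (fun k => match k with 0 => s n | S m => img (s n) (fs m) end).
        + intros [|m]; [exact IH|apply cnt_img, IH].
        + intros z hz. apply hstep in hz. destruct hz as [hz | (m & x & hx & ->)].
          * exists 0. exact hz.
          * exists (S m). apply img_spec. eauto. }
    set (b := setof (fun z => exists n, z ∈ s n)).
    assert (hb : forall z, z ∈ b <-> exists n, z ∈ s n).
    { apply setof_spec. apply is_set_sub with X. intros z [n hz]. exact (hsX n z hz). }
    exists b. split.
    + apply closed_sets_spec. split; [|split; [|split]].
      * intros z hz. apply hb in hz. destruct hz as [n hz]. exact (hsX n z hz).
      * apply countable_cnt. apply cnt_bigunion with s; [exact hscnt|].
        intros z hz. apply hb, hz.
      * apply hb. exists 0. apply hc0. right. apply upair_spec. auto.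
      * intros n x hx. apply hb in hx. destruct hx as [m hx]. apply hb. exists (S m).
        apply hstep. eauto.
    + intros z hz. apply hb. exists 0. apply hc0. auto.
  - intros s hs.
    assert (hs' : forall n, s n ⊆ X /\ countable (s n) /\ x0 ∈ s n /\
      forall m x, x ∈ s n -> fs m x ∈ s n).
    { intro n. apply closed_sets_spec, hs. }
    assert (hb : forall z, z ∈ setof (fun z => exists n, z ∈ s n) <-> exists n, z ∈ s n).
    { apply setof_spec. apply is_set_sub with X. intros z [n hz]. exact (proj1 (hs' n) z hz). }
    apply closed_sets_spec. split; [|split; [|split]].
    + intros z hz. apply hb in hz. destruct hz as [n hz]. exact (proj1 (hs' n) z hz).
    + apply countable_cnt. apply cnt_bigunion with s.
      * intro n. apply countable_cnt, hs'.
      * intros z hz. apply hb, hz.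
    + apply hb. exists 0. apply hs'.
    + intros n x hx. apply hb in hx. destruct hx as [m hx]. apply hb. exists m.
      apply hs', hx.
Qed.

End ClosedSets.

(** * Coherent adequate type forcings *)

Section CoherentAdequateType.

Context {U : universe}.
Variables (lam Y r S YY P : U) (le : U -> U -> Prop).
Hypothesis hlam : ordinal lam.
Hypothesis hge : omega2 ⊆ lam.
Hypothesis hcf : ~ countable (cf lam).
Hypothesis hcont : continuum ∈ lam.
Hypothesis hr : is_bij r continuum (powerset omega).
Hypothesis hYZ : codes (H lam) Y (Zrel r).
Hypothesis hSstat : stationary_omega2 (setof (fun alpha => alpha ∈ S /\ cf alpha = omega1)).
Hypothesis hYY : YY ⊆ XX lam Y.
Hypothesis hYYstat : stationary_countable (H lam) YY.
Hypothesis hP : coherent_adequate_type lam Y S YY P le.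

Lemma omega_in_lam : omega ∈ lam.
Proof.
  apply hge. exact (ord_trans _ _ _ ord_omega2 omega1_in_omega2 omega_in_omega1).
Qed.

Definition has_model (k : nat) (p M : U) : Prop :=
  exists xs A, length xs = k /\ p = tuple xs A /\ M ∈ A.

(** Hides the tuple format. What remains is that conditions carry models, keep them when extended,
    are strongly generic for them, and can acquire any model of [YY] containing them; the latter is
    the amalgamation clause for a single model. *)
Lemma side_conditions : exists has : U -> U -> Prop,
  (forall p q M, p ∈ P -> q ∈ P -> le q p -> has p M -> has q M) /\
  (forall p M, p ∈ P -> has p M -> M ∈ YY /\ strongly_generic P le M p) /\
  (forall p M N, p ∈ P -> has p M -> has p N ->
     exists A, coherent_adequate lam Y A /\ M ∈ A /\ N ∈ A) /\
  (forall p N, p ∈ P -> N ∈ YY -> p ∈ N -> exists q, q ∈ P /\ le q p /\ has q N) /\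
  P ⊆ H lam.
Proof.
  destruct hP as (hpo & k & hform & hmono & hfin & hside & _ & hadd & hgen).
  exists (has_model k). split; [|split; [|split; [|split]]].
  - intros p q M hp hq hqp (xs & A & hl & -> & hM).
    destruct (hform q hq) as (ys & B & hl' & ->). exists ys, B.
    split; [exact hl'|]. split; [reflexivity|]. exact (hmono xs A ys B hl hl' hp hq hqp M hM).
  - intros p M hp (xs & A & hl & -> & hM). split; [|apply hgen; auto].
    destruct (hside xs A hl hp) as (_ & h & _). auto.
  - intros p M N hp (xs & A & hl & -> & hM) (ys & B & hl' & e & hN).
    exists A. split; [apply (hside xs A hl hp)|]. split; [exact hM|].
    (* Two readings of one condition as a tuple are compared through reflexivity of [le] and
       persistence of side conditions, which give [B ⊆ A]; injectivity of [tuple] is not invoked. *)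
    assert (hp' : tuple ys B ∈ P) by (rewrite <- e; exact hp).
    apply (hmono ys B xs A hl' hl hp' hp); [|exact hN]. rewrite <- e. apply hpo, hp.
  - intros p N hp hN hpN. destruct (hform p hp) as (xs & A & hl & ->).
    assert (eN : forall M, M ∈ upair N N -> M = N).
    { intros M h. apply upair_spec in h. tauto. }
    destruct (hadd (upair N N)) with (xs := xs) (A := A)
      as (ys & B & hl' & hq & hqp & hB); auto.
    + exists (N :: nil). intro z. rewrite upair_spec. simpl. split; intro h; intuition.
    + exists N. apply upair_spec. auto.
    + intros M hM. rewrite (eN M hM). exact hN.
    + intros M M' hM hM'. rewrite (eN M hM), (eN M' hM'). apply isomorphic_refl.
    + apply singleton_S_coherent_adequate; auto.
    + intros M hM. rewrite (eN M hM). exact hpN.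
    + exists (tuple ys B). split; [exact hq|]. split; [exact hqp|]. exists ys, B.
      split; [exact hl'|]. split; [reflexivity|]. apply hB, upair_spec. auto.
  - intros p hp. destruct (hform p hp) as (xs & A & hl & ->).
    apply H_tuple; auto using omega_in_lam.
    + intros x hx. destruct (hfin xs A hl hp x hx) as [h1 h2].
      apply H_countable; auto using omega_in_lam, cnt_finite.
    + destruct (hside xs A hl hp) as (h1 & h2 & _).
      apply H_countable; auto using omega_in_lam, cnt_finite.
      intros M hM. apply (model_in_H lam Y); auto using omega_in_lam.
Qed.

Lemma closed_model p (fs : nat -> U -> U) : p ∈ P ->
  (forall n x, x ∈ H lam -> fs n x ∈ H lam) ->
  exists N, N ∈ YY /\ p ∈ N /\ forall n x, x ∈ N -> fs n x ∈ N.
Proof.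
  intros hp hfs. destruct side_conditions as (_ & _ & _ & _ & _ & hPH).
  destruct (hYYstat (closed_sets (H lam) p fs)) as (N & hN & hNY).
  { apply club_closed_sets; auto. }
  apply closed_sets_spec in hN. exists N. tauto.
Qed.

(** Extend [q] to carry a model [N], then to [s] sending [delta N] to some [n]. The conditions in
    [N] that either decide some [x] of [N] to be sent to [n], or have no extension sending a member
    of [omega1] to [n], are dense in the poset of [N]. Strong genericity makes one of them
    compatible with [s]. The second kind is refuted by the common extension, and the first gives
    [x = delta N], which is not in [N]. *)
Lemma no_decided_injection q (Q : U -> U -> nat -> Prop) : q ∈ P ->
  ~ decides_injection P le q omega1 Q.
Proof.
  intros hq (Qmono & Qtotal & Qinj).
  assert (hpo : forcing_poset P le) by apply hP.
  destruct side_conditions as (has & hmono & hgen & _ & hadd & hPH).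
  set (Ext := fun n u v => v ∈ P /\ le v u /\ exists x, x ∈ omega1 /\ Q v x n).
  (* A choice of extensions under which [N] will be closed; the default [u] keeps the function
     inside [H lam]. *)
  set (ext := fun n u => if excluded_middle_informative (exists v, Ext n u v)
    then epsilon (inhabits empty) (Ext n u) else u).
  set (Val := fun n v x => x ∈ omega1 /\ Q v x n).
  set (val := fun n v => if excluded_middle_informative (exists x, Val n v x)
    then epsilon (inhabits empty) (Val n v) else v).
  assert (hext : forall n u, (exists v, Ext n u v) -> Ext n u (ext n u)).
  { intros n u h. unfold ext. destruct excluded_middle_informative; [|tauto].
    apply epsilon_spec, h. }
  assert (hext' : forall n u, ~ (exists v, Ext n u v) -> ext n u = u).
  { intros n u h. unfold ext. destruct excluded_middle_informative; tauto. }
  assert (hval : forall n v, (exists x, Val n v x) -> Val n v (val n v)).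
  { intros n v h. unfold val. destruct excluded_middle_informative; [|tauto].
    apply epsilon_spec, h. }
  (* One sequence of unary functions carries both families: the Cantor code of [(n, 0)] stands for
     [ext n], every other code with first component [n] for [val n]. *)
  destruct (closed_model q (fun k => match of_nat k with
    | (n, 0) => ext n | (n, _) => val n end) hq) as (N & hN & hqN & hcl).
  { intros k x hx. destruct (of_nat k) as [n [|m]].
    - destruct (classic (exists v, Ext n x v)) as [h | h].
      + apply hPH. apply (hext n x h).
      + rewrite (hext' n x h). exact hx.
    - unfold val. destruct excluded_middle_informative as [h | h]; [|exact hx].
      destruct (epsilon_spec (inhabits empty) _ h) as [h1 _].
      apply H_ord; [exact hlam|]. apply hge.
      exact (ord_trans _ _ _ ord_omega2 omega1_in_omega2 h1). }
  assert (hextN : forall n u, u ∈ N -> ext n u ∈ N).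
  { intros n u hu. specialize (hcl (to_nat (n, 0)) u hu). rewrite cancel_of_to in hcl.
    exact hcl. }
  assert (hvalN : forall n u, u ∈ N -> val n u ∈ N).
  { intros n u hu. specialize (hcl (to_nat (n, 1)) u hu). rewrite cancel_of_to in hcl.
    exact hcl. }
  destruct (hadd q N hq hN hqN) as (q' & hq' & hqq & hhas).
  pose proof (hYY N hN) as hNX.
  pose proof (delta_in_omega1 lam Y hlam hcf omega_in_lam N hNX) as hd.
  destruct (Qtotal q' (delta N) hq' hqq hd) as (s & n & hs & hsq & hQ).
  (* [Dec] is defined from the external relation [Q] and need not belong to [N]; strong genericity
     admits every dense subset of the poset of [N]. *)
  set (Dec := fun d => d ∈ inter N P /\
    ((exists x, x ∈ N /\ x ∈ omega1 /\ Q d x n) \/ ~ exists v, Ext n d v)).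
  assert (hDec : forall d, d ∈ setof Dec <-> Dec d).
  { apply setof_spec. apply is_set_sub with (inter N P). intros z [h _]; exact h. }
  destruct (proj2 (hgen q' N hq' hhas) (setof Dec)) with (r := s)
    as (d & t & hdD & ht & hts & htd); auto.
  - intros d h. apply hDec in h. apply h.
  - intros u hu. destruct (proj1 (inter_spec _ _ _) hu) as [huN huP].
    destruct (classic (exists v, Ext n u v)) as [h | h].
    + destruct (hext n u h) as (h1 & h2 & h3). exists (ext n u). split; [|exact h2].
      apply hDec. split; [apply inter_spec; auto|]. left. exists (val n (ext n u)).
      split; [auto|]. exact (hval n _ h3).
    + exists u. split; [|apply hpo, huP]. apply hDec. split; [exact hu|]. auto.
  - apply hDec in hdD. destruct hdD as [hdi hdD]. apply inter_spec in hdi.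
    destruct hdi as [_ hdP]. pose proof (Qmono s t _ _ hs ht hts hQ) as hQt.
    destruct hdD as [(x & hxN & hxw & hQd) | no].
    + apply (delta_notin lam Y hlam hcf omega_in_lam N hNX).
      replace (delta N) with x; [exact hxN|].
      apply (Qinj t x (delta N) n); auto.
      * assert (lt := proj2 (proj2 hpo)).
        apply (lt t s); auto. apply (lt s q'); auto.
      * apply (Qmono d); auto.
    + apply no. exists t. split; [exact ht|]. split; [exact htd|]. eauto.
Qed.

Lemma forces_equinum_continuum p : p ∈ P ->
  forces P le p (FEquinum (check P omega1) (check P continuum)).
Proof.
  assert (hpo : forcing_poset P le) by apply hP.
  destruct side_conditions as (has & hmono & hgen & hcoh & hadd & hPH).
  destruct (infinite_absorbs_nat (omega1 (U := U)) ord_omega1 omega_sub_omega1) as (pr & pr1 & pr2).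
  (* The enumeration is chosen for the trace and not for the model, so models with equal traces give
     equal values; this makes [R] functional. *)
  set (enum := fun c : U => epsilon (inhabits (fun _ : nat => empty))
    (fun f : nat -> U => forall z, z ∈ c -> exists n, z = f n)).
  assert (henum : forall c, cnt c -> forall z, z ∈ c -> exists n, z = enum c n).
  { intros c hc. exact (epsilon_spec (inhabits (fun _ : nat => empty)) _ hc). }
  set (R := fun p x y => p ∈ P /\ exists M n, has p M /\ x = pr (delta M) n /\
    y = enum (inter M continuum) n /\ y ∈ inter M continuum).
  assert (hdelta : forall p M, p ∈ P -> has p M -> delta M ∈ omega1).
  { intros q M hq hM. apply (delta_in_omega1 lam Y); auto using omega_in_lam.
    apply hYY, (hgen q M hq hM). }
  apply (forces_equinum_of_surjection P le hpo omega1 continuum R ord_omega1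
    omega1_sub_continuum).
  - intros q s x y hq hs hsq (_ & M & n & hM & H). split; [exact hs|]. exists M, n. eauto.
  - intros q x y (hq & M & n & hM & -> & _ & hy). split; [eauto|].
    apply inter_spec in hy. apply hy.
  - intros q x y y' hq (_ & M & n & hM & -> & -> & _) (_ & M' & n' & hM' & e & -> & _).
    apply pr2 in e; eauto. destruct e as [e ->].
    destruct (hcoh q M M' hq hM hM') as (A & hA & i1 & i2).
    rewrite (coherent_same_continuum lam Y hlam hcf omega_in_lam A M M' r); auto.
  - intros q y hq hy.
    (* Closure under the constant function with value [y] puts the index [y] into [N]. *)
    destruct (closed_model q (fun _ _ => y) hq) as (N & hN & hqN & hcl).
    { intros _ _ _. apply H_ord; [exact hlam|]. exact (ord_trans _ _ _ hlam hcont hy). }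
    destruct (hadd q N hq hN hqN) as (s & hs & hsq & hhas).
    assert (hyN : y ∈ inter N continuum).
    { apply inter_spec. split; [exact (hcl 0 q hqN)|exact hy]. }
    destruct (henum (inter N continuum)) with (z := y) as [n hn].
    { apply cnt_sub with N; [apply (model_cnt lam Y), hYY, hN|].
      intros z hz. apply inter_spec in hz. apply hz. }
    { exact hyN. }
    exists s, (pr (delta N) n). split; [exact hs|]. split; [exact hsq|].
    split; [exact hs|]. exists N, n. auto.
Qed.

End CoherentAdequateType.

Theorem theorem3p2 (U : universe)
  (lam Y : U) (W : U -> U -> Prop) (r : U)
  (hcard : is_cardinal lam) (hge : omega2 ⊆ lam)
  (hcf : ~ countable (cf lam)) (hcont : continuum ∈ lam)
  (hY : Y ⊆ H lam)
  (hW : well_ordering (H lam) W) (hYW : codes (H lam) Y W)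
  (hr : least_enumeration W r) (hYZ : codes (H lam) Y (Zrel r))
  (S YY : U)
  (hS : S ⊆ omega2)
  (hSstat : stationary_omega2 (setof (fun alpha => alpha ∈ S /\ cf alpha = omega1)))
  (hYY : YY ⊆ XX lam Y)
  (hYYstat : stationary_countable (H lam) YY)
  (hYYiso : closed_under_iso Y YY)
  (P : U) (le : U -> U -> Prop)
  (hP : coherent_adequate_type lam Y S YY P le) :
  collapses_to_omega1 P le continuum.
Proof.
  destruct hcard as [hlam _]. destruct hr as [hr' _].
  intros p hp. split.
  - apply forces_omega1; [apply hP|exact hp|]. intros q Q hq.
    apply (no_decided_injection lam Y S YY); auto.
  - apply (forces_equinum_continuum lam Y r S YY P le); auto.
Qed.
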